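(* Let $q>1$, $q'=q/(q-1)$, $a=(2-q)/(q-1)$, and $\mathbb{R}^{N+}=\{x\in\mathbb{R}^N:x_1>0\}$. There exists a positive classical solution $U$ of (E) in $Q_{\mathbb{R}^N,\infty}$, depending only on $x_1$ and self-similar, of the form $U(x,t)=t^{-a/2}f(t^{-1/2}x_1)$ with $f\in C^2(\mathbb{R})$, $f>0$, which has initial trace $(\overline{\mathbb{R}^{N+}},0)$, and $$\lim_{\eta\to\infty}\eta^{-q'}f(\eta)=c_q:=(q')^{-q'}\Big(\frac1{q-1}\Big)^{\frac1{q-1}},\qquad \lim_{\eta\to-\infty}e^{\eta^2/4}(-\eta)^{-\frac{3-2q}{q-1}}f(\eta)=C>0 .$$ In particular, as $t\to0$, $U(x,t)$ behaves like $c_q x_1^{q'}t^{-1/(q-1)}$ for fixed $x$ with $x_1>0$, $U(x,t)=f(0)t^{-a/2}$ for $x_1=0$, and for fixed $t>0$, $U(x,t)\sim c_q t^{-1/(q-1)}x_1^{q'}$ as $x_1\to\infty$.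
   Context: Equation (E) is $u_t-\Delta u+|\nabla u|^q=0$, $Q_{\mathbb{R}^N,T}=\mathbb{R}^N\times(0,T)$. A classical solution is $u\in C^{2,1}(Q_{\mathbb{R}^N,T})$ satisfying (E) pointwise. A nonnegative solution $u$ has initial trace $(\mathcal{S},u_0)$, where $\mathcal{S}\subset\mathbb{R}^N$ is closed, $\mathcal{R}=\mathbb{R}^N\setminus\mathcal{S}$ and $u_0$ is a nonnegative Radon measure on $\mathcal{R}$, if $\lim_{t\to0}\int_{\mathcal{R}}u(\cdot,t)\psi\,dx=\int_{\mathcal{R}}\psi\,du_0$ for all $\psi\in C_c(\mathcal{R})$ and $\lim_{t\to0}\int_{B(x_0,\varepsilon)}u(\cdot,t)dx=\infty$ for all $x_0\in\mathcal{S}$, $\varepsilon>0$. The trace $(\overline{\mathbb{R}^{N+}},0)$ means $\mathcal{S}=\{x_1\ge0\}$ and $u_0=0$ on $\{x_1<0\}$. *)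

(* Defs.v *)
From Stdlib Require Import Reals Lra ClassicalDescription ClassicalEpsilon.
Open Scope R_scope.

(* Points of R^N are functions nat -> R; only coordinates 0..N-1 matter.
   Coordinate 0 is the paper's x_1. *)
Definition pt := nat -> R.

Definition upd (x : pt) (i : nat) (s : R) : pt :=
  fun j => if Nat.eqb j i then s else x j.

(* x^q for x >= 0, q > 0, with 0^q = 0 (Stdlib's Rpower 0 q = 1). *)
Definition rpow (x q : R) : R := if Rlt_dec 0 x then Rpower x q else 0.

Definition sumN (N : nat) (g : nat -> R) : R :=
  match N with O => 0 | S n => sum_f_R0 g n end.

Definition close (N : nat) (x y : pt) (d : R) : Prop :=
  forall i, (i < N)%nat -> Rabs (y i - x i) < d.

Definition cont_Q (N : nat) (g : pt -> R -> R) : Prop :=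
  forall x t, 0 < t -> forall eps, 0 < eps -> exists d, 0 < d /\
    forall y s, 0 < s -> Rabs (s - t) < d -> close N x y d ->
      Rabs (g y s - g x t) < eps.

Definition classical_solution (N : nat) (q : R) (u : pt -> R -> R) : Prop :=
  exists (ut : pt -> R -> R) (ux : nat -> pt -> R -> R)
         (uxx : nat -> nat -> pt -> R -> R),
    cont_Q N u /\ cont_Q N ut /\
    (forall i, (i < N)%nat -> cont_Q N (ux i)) /\
    (forall i j, (i < N)%nat -> (j < N)%nat -> cont_Q N (uxx i j)) /\
    (forall x t, 0 < t -> derivable_pt_lim (fun s => u x s) t (ut x t)) /\
    (forall i x t, (i < N)%nat -> 0 < t ->
        derivable_pt_lim (fun s => u (upd x i s) t) (x i) (ux i x t)) /\
    (forall i j x t, (i < N)%nat -> (j < N)%nat -> 0 < t ->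
        derivable_pt_lim (fun s => ux i (upd x j s) t) (x j) (uxx i j x t)) /\
    (forall x t, 0 < t ->
        ut x t - sumN N (fun i => uxx i i x t)
          + rpow (sqrt (sumN N (fun i => (ux i x t) ^ 2))) q = 0).

(* Midpoint Riemann sum of g over the cube [-R,R]^N with (S n)^N cells. *)
Fixpoint gsum (d n : nat) (R0 : R) (g : pt -> R) (x : pt) : R :=
  match d with
  | O => g x
  | S d' => sum_f_R0 (fun k =>
        gsum d' n R0 g (upd x d' (- R0 + (2 * INR k + 1) * R0 / INR (S n)))
          * (2 * R0 / INR (S n))) n
  end.

(* limit of a sequence (0 if it does not converge) *)
Definition lim_seq (s : nat -> R) : R :=
  match excluded_middle_informative (exists l, Un_cv s l) with
  | left H => proj1_sig (constructive_indefinite_description _ H)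
  | right _ => 0
  end.

Definition intBox (N : nat) (R0 : R) (g : pt -> R) : R :=
  lim_seq (fun n => gsum N n R0 g (fun _ => 0)).

Definition intBall (N : nat) (x0 : pt) (r : R) (g : pt -> R) : R :=
  intBox N (r + sumN N (fun i => Rabs (x0 i)))
    (fun x => if Rlt_dec (sumN N (fun i => (x i - x0 i) ^ 2)) (r ^ 2)
              then g x else 0).

Definition Cc_neg (N : nat) (psi : pt -> R) (R0 : R) : Prop :=
  (forall x eps, 0 < eps -> exists d, 0 < d /\
      forall y, close N x y d -> Rabs (psi y - psi x) < eps) /\
  0 < R0 /\
  exists d, 0 < d /\ forall x,
    ((exists i, (i < N)%nat /\ R0 <= Rabs (x i)) \/ - d < x O) -> psi x = 0.

(* initial trace (closure of R^{N+}, 0):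
   S = {x_1 >= 0}, u_0 = 0 on R = {x_1 < 0} *)
Definition trace_halfspace (N : nat) (u : pt -> R -> R) : Prop :=
  (forall psi R0, Cc_neg N psi R0 ->
     forall eps, 0 < eps -> exists d, 0 < d /\ forall t, 0 < t < d ->
       Rabs (intBox N R0 (fun x => u x t * psi x)) < eps) /\
  (forall x0 r, 0 <= x0 O -> 0 < r ->
     forall M, exists d, 0 < d /\ forall t, 0 < t < d ->
       M < intBall N x0 r (fun x => u x t)).

Definition C2 (f : R -> R) : Prop :=
  exists f1 f2 : R -> R,
    (forall x, derivable_pt_lim f x (f1 x)) /\
    (forall x, derivable_pt_lim f1 x (f2 x)) /\ continuity f2.

(* Main.v *)
Require Import Defs.
From Coquelicot Require Import Coquelicot.
From Stdlib Require Import Reals Lra Lia Classical ClassicalDescription ClassicalEpsilon.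
Open Scope R_scope.

(** The profile solves [f'' + (t/2) f' + (a/2) f = (f')^q] and is found by shooting from the left.
    Write [g = f'], [k = g'] and [Y = q g^(q-1)] ([drift] below).  Start at [t = -n] from [f = 0], [g = gam > 0].
    Up to a fixed time [-S] one has [f <= 4 g / (-t)], so [k > 0].  Afterwards there are two disjoint
    open outcomes: [k] becomes negative (small [gam]), or [Y - t] exceeds a constant [K] while
    increasing (large [gam]), which traps the solution in [k > 0].  By connectedness some [gam] has
    neither outcome, and then [k >= 0] and [Y <= t + K] throughout.  Letting [n] tend to infinity gives
    an entire solution with [k >= 0], [Y <= t + K] for [t >= -S] and [f <= 4 g / (-t)] for [t <= -S].

    At [+oo] the mirror trap ([Y - t] very negative and decreasing forces [k < 0]) shows that [Y - t] is
    bounded, whence [f ~ cq t^q'].  At [-oo] the ratio [f / g] satisfies a Riccati equation whose only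
    bounded solutions are [2/(-t) + O((-t)^(-3))]; hence [ln g + t^2/4 - a ln (-t)] has a summable
    derivative and converges.

    For the trace, the midpoint sums over a ball are compared with those of a common refinement of the
    two grids: a line in the first coordinate direction meets the sphere in at most two points, so few
    cells contribute a non-small difference. *)

(** Why these quantities. Differentiating the profile equation gives [k' = (Y - t/2) k - (a+1)/2 g].
    The number [a] changes sign at [q = 2], but [a + 1 = 1/(q-1)] is always positive, so a zero of
    [k] can only be crossed downwards. With [f''] dropped, the profile equation is solved exactly by
    [cq t^q'], for which [Y = t]; hence [Y - t] is what has to be controlled at infinity. The
    identity [(a+1)(q-1) = 1] makes the coefficients collapse exactly where the slope of [Y] is 1.

    The obstacle is that the power is superlinear: trajectories may blow up before time [n], and
    then no shooting map is defined on a whole interval of [gam]. The power is therefore continued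
    linearly above a level [M] with [q M^(q-1) = 2n + K + 2]: high enough for the trap to survive in
    the linear range and for the selected solution never to exceed [M], so that it solves the
    original equation. The limit in [n] needs bounds free of [n], above all [g(-S) >= gam0], which
    keeps the limit from being the zero solution. *)

(** * Calculus on intervals *)

(* [auto_derive] with the derivatives of opaque functions read off from the context. *)
Ltac derive_ctx :=
  auto_derive;
  [ repeat match goal with
    | |- _ /\ _ => split
    | |- True => exact I
    | H : is_derive _ ?x _ |- ex_derive _ ?x => eexists; exact H
    | |- _ => lra
    end
  | repeat match goal with
    | H : is_derive ?f ?x ?v |- context [Derive ?g ?x] =>
        unify f g; rewrite (is_derive_unique g x v H)
    end ].

Lemma fun_choice (A B : Type) (P : A -> B -> Prop) :
  (forall x, exists y, P x y) -> exists f, forall x, P x (f x).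
Proof.
  intros H. exists (fun x => proj1_sig (constructive_indefinite_description _ (H x))).
  intros x. exact (proj2_sig (constructive_indefinite_description _ (H x))).
Qed.

Lemma Un_cv_const (c : R) : Un_cv (fun _ => c) c.
Proof. intros eps He. exists O. intros n _. unfold Rdist. rewrite Rminus_diag, Rabs_R0. exact He. Qed.

Lemma locally_gt (c x : R) : c < x -> locally x (fun y => c < y).
Proof. apply (open_gt c x). Qed.

Lemma locally_lt (c x : R) : x < c -> locally x (fun y => y < c).
Proof. apply (open_lt c x). Qed.

Lemma is_derive_eq (f : R -> R) (x u v : R) :
  is_derive f x u -> u = v -> is_derive f x v.
Proof. now intros H <-. Qed.

Lemma is_derive_continuity_pt (f : R -> R) (x v : R) :
  is_derive f x v -> continuity_pt f x.
Proof.
  intros H. apply derivable_continuous_pt. exists v. now apply is_derive_Reals.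
Qed.

Lemma nondecreasing_of_derive (h dh : R -> R) (a b : R) :
  (forall x, a <= x <= b -> is_derive h x (dh x)) ->
  (forall x, a < x < b -> 0 <= dh x) -> a <= b -> h a <= h b.
Proof.
  intros Hd Hp Hab.
  destruct (Req_dec a b) as [->|Hne]; [lra|].
  destruct (MVT_cor2 h dh a b) as [c [Hc1 Hc2]]; [lra| |].
  - intros c Hc. apply is_derive_Reals, Hd, Hc.
  - specialize (Hp c Hc2). nra.
Qed.

Lemma increasing_of_derive (h dh : R -> R) (a b : R) :
  (forall x, a <= x <= b -> is_derive h x (dh x)) ->
  (forall x, a < x < b -> 0 < dh x) -> a < b -> h a < h b.
Proof.
  intros Hd Hp Hab.
  destruct (MVT_cor2 h dh a b) as [c [Hc1 Hc2]]; [lra| |].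
  - intros c Hc. apply is_derive_Reals, Hd, Hc.
  - specialize (Hp c Hc2). nra.
Qed.

Lemma nonincreasing_of_derive (h dh : R -> R) (a b : R) :
  (forall x, a <= x <= b -> is_derive h x (dh x)) ->
  (forall x, a < x < b -> dh x <= 0) -> a <= b -> h b <= h a.
Proof.
  intros Hd Hp Hab.
  enough (- h a <= - h b) by lra.
  apply (nondecreasing_of_derive (fun x => - h x) (fun x => - dh x)); auto.
  - intros x Hx. apply (is_derive_opp h). auto.
  - intros x Hx. specialize (Hp x Hx). lra.
Qed.

Lemma continuity_pt_eps (f : R -> R) (x eps : R) :
  continuity_pt f x -> 0 < eps ->
  exists d, 0 < d /\ forall y, Rabs (y - x) < d -> Rabs (f y - f x) < eps.
Proof.
  intros Hc He. destruct (Hc eps He) as [d [Hd H]].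
  exists d. split; [exact Hd|]. intros y Hy.
  destruct (Req_dec x y) as [<-|Hne].
  - rewrite Rminus_diag, Rabs_R0. exact He.
  - apply H. repeat split; auto.
Qed.

Lemma first_zero (h : R -> R) (a b : R) :
  a <= b -> (forall x, a <= x <= b -> continuity_pt h x) ->
  0 < h a -> h b <= 0 ->
  exists c, a < c <= b /\ h c = 0 /\ forall x, a <= x < c -> 0 < h x.
Proof.
  intros Hab Hc Ha Hb.
  pose (E := fun x => a <= x <= b /\ forall y, a <= y <= x -> 0 < h y).
  destruct (completeness E) as [c [Hub Hlub]].
  { exists b. intros x [Hx _]. lra. }
  { exists a. split; [lra|]. intros y Hy. now replace y with a by lra. }
  assert (Hac : a <= c).
  { apply Hub. split; [lra|]. intros y Hy. now replace y with a by lra. }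
  assert (Hcb : c <= b).
  { apply Hlub. intros x [Hx _]. lra. }
  assert (Hbefore : forall x, a <= x < c -> 0 < h x).
  { intros x Hx. destruct (Rlt_dec 0 (h x)) as [H|H]; [exact H|exfalso].
    enough (c <= x) by lra. apply Hlub. intros y [Hy1 Hy2].
    destruct (Rle_dec y x) as [H1|H1]; [exact H1|].
    exfalso. apply H, Hy2. lra. }
  assert (H0 : h c = 0).
  { destruct (Rtotal_order (h c) 0) as [H|[H|H]]; [exfalso|exact H|exfalso].
    - destruct (continuity_pt_eps h c (- h c) (Hc c (conj Hac Hcb))) as [d [Hd Hd']]; [lra|].
      assert (a < c). { destruct (Req_dec a c) as [E'|]; [rewrite <- E' in H; lra|lra]. }
      pose (y := Rmax a (c - d / 2)).
      assert (a <= y < c /\ c - d / 2 <= y) as [Hy1 Hy2].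
      { unfold y. split; [split; [apply Rmax_l|]|apply Rmax_r]. apply Rmax_lub_lt; lra. }
      specialize (Hbefore y Hy1). specialize (Hd' y).
      assert (Rabs (y - c) < d) as H1 by (apply Rabs_def1; lra).
      apply Hd' in H1. apply Rabs_def2 in H1. lra.
    - destruct (continuity_pt_eps h c (h c) (Hc c (conj Hac Hcb))) as [d [Hd Hd']]; [lra|].
      assert (c < b). { destruct (Req_dec c b) as [E'|]; [rewrite E' in H; lra|lra]. }
      pose (y := Rmin b (c + d / 2)).
      assert (c < y <= b /\ y <= c + d / 2) as [Hy1 Hy2].
      { unfold y. split; [split; [|apply Rmin_l]|apply Rmin_r]. apply Rmin_glb_lt; lra. }
      enough (y <= c) by lra. apply Hub. split; [lra|]. intros z Hz.
      destruct (Rlt_dec z c) as [Hzc|Hzc]; [apply Hbefore; lra|].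
      assert (Rabs (z - c) < d) as H1 by (apply Rabs_def1; lra).
      apply Hd' in H1. apply Rabs_def2 in H1. lra. }
  exists c. repeat split; auto.
  destruct (Req_dec a c) as [E'|]; [rewrite E' in Ha; lra|lra].
Qed.

(* [h] cannot come down to zero: at its first zero the derivative would be nonpositive. *)
Lemma positive_barrier (h dh : R -> R) (a b : R) :
  (forall x, a <= x <= b -> is_derive h x (dh x)) -> 0 < h a ->
  (forall x, a < x <= b -> h x = 0 -> (forall y, a <= y < x -> 0 < h y) -> 0 < dh x) ->
  forall x, a <= x <= b -> 0 < h x.
Proof.
  intros Hd Ha Hbar x Hx.
  destruct (Rlt_dec 0 (h x)) as [H|H]; [exact H|exfalso].
  destruct (first_zero h a x) as [c [Hc1 [Hc2 Hc3]]]; try lra.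
  { intros y Hy. eapply is_derive_continuity_pt, Hd. lra. }
  assert (Hpos : 0 < dh c) by (apply Hbar; auto; lra).
  assert (D : derivable_pt_lim h c (dh c)) by (apply is_derive_Reals, Hd; lra).
  destruct (D _ Hpos) as [d Hdd].
  pose (e := Rmin (d / 2) (c - a)).
  assert (He : 0 < e) by (apply Rmin_glb_lt; [pose proof (cond_pos d)|]; lra).
  assert (He1 : e <= d / 2) by apply Rmin_l.
  assert (He2 : e <= c - a) by apply Rmin_r.
  pose proof (cond_pos d).
  assert (K : Rabs ((h (c + - e) - h c) / - e - dh c) < dh c).
  { apply Hdd; [lra|]. rewrite Rabs_Ropp, Rabs_right; lra. }
  assert (0 < h (c + - e)) by (apply Hc3; lra).
  rewrite Hc2 in K. apply Rabs_def2 in K.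
  assert ((h (c + - e) - 0) / - e < 0).
  { replace ((h (c + - e) - 0) / - e) with (- (h (c + - e) / e)) by (field; lra).
    enough (0 < h (c + - e) / e) by lra. apply Rdiv_lt_0_compat; lra. }
  lra.
Qed.

(** Connectedness of [[a, b]], through the supremum [c] of [A]: openness of [A] would carry [A] past
    [c], and openness of [B] would keep [A] out of a left neighbourhood of [c]. *)
Lemma open_disjoint_gap (A B : R -> Prop) (a b : R) :
  a <= b -> A a -> B b ->
  (forall x, a <= x <= b -> A x -> exists d, 0 < d /\ forall y, a <= y <= b -> Rabs (y - x) < d -> A y) ->
  (forall x, a <= x <= b -> B x -> exists d, 0 < d /\ forall y, a <= y <= b -> Rabs (y - x) < d -> B y) ->
  (forall x, a <= x <= b -> A x -> B x -> False) ->
  exists x, a <= x <= b /\ ~ A x /\ ~ B x.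
Proof.
  intros Hab Aa Bb OA OB Dis.
  destruct (completeness (fun x => a <= x <= b /\ A x)) as [c [Hub Hlub]].
  { exists b. intros x [Hx _]. lra. }
  { exists a. split; [lra|exact Aa]. }
  assert (Hac : a <= c) by (apply Hub; split; [lra|exact Aa]).
  assert (Hcb : c <= b) by (apply Hlub; intros x [Hx _]; lra).
  exists c. split; [lra|split; intros H].
  - destruct (OA c (conj Hac Hcb) H) as [d [Hd K]].
    assert (c < b). { destruct (Req_dec c b) as [->|]; [|lra]. exfalso. apply (Dis b); auto; lra. }
    pose (y := Rmin b (c + d / 2)).
    assert (c < y <= b /\ y <= c + d / 2) as [Hy1 Hy2].
    { unfold y. split; [split; [|apply Rmin_l]|apply Rmin_r]. apply Rmin_glb_lt; lra. }
    enough (y <= c) by lra. apply Hub. split; [lra|]. apply K; [lra|].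
    apply Rabs_def1; lra.
  - destruct (OB c (conj Hac Hcb) H) as [d [Hd K]].
    assert (c <= c - d); [|lra]. apply Hlub. intros y [Hy1 Hy2].
    assert (y <= c) by (apply Hub; auto).
    destruct (Rle_dec y (c - d)) as [|H1]; [assumption|exfalso].
    apply (Dis y); auto. apply K; auto. apply Rabs_def1; lra.
Qed.

Lemma exp_le (x y : R) : x <= y -> exp x <= exp y.
Proof. intros [H| ->]; [left; now apply exp_increasing|right; reflexivity]. Qed.

Lemma continuity_pt_open (h : R -> R) (x c : R) :
  continuity_pt h x -> c < h x -> exists d, 0 < d /\ forall y, Rabs (y - x) < d -> c < h y.
Proof.
  intros Hc Hx. destruct (continuity_pt_eps h x (h x - c) Hc) as [d [Hd K']]; [lra|].
  exists d. split; [exact Hd|]. intros y Hy. specialize (K' y Hy). apply Rabs_def2 in K'. lra.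
Qed.

Lemma lipschitz_continuity_pt (h : R -> R) (x C : R) :
  0 < C -> (forall y, Rabs (h y - h x) <= C * Rabs (y - x)) -> continuity_pt h x.
Proof.
  intros HC H eps He. exists (eps / C). split; [apply Rdiv_lt_0_compat; lra|].
  intros y [_ Hy]. simpl in *. unfold Rdist in *. eapply Rle_lt_trans; [apply H|].
  apply Rmult_lt_compat_l with (r := C) in Hy; [|exact HC].
  replace (C * (eps / C)) with eps in Hy by (field; lra). exact Hy.
Qed.

Lemma bounded_subsequence (u : nat -> R) (lo hi : R) :
  (forall n, lo <= u n <= hi) ->
  exists (phi : nat -> nat) (l : R), (forall n, (n <= phi n)%nat) /\ Un_cv (fun n => u (phi n)) l.
Proof.
  intros H.
  destruct (Bolzano_Weierstrass u (fun c => lo <= c <= hi) (compact_P3 lo hi) H) as [l Hl].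
  assert (P : forall n : nat, exists p, (n <= p)%nat /\ Rabs (u p - l) < / INR (S n)).
  { intros n. assert (Hn : 0 < / INR (S n)) by (apply Rinv_0_lt_compat, lt_0_INR; lia).
    apply (Hl (fun y => Rabs (y - l) < / INR (S n)) n).
    exists (mkposreal _ Hn). intros y Hy. exact Hy. }
  destruct (fun_choice _ _ _ P) as [phi Hphi].
  exists phi, l. split; [apply Hphi|].
  intros eps He. destruct (archimed_cor1 eps He) as [N [HN1 HN2]].
  exists N. intros n Hn. unfold Rdist. eapply Rlt_trans; [apply Hphi|].
  eapply Rle_lt_trans; [|exact HN1]. apply Rinv_le_contravar; [now apply lt_0_INR|].
  apply le_INR. lia.
Qed.

Lemma Un_cv_ge (u : nat -> R) (l c : R) (N : nat) :
  Un_cv u l -> (forall n, (N <= n)%nat -> c <= u n) -> c <= l.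
Proof.
  intros Hu H. apply Rnot_lt_le. intros Hlt.
  destruct (Hu (c - l) ltac:(lra)) as [N1 HN1].
  specialize (HN1 (max N N1) ltac:(lia)). specialize (H (max N N1) ltac:(lia)).
  unfold Rdist in HN1. apply Rabs_def2 in HN1. lra.
Qed.

Lemma Un_cv_squeeze (u d : nat -> R) (l C : R) (N : nat) :
  0 < C -> Un_cv d 0 -> (forall n, (N <= n)%nat -> Rabs (u n - l) <= C * d n) -> Un_cv u l.
Proof.
  intros HC Hd H eps He. destruct (Hd (eps / C)) as [N1 HN1]; [apply Rdiv_lt_0_compat; lra|].
  exists (max N N1). intros n Hn. unfold Rdist. eapply Rle_lt_trans; [apply H; lia|].
  specialize (HN1 n ltac:(lia)). unfold Rdist in HN1. apply Rabs_def2 in HN1.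
  replace eps with (C * (eps / C)) by (field; lra). apply Rmult_lt_compat_l; lra.
Qed.

Lemma Rmult_Rabs_bounds (x y c : R) : 0 <= y <= c -> - (Rabs x * c) <= x * y <= Rabs x * c.
Proof.
  intros Hy. apply Rabs_le_between. rewrite Rabs_mult, (Rabs_right y) by lra.
  apply Rmult_le_compat_l; [apply Rabs_pos|lra].
Qed.

(** Only the last excursion below the level [c] matters, and [h] is nondecreasing throughout it. *)
Lemma lower_bound_of_derive (h dh : R -> R) (a b c : R) :
  a <= b -> (forall x, a <= x <= b -> is_derive h x (dh x)) -> c <= h a ->
  (forall x, a <= x <= b -> h x < c -> 0 <= dh x) -> c <= h b.
Proof.
  intros Hab Hd Ha H. apply Rnot_lt_le. intros Hb.
  (* Reversing time turns the last time at level [c] before [b] into a first zero. *)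
  destruct (first_zero (fun x => c - h (- x)) (- b) (- a)) as [r [Hr1 [Hr2 Hr3]]].
  { lra. }
  { intros x Hx. apply continuity_pt_minus; [now apply continuity_pt_const|].
    apply (continuity_pt_comp (fun x => - x) h); [reg|].
    eapply is_derive_continuity_pt, Hd. lra. }
  { rewrite Ropp_involutive. lra. }
  { rewrite Ropp_involutive. lra. }
  assert (h (- r) <= h b); [|lra].
  apply (nondecreasing_of_derive h dh); [| |lra].
  - intros x Hx. apply Hd. lra.
  - intros x Hx. apply H; [lra|]. specialize (Hr3 (- x) ltac:(lra)). simpl in Hr3.
    rewrite Ropp_involutive in Hr3. lra.
Qed.

(** * Second-order initial value problems *)

Lemma geometric_cauchy_limit (u : nat -> R) (c : R) :
  (forall n, Rabs (u (S n) - u n) <= c * (1 / 2) ^ n) ->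
  exists l, forall n, Rabs (u n - l) <= 2 * c * (1 / 2) ^ n.
Proof.
  intros H.
  assert (Hc : 0 <= c) by (pose proof (H 0%nat) as H0; simpl in H0; pose proof (Rabs_pos (u 1%nat - u 0%nat)); lra).
  assert (Hp : forall n, 0 < (1 / 2) ^ n) by (intros n; apply pow_lt; lra).
  assert (Hd : forall n m, Rabs (u (n + m)%nat - u n) <= 2 * c * (1 / 2) ^ n * (1 - (1 / 2) ^ m)).
  { intros n m. induction m as [|m IH].
    - rewrite Nat.add_0_r, Rminus_diag, Rabs_R0. simpl. lra.
    - replace (u (n + S m)%nat - u n) with ((u (S (n + m)) - u (n + m)%nat) + (u (n + m)%nat - u n))
        by (rewrite Nat.add_succ_r; ring).
      eapply Rle_trans; [apply Rabs_triang|].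
      specialize (H (n + m)%nat). rewrite pow_add in H. simpl. nra. }
  assert (Hd' : forall n m, (n <= m)%nat -> Rabs (u m - u n) <= 2 * c * (1 / 2) ^ n).
  { intros n m Hnm. replace m with (n + (m - n))%nat by lia.
    eapply Rle_trans; [apply Hd|].
    assert (0 <= c * (1 / 2) ^ n) by (apply Rmult_le_pos; [exact Hc|apply Rlt_le, Hp]).
    pose proof (Hp (m - n)%nat). nra. }
  destruct (R_complete u) as [l Hl].
  { intros eps He.
    destruct (pow_lt_1_zero (1 / 2)) with (y := eps / (4 * c + 1)) as [N HN].
    { rewrite Rabs_right; lra. }
    { apply Rdiv_lt_0_compat; lra. }
    exists N. intros n m Hn Hm. unfold Rdist.
    replace (u n - u m) with ((u n - u N) - (u m - u N)) by ring.
    specialize (HN N (le_n N)). rewrite Rabs_right in HN by (apply Rle_ge, Rlt_le, Hp).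
    apply Rmult_lt_compat_l with (r := 4 * c + 1) in HN; [|lra].
    replace ((4 * c + 1) * (eps / (4 * c + 1))) with eps in HN by (field; lra).
    eapply Rle_lt_trans; [apply Rabs_triang|]. rewrite Rabs_Ropp.
    pose proof (Hd' N n Hn). pose proof (Hd' N m Hm). pose proof (Hp N). nra. }
  exists l. intros n. apply Rnot_lt_le. intros Hlt.
  destruct (Hl (Rabs (u n - l) - 2 * c * (1 / 2) ^ n)) as [N HN]; [lra|].
  specialize (HN (max n N) ltac:(lia)). specialize (Hd' n (max n N) ltac:(lia)).
  unfold Rdist in HN.
  pose proof (Rabs_triang (u n - u (max n N)) (u (max n N) - l)) as T.
  replace (u n - u (max n N) + (u (max n N) - l)) with (u n - l) in T by ring.
  rewrite Rabs_minus_sym in Hd'. lra.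
Qed.

Lemma is_derive_primitive (h : R -> R) (c a t : R) :
  (forall s, continuity_pt h s) -> is_derive (fun s => c + RInt h a s) t (h t).
Proof.
  intros Hc.
  assert (Hc' : forall s, continuous h s) by (intros s; apply continuity_pt_filterlim, Hc).
  assert (D : is_derive (fun s => RInt h a s) t (h t)).
  { apply (is_derive_RInt h (fun s => RInt h a s) a t); [|apply Hc'].
    apply filter_forall. intros s. apply (@RInt_correct R_CompleteNormedModule).
    apply (@ex_RInt_continuous R_CompleteNormedModule). intros z _. apply Hc'. }
  apply (is_derive_eq _ _ (0 + h t)); [|ring].
  apply (is_derive_plus (fun _ => c)); [apply @is_derive_const|exact D].
Qed.

(** Integration against the weight [exp (l(t-t0)) + exp (-l(t-t0))] gains a factor [1/l] in both
    time directions. This is the Bielecki weight: it turns Picard iteration into a contraction on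
    the whole line, without gluing short intervals. *)
Lemma exp_weight_bound (u du : R -> R) (l c t0 : R) :
  0 < l -> 0 <= c ->
  (forall t, is_derive u t (du t)) -> u t0 = 0 ->
  (forall t, Rabs (du t) <= c * (exp (l * (t - t0)) + exp (- (l * (t - t0))))) ->
  forall t, Rabs (u t) <= c / l * (exp (l * (t - t0)) + exp (- (l * (t - t0)))).
Proof.
  intros Hl Hc Hd H0 Hb t.
  (* [V] vanishes at [t0], its derivative is the given bound on [du], and its absolute value is at
     most [c/l] times the weight. *)
  pose (V := fun t => c / l * (exp (l * (t - t0)) - exp (- (l * (t - t0))))).
  assert (DV : forall t, is_derive V t (c * (exp (l * (t - t0)) + exp (- (l * (t - t0)))))).
  { intros s. unfold V. auto_derive; [exact I|]. unfold Rminus. field. lra. }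
  assert (V0 : V t0 = 0) by (unfold V; rewrite Rminus_diag, Rmult_0_r, Ropp_0; ring).
  assert (D1 : forall s, is_derive (fun t => V t - u t) s (c * (exp (l * (s - t0)) + exp (- (l * (s - t0)))) - du s)).
  { intros s. apply (is_derive_minus V u); auto. }
  assert (D2 : forall s, is_derive (fun t => V t + u t) s (c * (exp (l * (s - t0)) + exp (- (l * (s - t0)))) + du s)).
  { intros s. apply (is_derive_plus V u); auto. }
  assert (B : forall s, - (c * (exp (l * (s - t0)) + exp (- (l * (s - t0))))) <= du s
                        <= c * (exp (l * (s - t0)) + exp (- (l * (s - t0))))).
  { intros s. apply Rabs_le_between, Hb. }
  assert (VW : - (c / l * (exp (l * (t - t0)) + exp (- (l * (t - t0))))) <= V t
               <= c / l * (exp (l * (t - t0)) + exp (- (l * (t - t0))))).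
  { assert (0 <= c / l) by (apply Rdiv_le_0_compat; lra).
    pose proof (exp_pos (l * (t - t0))). pose proof (exp_pos (- (l * (t - t0)))).
    unfold V. split; nra. }
  assert (E : forall s r, s <= r -> V s - u s <= V r - u r /\ V s + u s <= V r + u r).
  { intros s r Hsr. split.
    - apply (nondecreasing_of_derive _ _ s r (fun x _ => D1 x)); [|exact Hsr].
      intros x _. specialize (B x). lra.
    - apply (nondecreasing_of_derive _ _ s r (fun x _ => D2 x)); [|exact Hsr].
      intros x _. specialize (B x). lra. }
  apply Rabs_le. destruct (Rle_dec t0 t) as [Ht|Ht].
  - specialize (E t0 t Ht). lra.
  - specialize (E t t0 ltac:(lra)). lra.
Qed.

(** * Global Picard iteration in the weighted norm *)

Section Picard.

Context (Phi : R -> R -> R -> R) (L B t0 x0 y0 : R).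
Context (HL : 0 < L).
Context (Hlip : forall t x1 y1 x2 y2,
  Rabs (Phi t x1 y1 - Phi t x2 y2) <= L * (Rabs (x1 - x2) + Rabs (y1 - y2))).
Context (Hcont : forall x y t, continuity_pt (fun s => Phi s x y) t).
Context (Hbd : forall t, Rabs (Phi t x0 y0) <= B).

Fixpoint picard (n : nat) : (R -> R) * (R -> R) :=
  match n with
  | O => (fun _ => x0, fun _ => y0)
  | S n => (fun t => x0 + RInt (snd (picard n)) t0 t,
            fun t => y0 + RInt (fun s => Phi s (fst (picard n) s) (snd (picard n) s)) t0 t)
  end.

Lemma continuity_pt_lipschitz_comp (x y : R -> R) (t : R) :
  continuity_pt x t -> continuity_pt y t ->
  continuity_pt (fun s => Phi s (x s) (y s)) t.
Proof.
  intros Hx Hy eps He.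
  assert (He' : 0 < eps / (3 * (L + 1))) by (apply Rdiv_lt_0_compat; lra).
  destruct (continuity_pt_eps _ _ _ Hx He') as [d1 [Hd1 K1]].
  destruct (continuity_pt_eps _ _ _ Hy He') as [d2 [Hd2 K2]].
  destruct (continuity_pt_eps _ _ (eps / 3) (Hcont (x t) (y t) t)) as [d3 [Hd3 K3]]; [lra|].
  exists (Rmin d1 (Rmin d2 d3)). split; [repeat apply Rmin_glb_lt; assumption|].
  intros s [_ Hs]. unfold dist in *. simpl in *. unfold Rdist in *.
  assert (Rabs (s - t) < d1) as S1 by (eapply Rlt_le_trans; [exact Hs|apply Rmin_l]).
  assert (Rabs (s - t) < d2) as S2
    by (eapply Rlt_le_trans; [exact Hs|eapply Rle_trans; [apply Rmin_r|apply Rmin_l]]).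
  assert (Rabs (s - t) < d3) as S3
    by (eapply Rlt_le_trans; [exact Hs|eapply Rle_trans; [apply Rmin_r|apply Rmin_r]]).
  specialize (K1 s S1). specialize (K2 s S2). specialize (K3 s S3).
  specialize (Hlip s (x s) (y s) (x t) (y t)).
  replace (Phi s (x s) (y s) - Phi t (x t) (y t)) with
    ((Phi s (x s) (y s) - Phi s (x t) (y t)) + (Phi s (x t) (y t) - Phi t (x t) (y t))) by ring.
  eapply Rle_lt_trans; [apply Rabs_triang|].
  assert (L * (Rabs (x s - x t) + Rabs (y s - y t)) <= 2 * (eps / 3)).
  { apply Rle_trans with (L * (2 * (eps / (3 * (L + 1))))).
    - apply Rmult_le_compat_l; lra.
    - replace (2 * (eps / 3)) with ((L + 1) * (2 * (eps / (3 * (L + 1))))) by (field; lra).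
      nra. }
  lra.
Qed.

Lemma picard_continuity (n : nat) (t : R) :
  continuity_pt (fst (picard n)) t /\ continuity_pt (snd (picard n)) t.
Proof.
  revert t. induction n as [|n IH]; intros t; simpl.
  - split; now apply continuity_pt_const.
  - split; eapply is_derive_continuity_pt, is_derive_primitive; intros s.
    + apply IH.
    + apply continuity_pt_lipschitz_comp; apply IH.
Qed.

Lemma picard_derive (n : nat) (t : R) :
  is_derive (fst (picard (S n))) t (snd (picard n) t) /\
  is_derive (snd (picard (S n))) t (Phi t (fst (picard n) t) (snd (picard n) t)).
Proof.
  split.
  - apply (is_derive_primitive (snd (picard n))). intros s. apply picard_continuity.
  - apply (is_derive_primitive (fun s => Phi s (fst (picard n) s) (snd (picard n) s))).
    intros s. apply continuity_pt_lipschitz_comp; apply picard_continuity.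
Qed.

Lemma picard_init (n : nat) : fst (picard n) t0 = x0 /\ snd (picard n) t0 = y0.
Proof.
  destruct n; simpl; [auto|]. rewrite !RInt_point.
  split; apply Rplus_0_r.
Qed.

Lemma picard_step (n : nat) (t : R) :
  let W := exp ((4 * L + 2) * (t - t0)) + exp (- ((4 * L + 2) * (t - t0))) in
  Rabs (fst (picard (S n)) t - fst (picard n) t) <= (Rabs y0 + B) * W * (1 / 2) ^ n /\
  Rabs (snd (picard (S n)) t - snd (picard n) t) <= (Rabs y0 + B) * W * (1 / 2) ^ n.
Proof.
  assert (HB : 0 <= B) by (pose proof (Rabs_pos (Phi t0 x0 y0)); specialize (Hbd t0); lra).
  assert (HC : 0 <= Rabs y0 + B) by (pose proof (Rabs_pos y0); lra).
  (* [1/l <= 1/2] serves the first component and [2L/l <= 1/2] the second: each iteration halves the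
     increment. *)
  set (l := 4 * L + 2).
  assert (Hl : 0 < l) by (unfold l; lra).
  assert (HW : forall s, 1 <= exp (l * (s - t0)) + exp (- (l * (s - t0)))).
  { intros s. pose proof (exp_pos (l * (s - t0))). pose proof (exp_pos (- (l * (s - t0)))).
    destruct (Rle_dec 0 (l * (s - t0))).
    - pose proof (exp_ineq1_le (l * (s - t0))). lra.
    - pose proof (exp_ineq1_le (- (l * (s - t0)))). lra. }
  revert t. induction n as [|n IH]; intros t W.
  - assert (Hl1 : (Rabs y0 + B) / l * W <= (Rabs y0 + B) * W * (1 / 2) ^ 0).
    { simpl. rewrite Rmult_1_r. apply Rmult_le_compat_r; [specialize (HW t); unfold W; lra|].
      apply Rle_div_l; [lra|]. unfold l. nra. }
    split; (eapply Rle_trans; [|exact Hl1]).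
    + apply (exp_weight_bound (fun t => fst (picard 1) t - fst (picard 0) t) (fun t => y0 - 0)); auto.
      * intros s. apply (is_derive_minus (fst (picard 1)) (fst (picard 0))); [apply (picard_derive 0)|].
        apply (is_derive_const x0).
      * rewrite !(proj1 (picard_init _)). ring.
      * intros s. rewrite Rminus_0_r. specialize (HW s). fold l.
        pose proof (Rabs_pos y0). nra.
    + apply (exp_weight_bound (fun t => snd (picard 1) t - snd (picard 0) t) (fun t => Phi t x0 y0 - 0)); auto.
      * intros s. apply (is_derive_minus (snd (picard 1)) (snd (picard 0))); [apply (picard_derive 0)|].
        apply (is_derive_const y0).
      * rewrite !(proj2 (picard_init _)). ring.
      * intros s. rewrite Rminus_0_r. specialize (HW s). specialize (Hbd s). fold l.
        pose proof (Rabs_pos y0). nra.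
  - assert (Hp : 0 < (1 / 2) ^ n) by (apply pow_lt; lra).
    set (c := (Rabs y0 + B) * (1 / 2) ^ n).
    assert (Hc : 0 <= c) by (unfold c; nra).
    split.
    + apply Rle_trans with (c / l * W).
      * apply (exp_weight_bound (fun t => fst (picard (S (S n))) t - fst (picard (S n)) t)
                 (fun t => snd (picard (S n)) t - snd (picard n) t)); auto.
        -- intros s. apply (is_derive_minus (fst (picard (S (S n)))) (fst (picard (S n)))); apply picard_derive.
        -- rewrite !(proj1 (picard_init _)). ring.
        -- intros s. eapply Rle_trans; [apply IH|]. right. unfold c. ring.
      * replace ((Rabs y0 + B) * W * (1 / 2) ^ S n) with (c * (1 / 2) * W) by (unfold c; simpl; ring).
        apply Rmult_le_compat_r; [specialize (HW t); unfold W; lra|].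
        apply Rmult_le_compat_l; [exact Hc|].
        apply Rle_trans with (/ 2); [apply Rinv_le_contravar; unfold l; lra|lra].
    + apply Rle_trans with ((2 * L * c) / l * W).
      * apply (exp_weight_bound (fun t => snd (picard (S (S n))) t - snd (picard (S n)) t)
                 (fun t => Phi t (fst (picard (S n)) t) (snd (picard (S n)) t)
                           - Phi t (fst (picard n) t) (snd (picard n) t))); auto.
        -- nra.
        -- intros s. apply (is_derive_minus (snd (picard (S (S n)))) (snd (picard (S n)))); apply picard_derive.
        -- rewrite !(proj2 (picard_init _)). ring.
        -- intros s. eapply Rle_trans; [apply Hlip|].
           destruct (IH s) as [I1 I2]. fold l in I1, I2.
           replace (2 * L * c * (exp (l * (s - t0)) + exp (- (l * (s - t0)))))
             with (L * (2 * ((Rabs y0 + B) * (exp (l * (s - t0)) + exp (- (l * (s - t0)))) * (1 / 2) ^ n)))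
             by (unfold c; ring).
           apply Rmult_le_compat_l; [lra|]. fold l. lra.
      * replace ((Rabs y0 + B) * W * (1 / 2) ^ S n) with (c * (1 / 2) * W) by (unfold c; simpl; ring).
        apply Rmult_le_compat_r; [specialize (HW t); unfold W; lra|].
        apply Rle_div_l; [lra|]. unfold l. nra.
Qed.

Lemma geometric_CVU (u : nat -> R -> R) (v : R -> R) (C l t : R) :
  0 <= C -> 0 <= l ->
  (forall s n, Rabs (u n s - v s) <= 2 * (C * (exp (l * (s - t0)) + exp (- (l * (s - t0))))) * (1 / 2) ^ n) ->
  CVU u v t (mkposreal 1 Rlt_0_1).
Proof.
  intros HC Hl H eps He.
  set (K := exp (l * (Rabs (t - t0) + 1))).
  assert (HK : 0 < K) by apply exp_pos.
  destruct (pow_lt_1_zero (1 / 2)) with (y := eps / (4 * C * K + 1)) as [N HN].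
  { rewrite Rabs_right; lra. }
  { apply Rdiv_lt_0_compat; [exact He|]. assert (0 <= C * K) by nra. nra. }
  exists N. intros n s Hn Hs. unfold Boule in Hs. simpl in Hs.
  rewrite Rabs_minus_sym. eapply Rle_lt_trans; [apply H|].
  assert (H1 : exp (l * (s - t0)) <= K).
  { apply exp_le. apply Rmult_le_compat_l; [exact Hl|].
    pose proof (Rle_abs (t - t0)). apply Rabs_def2 in Hs. lra. }
  assert (H2 : exp (- (l * (s - t0))) <= K).
  { apply exp_le. rewrite <- Ropp_mult_distr_r_reverse. apply Rmult_le_compat_l; [exact Hl|].
    pose proof (Rle_abs (- (t - t0))). rewrite Rabs_Ropp in *. apply Rabs_def2 in Hs. lra. }
  specialize (HN n Hn). assert (Hp : 0 < (1 / 2) ^ n) by (apply pow_lt; lra).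
  rewrite Rabs_right in HN by lra.
  assert (HCK : 0 <= C * K) by nra.
  apply Rmult_lt_compat_l with (r := 4 * C * K + 1) in HN; [|nra].
  replace ((4 * C * K + 1) * (eps / (4 * C * K + 1))) with eps in HN by (field; nra).
  eapply Rle_lt_trans; [|exact HN].
  apply Rmult_le_compat_r; [lra|].
  assert (C * (exp (l * (s - t0)) + exp (- (l * (s - t0)))) <= C * (2 * K)) by (apply Rmult_le_compat_l; lra).
  lra.
Qed.

Lemma picard_lindelof :
  exists x y : R -> R, x t0 = x0 /\ y t0 = y0 /\
    forall t, is_derive x t (y t) /\ is_derive y t (Phi t (x t) (y t)).
Proof.
  set (W := fun t => exp ((4 * L + 2) * (t - t0)) + exp (- ((4 * L + 2) * (t - t0)))).
  assert (HB : 0 <= B) by (pose proof (Rabs_pos (Phi t0 x0 y0)); specialize (Hbd t0); lra).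
  assert (HC : 0 <= Rabs y0 + B) by (pose proof (Rabs_pos y0); lra).
  assert (X : forall t, exists l, forall n, Rabs (fst (picard n) t - l) <= 2 * ((Rabs y0 + B) * W t) * (1 / 2) ^ n).
  { intros t. apply geometric_cauchy_limit. intros n. apply picard_step. }
  assert (Y : forall t, exists l, forall n, Rabs (snd (picard n) t - l) <= 2 * ((Rabs y0 + B) * W t) * (1 / 2) ^ n).
  { intros t. apply geometric_cauchy_limit. intros n. apply picard_step. }
  pose (x := fun t => proj1_sig (constructive_indefinite_description _ (X t))).
  pose (y := fun t => proj1_sig (constructive_indefinite_description _ (Y t))).
  assert (Hx : forall t n, Rabs (fst (picard n) t - x t) <= 2 * ((Rabs y0 + B) * W t) * (1 / 2) ^ n)
    by (intros t; exact (proj2_sig (constructive_indefinite_description _ (X t)))).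
  assert (Hy : forall t n, Rabs (snd (picard n) t - y t) <= 2 * ((Rabs y0 + B) * W t) * (1 / 2) ^ n)
    by (intros t; exact (proj2_sig (constructive_indefinite_description _ (Y t)))).
  clearbody x y. clear X Y.
  assert (Ux : forall t, CVU (fun n => fst (picard n)) x t (mkposreal 1 Rlt_0_1)).
  { intros t. apply (geometric_CVU _ _ (Rabs y0 + B) (4 * L + 2)); [exact HC|lra|exact Hx]. }
  assert (Uy : forall t, CVU (fun n => snd (picard n)) y t (mkposreal 1 Rlt_0_1)).
  { intros t. apply (geometric_CVU _ _ (Rabs y0 + B) (4 * L + 2)); [exact HC|lra|exact Hy]. }
  assert (CVU_cv : forall (u : nat -> R -> R) v t, CVU u v t (mkposreal 1 Rlt_0_1) -> Un_cv (fun n => u n t) (v t)).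
  { intros u v t H eps He. destruct (H eps He) as [N HN]. exists N. intros n Hn.
    unfold Rdist. rewrite Rabs_minus_sym. apply HN; [exact Hn|].
    unfold Boule. rewrite Rminus_diag, Rabs_R0. simpl. lra. }
  assert (CVU_S : forall (u : nat -> R -> R) v t r, CVU u v t r -> CVU (fun n => u (S n)) v t r).
  { intros u v t r H eps He. destruct (H eps He) as [N HN]. exists N. intros n s Hn. apply HN. lia. }
  assert (Cx : forall t, continuity_pt x t).
  { intros t. eapply CVU_continuity; [apply Ux| |apply Boule_center]. intros n s _. apply picard_continuity. }
  assert (Cy : forall t, continuity_pt y t).
  { intros t. eapply CVU_continuity; [apply Uy| |apply Boule_center]. intros n s _. apply picard_continuity. }
  assert (UP : forall t, CVU (fun n s => Phi s (fst (picard n) s) (snd (picard n) s))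
                           (fun s => Phi s (x s) (y s)) t (mkposreal 1 Rlt_0_1)).
  { intros t eps He.
    assert (He' : 0 < eps / (2 * L)) by (apply Rdiv_lt_0_compat; lra).
    destruct (Ux t _ He') as [N1 HN1]. destruct (Uy t _ He') as [N2 HN2].
    exists (max N1 N2). intros n s Hn Hs.
    specialize (HN1 n s ltac:(lia) Hs). specialize (HN2 n s ltac:(lia) Hs).
    eapply Rle_lt_trans; [apply Hlip|].
    replace eps with (L * (eps / (2 * L) + eps / (2 * L))) by (field; lra).
    apply Rmult_lt_compat_l; [exact HL|]. lra. }
  exists x, y. split; [|split].
  - eapply UL_sequence; [apply CVU_cv, (Ux t0)|].
    apply Un_cv_ext with (fun _ => x0); [intros n; symmetry; apply picard_init|apply Un_cv_const].
  - eapply UL_sequence; [apply CVU_cv, (Uy t0)|].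
    apply Un_cv_ext with (fun _ => y0); [intros n; symmetry; apply picard_init|apply Un_cv_const].
  (* The derivatives of the iterates converge uniformly near [t], so the limit may be
     differentiated; the index shift pairs iterate [S n] with the field evaluated at iterate [n]. *)
  - intros t. split; apply is_derive_Reals.
    + apply (Ranalysis5.derivable_pt_lim_CVU (fun n => fst (picard (S n))) (fun n => snd (picard n)) x y t
               t (mkposreal 1 Rlt_0_1)).
      * apply Boule_center.
      * intros s n _. apply is_derive_Reals, picard_derive.
      * intros s _. apply CVU_cv, (CVU_S (fun n => fst (picard n))), Ux.
      * apply Uy.
      * intros s _. apply Cy.
    + apply (Ranalysis5.derivable_pt_lim_CVU (fun n => snd (picard (S n)))
               (fun n s => Phi s (fst (picard n) s) (snd (picard n) s)) y (fun s => Phi s (x s) (y s)) t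
               t (mkposreal 1 Rlt_0_1)).
      * apply Boule_center.
      * intros s n _. apply is_derive_Reals, picard_derive.
      * intros s _. apply CVU_cv, (CVU_S (fun n => snd (picard n))), Uy.
      * apply UP.
      * intros s _. apply continuity_pt_lipschitz_comp; auto.
Qed.

End Picard.

(** [V' <= l V] bounds [V] after [t0] and [- V' <= l V] before it. The constant [3L + 1] comes from
    [2uv <= u^2 + v^2] applied to [2uv + 2Lv(u+v)]. *)
Lemma gronwall_pair (x1 y1 x2 y2 z1 z2 : R -> R) (L a b t0 : R) :
  0 <= L ->
  (forall t, a <= t <= b -> is_derive x1 t (y1 t) /\ is_derive y1 t (z1 t)) ->
  (forall t, a <= t <= b -> is_derive x2 t (y2 t) /\ is_derive y2 t (z2 t)) ->
  (forall t, a <= t <= b -> Rabs (z1 t - z2 t) <= L * (Rabs (x1 t - x2 t) + Rabs (y1 t - y2 t))) ->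
  a <= t0 <= b -> forall t, a <= t <= b ->
  (x1 t - x2 t) ^ 2 + (y1 t - y2 t) ^ 2
    <= exp ((3 * L + 1) * (b - a)) * ((x1 t0 - x2 t0) ^ 2 + (y1 t0 - y2 t0) ^ 2).
Proof.
  intros HL H1 H2 Hz Ht0 t Ht.
  set (l := 3 * L + 1). assert (Hl : 0 < l) by (unfold l; lra).
  set (V := fun t => (x1 t - x2 t) ^ 2 + (y1 t - y2 t) ^ 2).
  set (dV := fun t => 2 * (x1 t - x2 t) * (y1 t - y2 t) + 2 * (y1 t - y2 t) * (z1 t - z2 t)).
  assert (DV : forall t, a <= t <= b -> is_derive V t (dV t)).
  { intros s Hs. destruct (H1 s Hs) as [A1 A2]. destruct (H2 s Hs) as [B1 B2].
    unfold V. derive_ctx. unfold dV. ring. }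
  assert (BV : forall t, a <= t <= b -> - (l * V t) <= dV t <= l * V t).
  { intros s Hs. specialize (Hz s Hs). apply Rabs_le_between. unfold dV, V.
    eapply Rle_trans; [apply Rabs_triang|]. rewrite !Rabs_mult, (Rabs_right 2) by lra.
    rewrite <- (pow2_abs (x1 s - x2 s)), <- (pow2_abs (y1 s - y2 s)).
    set (u := Rabs (x1 s - x2 s)) in *. set (v := Rabs (y1 s - y2 s)) in *.
    assert (0 <= u) by apply Rabs_pos. assert (0 <= v) by apply Rabs_pos.
    assert (2 * v * Rabs (z1 s - z2 s) <= 2 * v * (L * (u + v))) by (apply Rmult_le_compat_l; lra).
    unfold l. assert (0 <= (u - v) ^ 2) by apply pow2_ge_0.
    assert (0 <= L * (u - v) ^ 2) by nra. nra. }
  assert (V0 : forall t, 0 <= V t) by (intros s; apply Rplus_le_le_0_compat; apply pow2_ge_0).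
  change (V t <= exp (l * (b - a)) * V t0).
  destruct (Rle_dec t0 t) as [Hle|Hle].
  - assert (E : V t * exp (- (l * t)) <= V t0 * exp (- (l * t0))).
    { apply (nonincreasing_of_derive (fun t => V t * exp (- (l * t)))
               (fun t => (dV t - l * V t) * exp (- (l * t)))); [| |exact Hle].
      - intros s Hs. assert (D := DV s ltac:(lra)). derive_ctx. ring.
      - intros s Hs. pose proof (exp_pos (- (l * s))). pose proof (BV s ltac:(lra)). nra. }
    apply Rmult_le_compat_r with (r := exp (l * t)) in E; [|apply Rlt_le, exp_pos].
    rewrite !Rmult_assoc, <- !exp_plus in E.
    replace (- (l * t) + l * t) with 0 in E by ring. rewrite exp_0, Rmult_1_r in E.
    eapply Rle_trans; [exact E|]. rewrite Rmult_comm. apply Rmult_le_compat_r; [apply V0|].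
    apply exp_le. assert (l * (t - t0) <= l * (b - a)) by (apply Rmult_le_compat_l; lra). lra.
  - assert (E : V t * exp (l * t) <= V t0 * exp (l * t0)).
    { apply (nondecreasing_of_derive (fun t => V t * exp (l * t))
               (fun t => (dV t + l * V t) * exp (l * t))); [| |lra].
      - intros s Hs. assert (D := DV s ltac:(lra)). derive_ctx. ring.
      - intros s Hs. pose proof (exp_pos (l * s)). pose proof (BV s ltac:(lra)). nra. }
    apply Rmult_le_compat_r with (r := exp (- (l * t))) in E; [|apply Rlt_le, exp_pos].
    rewrite !Rmult_assoc, <- !exp_plus in E.
    replace (l * t + - (l * t)) with 0 in E by ring. rewrite exp_0, Rmult_1_r in E.
    eapply Rle_trans; [exact E|]. rewrite Rmult_comm. apply Rmult_le_compat_r; [apply V0|].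
    apply exp_le. assert (l * (t0 - t) <= l * (b - a)) by (apply Rmult_le_compat_l; lra). lra.
Qed.

(** * Powers and their truncation *)

Lemma Rpower_pos (x e : R) : 0 < Rpower x e.
Proof. apply exp_pos. Qed.

Lemma Rpower_pred (x e : R) : 0 < x -> Rpower x e = x * Rpower x (e - 1).
Proof.
  intros Hx. rewrite <- (Rpower_1 x Hx) at 2. rewrite <- Rpower_plus. f_equal. ring.
Qed.

Lemma Rpower_Rinv_cancel (x e : R) : 0 < x -> e <> 0 -> Rpower (Rpower x (1 / e)) e = x.
Proof.
  intros Hx He. rewrite Rpower_mult. replace (1 / e * e) with 1 by (field; exact He).
  now apply Rpower_1.
Qed.

Lemma is_derive_Rpower (x e : R) : 0 < x -> is_derive (fun u => Rpower u e) x (e * Rpower x (e - 1)).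
Proof. intros Hx. apply is_derive_Reals. now apply derivable_pt_lim_power. Qed.

Lemma rpow_pos_eq (x e : R) : 0 < x -> rpow x e = Rpower x e.
Proof. intros Hx. unfold rpow. now destruct (Rlt_dec 0 x). Qed.

Lemma rpow_nonpos_eq (x e : R) : x <= 0 -> rpow x e = 0.
Proof. intros Hx. unfold rpow. destruct (Rlt_dec 0 x); [lra|reflexivity]. Qed.

Lemma rpow_nonneg (x e : R) : 0 <= rpow x e.
Proof. unfold rpow. destruct (Rlt_dec 0 x); [apply Rlt_le, Rpower_pos|lra]. Qed.

Lemma rpow_le (x y e : R) : 0 <= e -> x <= y -> rpow x e <= rpow y e.
Proof.
  intros He Hxy. destruct (Rlt_dec 0 x).
  - rewrite !rpow_pos_eq by lra. apply Rle_Rpower_l; lra.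
  - rewrite (rpow_nonpos_eq x) by lra. apply rpow_nonneg.
Qed.

Lemma rpow_small (e eps : R) : 0 < e -> 0 < eps ->
  exists d, 0 < d /\ forall x, x < d -> rpow x e < eps.
Proof.
  intros He Heps. exists (Rpower eps (1 / e)). split; [apply Rpower_pos|].
  intros x Hx. destruct (Rlt_dec 0 x) as [H|H].
  - rewrite rpow_pos_eq by lra.
    rewrite <- (Rpower_Rinv_cancel eps e) by lra.
    apply Rlt_Rpower_l; lra.
  - rewrite rpow_nonpos_eq; lra.
Qed.

Lemma rpow_continuity (x e : R) : 0 < e -> continuity_pt (fun u => rpow u e) x.
Proof.
  intros He. destruct (Rtotal_order x 0) as [H|[->|H]].
  - intros eps Heps. exists (- x). split; [lra|]. intros y [_ Hy].
    simpl in *. unfold Rdist in *. apply Rabs_def2 in Hy.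
    rewrite !rpow_nonpos_eq, Rminus_diag, Rabs_R0 by lra. exact Heps.
  - intros eps Heps. destruct (rpow_small e eps He Heps) as [d [Hd K]].
    exists d. split; [exact Hd|]. intros y [_ Hy]. simpl in *. unfold Rdist in *.
    rewrite (rpow_nonpos_eq 0) by lra. rewrite Rminus_0_r, Rabs_right by (apply Rle_ge, rpow_nonneg).
    apply K. apply Rabs_def2 in Hy. lra.
  - apply continuity_pt_ext_loc with (fun u => Rpower u e).
    + apply filter_imp with (2 := locally_gt 0 x H). intros y Hy. symmetry. now apply rpow_pos_eq.
    + eapply is_derive_continuity_pt, is_derive_Rpower, H.
Qed.

(** The delicate point is 0, where the right difference quotient is [h^(e-1)], small because
    [e > 1]. *)
Lemma is_derive_rpow (x e : R) : 1 < e -> is_derive (fun u => rpow u e) x (e * rpow x (e - 1)).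
Proof.
  intros He. destruct (Rtotal_order x 0) as [H|[->|H]].
  - rewrite rpow_nonpos_eq, Rmult_0_r by lra.
    apply is_derive_ext_loc with (fun _ => 0); [|apply (is_derive_const 0)].
    apply filter_imp with (2 := locally_lt 0 x H). intros y Hy. symmetry. apply rpow_nonpos_eq. lra.
  - apply is_derive_Reals. rewrite (rpow_nonpos_eq 0), Rmult_0_r by lra.
    intros eps Heps. destruct (rpow_small (e - 1) eps ltac:(lra) Heps) as [d [Hd K]].
    exists (mkposreal d Hd). intros h Hh0 Hh. simpl in Hh.
    rewrite Rplus_0_l, (rpow_nonpos_eq 0), !Rminus_0_r by lra.
    destruct (Rlt_dec 0 h) as [Hp|Hp].
    + rewrite rpow_pos_eq, (Rpower_pred h e) by lra.
      replace (h * Rpower h (e - 1) / h) with (Rpower h (e - 1)) by (field; lra).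
      rewrite Rabs_right by (apply Rle_ge, Rlt_le, Rpower_pos).
      rewrite <- rpow_pos_eq by lra. apply K. apply Rabs_def2 in Hh. lra.
    + rewrite rpow_nonpos_eq by lra. unfold Rdiv. rewrite Rmult_0_l, Rabs_R0. exact Heps.
  - rewrite rpow_pos_eq by lra.
    apply is_derive_ext_loc with (fun u => Rpower u e); [|now apply is_derive_Rpower].
    apply filter_imp with (2 := locally_gt 0 x H). intros y Hy. symmetry. now apply rpow_pos_eq.
Qed.

(** The derivative is truncated and then integrated, instead of truncating the power itself: the
    result is C^1, so that [k] can still be differentiated in time. *)
Definition trunc_deriv (q M u : R) : R := q * rpow (Rmin u M) (q - 1).

(* [u^q] for [0 <= u <= M], extended linearly for [u > M] and by [0] for [u < 0]. *)
Definition trunc_pow (q M u : R) : R := RInt (trunc_deriv q M) 0 u.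

Lemma trunc_deriv_continuity (q M u : R) : 1 < q -> continuity_pt (trunc_deriv q M) u.
Proof.
  intros Hq. unfold trunc_deriv. apply continuity_pt_mult.
  - apply continuity_pt_const. intros ? ?. reflexivity.
  - apply (continuity_pt_comp (fun u => Rmin u M) (fun v => rpow v (q - 1))).
    + apply continuity_pt_ext with (fun u => (u + M - Rabs (u - M)) / 2).
      { intros t. unfold Rmin. destruct (Rle_dec t M).
        - rewrite Rabs_left1 by lra. lra.
        - rewrite Rabs_right by lra. lra. }
      reg.
    + apply rpow_continuity. lra.
Qed.

Lemma is_derive_trunc_pow (q M u : R) : 1 < q -> is_derive (trunc_pow q M) u (trunc_deriv q M u).
Proof.
  intros Hq. apply is_derive_ext with (fun s => 0 + RInt (trunc_deriv q M) 0 s).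
  - intros t. apply Rplus_0_l.
  - apply is_derive_primitive. intros s. now apply trunc_deriv_continuity.
Qed.

Lemma trunc_deriv_nonneg (q M u : R) : 1 < q -> 0 <= trunc_deriv q M u.
Proof.
  intros Hq. unfold trunc_deriv. pose proof (rpow_nonneg (Rmin u M) (q - 1)). nra.
Qed.

Lemma trunc_deriv_bound (q M u : R) : 1 < q -> 0 < M -> trunc_deriv q M u <= q * Rpower M (q - 1).
Proof.
  intros Hq HM. unfold trunc_deriv. apply Rmult_le_compat_l; [lra|].
  rewrite <- rpow_pos_eq by exact HM. apply rpow_le; [lra|apply Rmin_r].
Qed.

Lemma trunc_deriv_le (q M u : R) : 0 < u <= M -> trunc_deriv q M u = q * Rpower u (q - 1).
Proof. intros Hu. unfold trunc_deriv. rewrite Rmin_left, rpow_pos_eq by lra. reflexivity. Qed.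

Lemma trunc_deriv_ge (q M u : R) : 0 < M <= u -> trunc_deriv q M u = q * Rpower M (q - 1).
Proof. intros Hu. unfold trunc_deriv. rewrite Rmin_right, rpow_pos_eq by lra. reflexivity. Qed.

Lemma trunc_deriv_pos (q M u : R) : 1 < q -> 0 < M -> 0 < u -> 0 < trunc_deriv q M u.
Proof.
  intros Hq HM Hu. unfold trunc_deriv. rewrite rpow_pos_eq by (apply Rmin_glb_lt; lra).
  apply Rmult_lt_0_compat; [lra|apply Rpower_pos].
Qed.

Lemma trunc_deriv_incr (q M u v : R) : 1 < q -> u <= v -> trunc_deriv q M u <= trunc_deriv q M v.
Proof.
  intros Hq Huv. unfold trunc_deriv. apply Rmult_le_compat_l; [lra|].
  apply rpow_le; [lra|]. apply Rle_min_compat_r, Huv.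
Qed.

Lemma trunc_pow_0 (q M : R) : trunc_pow q M 0 = 0.
Proof. exact (RInt_point 0 (trunc_deriv q M)). Qed.

Lemma trunc_pow_nonneg (q M u : R) : 1 < q -> 0 <= u -> 0 <= trunc_pow q M u.
Proof.
  intros Hq Hu. rewrite <- (trunc_pow_0 q M).
  apply (nondecreasing_of_derive _ (trunc_deriv q M)); [| |exact Hu].
  - intros x _. now apply is_derive_trunc_pow.
  - intros x _. now apply trunc_deriv_nonneg.
Qed.

Lemma trunc_pow_eq (q M u : R) : 1 < q -> 0 < u <= M -> trunc_pow q M u = Rpower u q.
Proof.
  intros Hq Hu. rewrite <- rpow_pos_eq by lra.
  assert (D : forall x, 0 <= x <= u ->
    is_derive (fun v => trunc_pow q M v - rpow v q) x (trunc_deriv q M x - q * rpow x (q - 1))).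
  { intros x _. apply (is_derive_minus (trunc_pow q M) (fun v => rpow v q));
      [now apply is_derive_trunc_pow|now apply is_derive_rpow]. }
  assert (Z : forall x, 0 < x < u -> trunc_deriv q M x - q * rpow x (q - 1) = 0).
  { intros x Hx. unfold trunc_deriv. rewrite Rmin_left by lra. ring. }
  pose proof (nondecreasing_of_derive _ _ 0 u D (fun x Hx => Req_le_sym _ _ (Z x Hx)) ltac:(lra)) as H1.
  pose proof (nonincreasing_of_derive _ _ 0 u D (fun x Hx => Req_le _ _ (Z x Hx)) ltac:(lra)) as H2.
  simpl in H1, H2. rewrite trunc_pow_0, (rpow_nonpos_eq 0) in H1, H2 by lra. lra.
Qed.

Lemma trunc_pow_lipschitz (q M u v : R) : 1 < q -> 0 < M ->
  Rabs (trunc_pow q M u - trunc_pow q M v) <= q * Rpower M (q - 1) * Rabs (u - v).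
Proof.
  intros Hq HM.
  destruct (MVT_gen (trunc_pow q M) v u (trunc_deriv q M)) as [c [_ Hc]].
  - intros x _. now apply is_derive_trunc_pow.
  - intros x _. eapply is_derive_continuity_pt. now apply is_derive_trunc_pow.
  - rewrite Hc, Rabs_mult. apply Rmult_le_compat_r; [apply Rabs_pos|].
    rewrite Rabs_right by (apply Rle_ge; now apply trunc_deriv_nonneg).
    now apply trunc_deriv_bound.
Qed.

(** * Shooting *)

Section Shooting.

Context (q a S K : R).
Context (Hq : 1 < q) (Ha : (a + 1) * (q - 1) = 1).
(** Where the constants enter: [8|a| <= S] makes [a f] small against [g] for [t <= -S]; [S + 1 <= K]
    gives [Y > 1] in the trap; [S + 4/(q-1) <= K] lets the bound [Y <= t + K] hold at [-S];
    [2|q-2|/(q-1) < K] absorbs the error term in the slope equation. *)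
Context (HS1 : 1 <= S) (HS2 : 8 * Rabs a <= S).
Context (HK1 : S + 1 <= K) (HK2 : S + 4 / (q - 1) <= K) (HK3 : 2 * (Rabs (q - 2) / (q - 1)) < K).

Definition trunc_rhs (M t x y : R) : R := trunc_pow q M y - t / 2 * y - a / 2 * x.

Definition is_sol (M lo hi : R) (f g : R -> R) : Prop :=
  forall t, lo <= t <= hi ->
    is_derive f t (g t) /\ is_derive g t (trunc_rhs M t (f t) (g t)).

Definition drift (g : R -> R) (t : R) : R := q * Rpower (g t) (q - 1).

Lemma is_derive_trunc_rhs (M lo hi : R) (f g : R -> R) (t : R) :
  is_sol M lo hi f g -> lo <= t <= hi ->
  is_derive (fun t => trunc_rhs M t (f t) (g t)) t
    ((trunc_deriv q M (g t) - t / 2) * trunc_rhs M t (f t) (g t) - (a + 1) / 2 * g t).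
Proof.
  intros H Ht. destruct (H t Ht) as [Df Dg].
  assert (DN : is_derive (fun t => trunc_pow q M (g t)) t
                 (trunc_rhs M t (f t) (g t) * trunc_deriv q M (g t))).
  { apply (is_derive_comp (trunc_pow q M) g); [now apply is_derive_trunc_pow|exact Dg]. }
  apply (is_derive_eq _ _ (trunc_rhs M t (f t) (g t) * trunc_deriv q M (g t)
            - (1 / 2 * g t + t / 2 * trunc_rhs M t (f t) (g t)) - a / 2 * g t)); [|lra].
  unfold trunc_rhs at 1.
  apply (is_derive_minus (fun t => trunc_pow q M (g t) - t / 2 * g t) (fun t => a / 2 * f t)).
  - apply (is_derive_minus (fun t => trunc_pow q M (g t)) (fun t => t / 2 * g t)); [exact DN|].
    derive_ctx. lra.
  - derive_ctx. lra.
Qed.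

(** Times [exp(t^2/8)/4], the barrier [4g + tf] is the derivative of [f exp(t^2/8)]; so [f] stays
    nonnegative as long as the barrier is positive. At a zero of the barrier [|a| f <= g/2], and its
    derivative is at least [f > 0]. *)
Lemma left_barrier (M n : R) (f g : R -> R) :
  S <= n -> is_sol M (- n) (- S) f g -> f (- n) = 0 -> 0 < g (- n) ->
  forall t, - n <= t <= - S ->
    0 <= f t /\ 0 < g t /\ - t * f t <= 4 * g t /\ - t / 4 * g t <= trunc_rhs M t (f t) (g t).
Proof.
  intros Hn Hsol Hf0 Hg0.
  assert (Fpos : forall x, - n <= x <= - S -> (forall y, - n <= y < x -> 0 < 4 * g y + y * f y) ->
            0 <= f x).
  { intros x Hx Hb.
    assert (E : f (- n) * exp ((- n) ^ 2 / 8) <= f x * exp (x ^ 2 / 8)).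
    { apply (nondecreasing_of_derive (fun t => f t * exp (t ^ 2 / 8))
               (fun t => exp (t ^ 2 / 8) * ((4 * g t + t * f t) / 4))); [| |lra].
      - intros y Hy. destruct (Hsol y ltac:(lra)) as [Df _].
        derive_ctx. unfold Rdiv. simpl. field.
      - intros y Hy. apply Rmult_le_pos; [apply Rlt_le, exp_pos|]. specialize (Hb y ltac:(lra)). lra. }
    rewrite Hf0, Rmult_0_l in E. pose proof (exp_pos (x ^ 2 / 8)). nra. }
  assert (B : forall t, - n <= t <= - S -> 0 < 4 * g t + t * f t).
  { apply (positive_barrier (fun t => 4 * g t + t * f t)
             (fun t => 4 * trunc_rhs M t (f t) (g t) + (f t + t * g t))).
    - intros x Hx. destruct (Hsol x Hx) as [Df Dg].
      derive_ctx. ring.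
    - rewrite Hf0. lra.
    - intros x Hx Hz Hb.
      assert (Gpos : forall y, - n <= y < x -> 0 < g y).
      { intros y Hy. assert (0 <= f y) by (apply Fpos; [lra|]; intros z Hz'; apply Hb; lra).
        specialize (Hb y Hy). nra. }
      assert (Fx : 0 < f x).
      { rewrite <- Hf0. apply (increasing_of_derive f g); [| |lra].
        - intros y Hy. apply Hsol. lra.
        - intros y Hy. apply Gpos. lra. }
      assert (Gx : 0 < g x) by nra.
      pose proof (trunc_pow_nonneg q M (g x) Hq ltac:(lra)) as HN.
      unfold trunc_rhs.
      assert (Af : a * f x <= Rabs a * f x) by (apply Rmult_le_compat_r; [lra|apply Rle_abs]).
      pose proof (Rabs_pos a).
      assert (8 * Rabs a * f x <= - x * f x) by (apply Rmult_le_compat_r; lra).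
      assert (- x * f x = 4 * g x) by lra.
      assert (1 * g x <= - x * g x) by (apply Rmult_le_compat_r; lra).
      lra. }
  intros t Ht.
  assert (Ft : 0 <= f t) by (apply Fpos; [exact Ht|]; intros y Hy; apply B; lra).
  specialize (B t Ht).
  assert (Gt : 0 < g t) by nra.
  pose proof (trunc_pow_nonneg q M (g t) Hq ltac:(lra)) as HN.
  repeat split; try lra.
  unfold trunc_rhs.
  assert (Af : a * f t <= Rabs a * f t) by (apply Rmult_le_compat_r; [lra|apply Rle_abs]).
  assert (8 * Rabs a * f t <= - t * f t) by (apply Rmult_le_compat_r; lra).
  assert (1 * g t <= - t * g t) by (apply Rmult_le_compat_r; lra).
  lra.
Qed.

(** * The slope of the drift and the trapping region *)

Lemma is_derive_drift (g k : R -> R) (t : R) :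
  0 < g t -> is_derive g t (k t) ->
  is_derive (drift g) t ((q - 1) * (k t / g t) * drift g t).
Proof.
  intros Hg Dg. unfold drift.
  apply (is_derive_eq _ _ (q * (k t * ((q - 1) * Rpower (g t) (q - 1 - 1))))).
  - apply (is_derive_scal (fun t => Rpower (g t) (q - 1))).
    apply (is_derive_comp (fun u => Rpower u (q - 1)) g); [now apply is_derive_Rpower|exact Dg].
  - rewrite (Rpower_pred (g t) (q - 1)) by exact Hg. field. lra.
Qed.

(** The function differentiated here is [(drift g)'], so this is the second-order equation for
    [Y]. *)
Lemma is_derive_slope (g k : R -> R) (t : R) :
  0 < g t -> is_derive g t (k t) ->
  is_derive k t ((drift g t - t / 2) * k t - (a + 1) / 2 * g t) ->
  is_derive (fun t => (q - 1) * (k t / g t) * drift g t) t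
    ((q - 1) * drift g t * ((drift g t - t / 2) * (k t / g t) - (a + 1) / 2 + (q - 2) * (k t / g t) ^ 2)).
Proof.
  intros Hg Dg Dk. pose proof (is_derive_drift g k t Hg Dg) as DY.
  derive_ctx. field. lra.
Qed.

Lemma drift_pos (g : R -> R) (t : R) : 0 < drift g t.
Proof. apply Rmult_lt_0_compat; [lra|apply Rpower_pos]. Qed.

(* When the slope of [drift g] is exactly 1, its derivative is [(drift - t)/2 + (q-2) k/g]. *)
Lemma slope_trap (g k : R -> R) (t0 t1 : R) :
  - S <= t0 ->
  (forall t, t0 <= t <= t1 -> 0 < g t) ->
  (forall t, t0 <= t <= t1 -> is_derive g t (k t)) ->
  (forall t, t0 <= t <= t1 -> is_derive k t ((drift g t - t / 2) * k t - (a + 1) / 2 * g t)) ->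
  K < drift g t0 - t0 -> 1 < (q - 1) * (k t0 / g t0) * drift g t0 ->
  forall t, t0 <= t <= t1 -> 1 < (q - 1) * (k t / g t) * drift g t.
Proof.
  intros Ht0 Hg Dg Dk HD HE t Ht.
  enough (0 < (q - 1) * (k t / g t) * drift g t - 1) by lra.
  revert t Ht.
  apply (positive_barrier (fun t => (q - 1) * (k t / g t) * drift g t - 1)
    (fun t => (q - 1) * drift g t * ((drift g t - t / 2) * (k t / g t) - (a + 1) / 2 + (q - 2) * (k t / g t) ^ 2))).
  - intros x Hx.
    apply (is_derive_eq _ _ ((q - 1) * drift g x * ((drift g x - x / 2) * (k x / g x) - (a + 1) / 2 + (q - 2) * (k x / g x) ^ 2) - 0)); [|ring].
    apply (is_derive_minus (fun t => (q - 1) * (k t / g t) * drift g t) (fun _ => 1)).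
    + apply is_derive_slope; auto.
    + apply (is_derive_const 1).
  - lra.
  - intros x Hx Hz Hb.
    assert (Hmono : drift g t0 - t0 <= drift g x - x).
    { apply (nondecreasing_of_derive (fun t => drift g t - t) (fun t => (q - 1) * (k t / g t) * drift g t - 1)); [| |lra].
      - intros y Hy. apply (is_derive_minus (drift g) (fun t => t)); [|apply (@is_derive_id R_AbsRing)].
        apply is_derive_drift; [apply Hg|apply Dg]; lra.
      - intros y Hy. specialize (Hb y ltac:(lra)). lra. }
    set (Y := drift g x) in *. set (p := k x / g x) in *.
    assert (HY : 1 < Y) by lra.
    assert (Hp : (q - 1) * p * Y = 1) by lra.
    assert (E : (q - 1) * Y * ((Y - x / 2) * p - (a + 1) / 2 + (q - 2) * p ^ 2) = (Y - x) / 2 + (q - 2) * p).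
    { replace ((q - 1) * Y * ((Y - x / 2) * p - (a + 1) / 2 + (q - 2) * p ^ 2))
        with (((q - 1) * p * Y) * (Y - x / 2) - ((a + 1) * (q - 1)) * Y / 2 + (q - 2) * p * ((q - 1) * p * Y)) by field.
      rewrite Hp, Ha. field. }
    rewrite E.
    (* [Y > 1] turns [(q-1) p Y = 1] into [p <= 1/(q-1)]; then [(q-2) p] is beaten by
       [(Y - x)/2 > K/2]. *)
    assert (Hp2 : 0 <= p <= 1 / (q - 1)).
    { replace p with (1 / ((q - 1) * Y)).
      - split.
        + apply Rlt_le, Rdiv_lt_0_compat; [lra|apply Rmult_lt_0_compat; lra].
        + unfold Rdiv. apply Rmult_le_compat_l; [lra|]. apply Rinv_le_contravar; [lra|].
          assert ((q - 1) * 1 <= (q - 1) * Y) by (apply Rmult_le_compat_l; lra). lra.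
      - assert (Y <> 0) by lra. apply Rmult_eq_reg_l with ((q - 1) * Y).
        + transitivity 1; [field; lra|lra].
        + apply Rmult_integral_contrapositive_currified; lra. }
    pose proof (Rmult_Rabs_bounds (q - 2) p (1 / (q - 1)) Hp2) as [Hlo _].
    replace (Rabs (q - 2) * (1 / (q - 1))) with (Rabs (q - 2) / (q - 1)) in Hlo by (field; lra).
    lra.
Qed.

Lemma slope_pos (k g Y : R) : 0 < g -> 0 < Y -> 1 < (q - 1) * (k / g) * Y -> 0 < k.
Proof.
  intros Hg HY H. destruct (Rlt_dec 0 k) as [|Hk]; [assumption|exfalso].
  assert (0 <= - k / g) by (apply Rdiv_le_0_compat; lra).
  replace (k / g) with (- (- k / g)) in H by (field; lra).
  assert (0 <= (q - 1) * (- k / g)) by (apply Rmult_le_pos; lra). nra.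
Qed.

(** While [g <= M] the truncation is invisible and [slope_trap] applies. The positivity of [g] that
    it presupposes is bootstrapped: up to a would-be first zero of [g] one has [k > 0], so [g]
    cannot decrease to 0. *)
Lemma trunc_trap_below (M t0 t1 : R) (f g : R -> R) :
  - S <= t0 -> is_sol M t0 t1 f g -> 0 < g t0 ->
  (forall t, t0 <= t <= t1 -> g t <= M) ->
  K < drift g t0 - t0 -> 1 < (q - 1) * (trunc_rhs M t0 (f t0) (g t0) / g t0) * drift g t0 ->
  forall t, t0 <= t <= t1 ->
    0 < g t /\ 1 < (q - 1) * (trunc_rhs M t (f t) (g t) / g t) * drift g t.
Proof.
  intros Ht0 Hsol Hg0 HM HD HE.
  pose (k := fun t => trunc_rhs M t (f t) (g t)).
  assert (T : forall s, t0 <= s <= t1 -> (forall t, t0 <= t <= s -> 0 < g t) ->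
            forall t, t0 <= t <= s -> 1 < (q - 1) * (k t / g t) * drift g t).
  { intros s Hs Hpos. apply slope_trap; auto.
    - intros t Ht. apply Hsol. lra.
    - intros t Ht. unfold drift. rewrite <- (trunc_deriv_le q M) by (split; [apply Hpos|apply HM]; lra).
      apply (is_derive_trunc_rhs M t0 t1); [exact Hsol|lra]. }
  assert (G : forall t, t0 <= t <= t1 -> 0 < g t).
  { intros t Ht. destruct (Rlt_dec 0 (g t)) as [|Hneg]; [assumption|exfalso].
    destruct (first_zero g t0 t) as [c [Hc1 [Hc2 Hc3]]]; try lra.
    { intros x Hx. destruct (Hsol x ltac:(lra)) as [_ Dg]. eapply is_derive_continuity_pt, Dg. }
    assert (g t0 <= g c); [|lra].
    apply (nondecreasing_of_derive g k); [| |lra].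
    - intros x Hx. apply Hsol. lra.
    - intros x Hx. apply Rlt_le, (slope_pos (k x) (g x) (drift g x)); [apply Hc3; lra|apply drift_pos|].
      apply (T x); [lra| |lra]. intros y Hy. apply Hc3. lra. }
  intros t Ht. split; [now apply G|]. apply (T t1); [lra|exact G|exact Ht].
Qed.

(** Above [M] the slope of the nonlinearity is frozen at [Y = q M^(q-1)], and the trap reads
    [k > e g]: the same threshold, slope 1, with this [Y]. At equality the derivative of [k - e g],
    multiplied by [(q-1) Y / g], is [(Y - x)/2 - e], positive because [Y >= 2 hi + K + 2]. *)
Lemma trunc_trap_above (M t1 hi : R) (f g : R -> R) :
  0 < M -> 0 <= hi -> 2 * hi + K + 2 <= q * Rpower M (q - 1) ->
  is_sol M t1 hi f g -> M <= g t1 ->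
  1 < (q - 1) * (trunc_rhs M t1 (f t1) (g t1) / g t1) * (q * Rpower M (q - 1)) ->
  forall t, t1 <= t <= hi -> 0 < trunc_rhs M t (f t) (g t).
Proof.
  intros HM Hhi HY Hsol HgM HE.
  set (Y := q * Rpower M (q - 1)) in *.
  set (e := 1 / ((q - 1) * Y)).
  assert (HK4 : 4 / (q - 1) <= Y) by lra.
  assert (HY2 : 2 <= Y) by lra.
  assert (HqY : 4 <= (q - 1) * Y).
  { apply Rmult_le_compat_l with (r := q - 1) in HK4; [|lra].
    replace ((q - 1) * (4 / (q - 1))) with 4 in HK4 by (field; lra). exact HK4. }
  assert (He : 0 < e) by (apply Rdiv_lt_0_compat; lra).
  assert (Hee : (q - 1) * Y * e = 1) by (unfold e; field; lra).
  pose (k := fun t => trunc_rhs M t (f t) (g t)).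
  (* [k > e g] makes [g exp (-e t)] nondecreasing, so [g] cannot fall back below [M], where the
     slope would no longer be frozen. *)
  assert (Hgrow : forall x, t1 <= x <= hi -> (forall y, t1 <= y < x -> 0 < k y - e * g y) -> M <= g x).
  { intros x Hx Hb.
    assert (E : g t1 * exp (- (e * t1)) <= g x * exp (- (e * x))).
    { apply (nondecreasing_of_derive (fun t => g t * exp (- (e * t))) (fun t => (k t - e * g t) * exp (- (e * t)))); [| |lra].
      - intros y Hy. destruct (Hsol y ltac:(lra)) as [_ Dg]. derive_ctx. unfold k. ring.
      - intros y Hy. specialize (Hb y ltac:(lra)). pose proof (exp_pos (- (e * y))). nra. }
    assert (exp (- (e * x)) <= exp (- (e * t1))) by (apply exp_le; nra).
    pose proof (exp_pos (- (e * x))). pose proof (exp_pos (- (e * t1))).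
    assert (M * exp (- (e * x)) <= g t1 * exp (- (e * t1))) by nra.
    nra. }
  assert (B : forall t, t1 <= t <= hi -> 0 < k t - e * g t).
  { apply (positive_barrier (fun t => k t - e * g t)
             (fun t => (trunc_deriv q M (g t) - t / 2) * k t - (a + 1) / 2 * g t - e * k t)).
    - intros x Hx. apply (is_derive_minus k (fun t => e * g t)).
      + now apply (is_derive_trunc_rhs M t1 hi).
      + apply (is_derive_scal g). apply Hsol, Hx.
    - fold (k t1) in HE.
      assert (k t1 / g t1 > e).
      { apply Rmult_lt_reg_l with ((q - 1) * Y); [lra|]. rewrite Hee. lra. }
      apply Rmult_gt_compat_r with (r := g t1) in H; [|lra].
      replace (k t1 / g t1 * g t1) with (k t1) in H by (field; lra). lra.
    - intros x Hx Hz Hb.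
      assert (Hgx : M <= g x) by (apply Hgrow; [lra|exact Hb]).
      rewrite trunc_deriv_ge by lra. fold Y.
      replace (k x) with (e * g x) by lra.
      replace ((Y - x / 2) * (e * g x) - (a + 1) / 2 * g x - e * (e * g x))
        with (g x * ((Y - x / 2) * e - (a + 1) / 2 - e * e)) by ring.
      apply Rmult_lt_0_compat; [lra|].
      apply Rmult_lt_reg_l with ((q - 1) * Y); [lra|]. rewrite Rmult_0_r.
      replace ((q - 1) * Y * ((Y - x / 2) * e - (a + 1) / 2 - e * e)) with
        (((q - 1) * Y * e) * (Y - x / 2) - ((a + 1) * (q - 1)) * Y / 2 - ((q - 1) * Y * e) * e) by field.
      rewrite Hee, Ha.
      assert (e <= 1 / 4).
      { unfold e. apply Rmult_le_compat_l; [lra|]. apply Rinv_le_contravar; lra. }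
      lra. }
  intros t Ht.
  assert (M <= g t) by (apply Hgrow; [exact Ht|]; intros y Hy; apply B; lra).
  specialize (B t Ht). fold (k t). nra.
Qed.

(** The two regimes are glued at the first time when [g] reaches [M]; there both forms of the slope
    condition coincide. *)
Lemma trunc_trap (M t0 hi : R) (f g : R -> R) :
  0 < M -> 0 <= hi -> 2 * hi + K + 2 <= q * Rpower M (q - 1) -> - S <= t0 ->
  is_sol M t0 hi f g -> 0 < g t0 ->
  K < trunc_deriv q M (g t0) - t0 ->
  1 < (q - 1) * (trunc_rhs M t0 (f t0) (g t0) / g t0) * trunc_deriv q M (g t0) ->
  forall t, t0 <= t <= hi -> 0 < trunc_rhs M t (f t) (g t).
Proof.
  intros HM Hhi HY Ht0 Hsol Hg0 HD HE t Ht.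
  destruct (Rle_dec M (g t0)) as [HMg|HMg].
  - rewrite trunc_deriv_ge in HE by lra. now apply (trunc_trap_above M t0 hi f g).
  - rewrite trunc_deriv_le in HD, HE by lra.
    assert (Sub : forall c, t0 <= c <= hi -> is_sol M t0 c f g) by (intros c Hc s Hs; apply Hsol; lra).
    assert (Low : forall c, t0 <= c <= hi -> (forall s, t0 <= s <= c -> g s <= M) ->
              0 < g c /\ 1 < (q - 1) * (trunc_rhs M c (f c) (g c) / g c) * drift g c).
    { intros c Hc Hle. apply (trunc_trap_below M t0 c f g); auto. lra. }
    destruct (classic (exists s, t0 <= s <= t /\ M <= g s)) as [[s [Hs1 Hs2]]|Hno].
    + destruct (first_zero (fun x => M - g x) t0 s) as [c [Hc1 [Hc2 Hc3]]]; try lra.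
      { intros x Hx. apply continuity_pt_minus; [now apply continuity_pt_const|].
        destruct (Hsol x ltac:(lra)) as [_ Dg]. eapply is_derive_continuity_pt, Dg. }
      apply (trunc_trap_above M c hi f g); try lra.
      * intros x Hx. apply Hsol. lra.
      * destruct (Low c ltac:(lra)) as [_ H].
        { intros x Hx. destruct (Req_dec x c) as [->|]; [lra|]. specialize (Hc3 x ltac:(lra)). lra. }
        unfold drift in H. replace (g c) with M in H at 3 by lra. exact H.
    + destruct (Low t Ht) as [Hg H].
      { intros s Hs. destruct (Rle_dec (g s) M); [assumption|]. exfalso. apply Hno. exists s. lra. }
      apply (slope_pos _ (g t) (drift g t)); [exact Hg|apply drift_pos|exact H].
Qed.

(** Convexity: [trunc_deriv] is nondecreasing and [trunc_pow] vanishes at 0. *)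
Lemma trunc_pow_le (M u : R) : 0 <= u -> trunc_pow q M u <= trunc_deriv q M u * u.
Proof.
  intros Hu.
  assert (H : trunc_pow q M u - trunc_deriv q M u * u <= trunc_pow q M 0 - trunc_deriv q M u * 0).
  { apply (nonincreasing_of_derive (fun v => trunc_pow q M v - trunc_deriv q M u * v)
             (fun v => trunc_deriv q M v - trunc_deriv q M u)); [| |exact Hu].
    - intros x _. pose proof (is_derive_trunc_pow q M x Hq) as D.
      derive_ctx. ring.
    - intros x Hx. pose proof (trunc_deriv_incr q M x u Hq ltac:(lra)). lra. }
  rewrite trunc_pow_0 in H. lra.
Qed.

(** As long as [Y <= 1], the ratio [p = k/g] satisfies [p' = (Y - t/2) p - b - p^2]; for [t >= 2] it
    loses at least [b] per unit of time while it is nonnegative, so it must become negative.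
    Everything is uniform in [M], so [gam0] can be fixed before [n]. *)
Lemma small_data_turns :
  exists gam0 T, 0 < gam0 /\ 0 <= T /\ forall M f g,
    is_sol M (- S) T f g -> 0 <= f (- S) -> S * f (- S) <= 4 * g (- S) -> 0 < g (- S) <= gam0 ->
    exists t, - S <= t <= T /\ trunc_rhs M t (f t) (g t) < 0.
Proof.
  assert (Hb : 0 < (a + 1) / 2).
  { destruct (Rlt_dec 0 (a + 1)); [lra|exfalso]. nra. }
  (* [P] will bound [k/g] on [[-S, T]], and [T] leaves a time [P/b] after [t = 2] for [k/g] to be
     used up. The level [gs] is where [q gs^(q-1) = 1]; growth at rate [P] over the time [T + S],
     from [gs/2 * exp (-(P (T + S)))], does not reach it. *)
  set (b := (a + 1) / 2) in *. set (P := S + 3). set (T := 2 + P / b).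
  set (gs := Rpower (1 / q) (1 / (q - 1))).
  assert (HT : 0 < P / b) by (apply Rdiv_lt_0_compat; unfold P; lra).
  assert (Hgs : 0 < gs) by apply Rpower_pos.
  exists (gs / 2 * exp (- (P * (T + S)))), T.
  split; [apply Rmult_lt_0_compat; [lra|apply exp_pos]|].
  split; [unfold T; lra|].
  intros M f g Hsol Hf0 HSf Hg0.
  apply NNPP. intros Hno.
  pose (k := fun t => trunc_rhs M t (f t) (g t)).
  assert (Hk : forall t, - S <= t <= T -> 0 <= k t).
  { intros t Ht. apply Rnot_lt_le. intros H. apply Hno. exists t. auto. }
  assert (HT' : - S < T) by (unfold T; lra).
  assert (Hmon : forall s t, - S <= s <= t -> t <= T -> g s <= g t).
  { intros s t Hs Ht. apply (nondecreasing_of_derive g k); [| |lra].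
    - intros x Hx. apply Hsol. lra.
    - intros x Hx. apply Hk. lra. }
  assert (Hg : forall t, - S <= t <= T -> 0 < g t).
  { intros t Ht. specialize (Hmon (- S) t ltac:(lra) ltac:(lra)). lra. }
  assert (HY : forall u, 0 < u <= gs -> trunc_deriv q M u <= 1).
  { intros u Hu. unfold trunc_deriv.
    apply Rle_trans with (q * Rpower gs (q - 1)).
    - apply Rmult_le_compat_l; [lra|]. rewrite <- rpow_pos_eq by exact Hgs.
      apply rpow_le; [lra|]. eapply Rle_trans; [apply Rmin_l|lra].
    - unfold gs. rewrite Rpower_Rinv_cancel; [|apply Rdiv_lt_0_compat; lra|lra].
      right. field. lra. }
  assert (Hgs0 : g (- S) <= gs / 2).
  { assert (exp (- (P * (T + S))) <= exp 0).
    { apply exp_le. assert (0 <= P * (T + S)) by (apply Rmult_le_pos; unfold P; lra). lra. }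
    rewrite exp_0 in *. nra. }
  assert (HP : forall c, - S <= c <= T -> (forall t, - S <= t <= c -> g t <= gs) ->
             forall t, - S <= t <= c -> 0 < P * g t - k t).
  { intros c Hc Hle.
    apply (positive_barrier (fun t => P * g t - k t)
             (fun t => P * k t - ((trunc_deriv q M (g t) - t / 2) * k t - b * g t))).
    - intros x Hx. apply (is_derive_minus (fun t => P * g t) k).
      + apply (is_derive_scal g). apply Hsol. lra.
      + apply (is_derive_trunc_rhs M (- S) T); [exact Hsol|lra].
    - specialize (Hg (- S) ltac:(lra)).
      pose proof (trunc_pow_le M (g (- S)) ltac:(lra)) as H1.
      specialize (HY (g (- S)) ltac:(lra)). unfold k, trunc_rhs, P.
      assert (- a * f (- S) <= Rabs a * f (- S)).
      { apply Rmult_le_compat_r; [exact Hf0|]. rewrite <- Rabs_Ropp. apply Rle_abs. }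
      assert (8 * Rabs a * f (- S) <= S * f (- S)) by (apply Rmult_le_compat_r; lra).
      assert (trunc_deriv q M (g (- S)) * g (- S) <= 1 * g (- S)) by (apply Rmult_le_compat_r; lra).
      assert (0 <= S * g (- S)) by (apply Rmult_le_pos; lra).
      lra.
    - intros x Hx Hz _. specialize (Hg x ltac:(lra)).
      specialize (HY (g x)). specialize (Hle x ltac:(lra)).
      replace (k x) with (P * g x) by lra.
      replace (P * (P * g x) - ((trunc_deriv q M (g x) - x / 2) * (P * g x) - b * g x))
        with (g x * (P * (P - (trunc_deriv q M (g x) - x / 2)) + b)) by ring.
      apply Rmult_lt_0_compat; [exact Hg|].
      assert (0 <= P * (P - (trunc_deriv q M (g x) - x / 2))); [|lra].
      apply Rmult_le_pos; unfold P; [lra|]. specialize (HY ltac:(lra)). lra. }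
  assert (Hle : forall t, - S <= t <= T -> g t <= gs).
  { intros t Ht. apply Rnot_lt_le. intros Hgt.
    destruct (first_zero (fun x => gs - g x) (- S) t) as [c [Hc1 [Hc2 Hc3]]]; try lra.
    { intros x Hx. apply continuity_pt_minus; [now apply continuity_pt_const|].
      destruct (Hsol x ltac:(lra)) as [_ Dg]. eapply is_derive_continuity_pt, Dg. }
    assert (HPc : forall s, - S <= s <= c -> 0 < P * g s - k s).
    { apply HP; [lra|]. intros s Hs. destruct (Req_dec s c) as [->|]; [lra|].
      specialize (Hc3 s ltac:(lra)). lra. }
    assert (E : g c * exp (- (P * c)) <= g (- S) * exp (- (P * - S))).
    { apply (nonincreasing_of_derive (fun t => g t * exp (- (P * t))) (fun t => - (P * g t - k t) * exp (- (P * t)))); [| |lra].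
      - intros y Hy. destruct (Hsol y ltac:(lra)) as [_ Dg]. derive_ctx. unfold k. ring.
      - intros y Hy. specialize (HPc y ltac:(lra)). pose proof (exp_pos (- (P * y))). nra. }
    apply Rmult_le_compat_r with (r := exp (P * c)) in E; [|apply Rlt_le, exp_pos].
    rewrite !Rmult_assoc, <- !exp_plus in E.
    replace (- (P * c) + P * c) with 0 in E by ring. rewrite exp_0 in E.
    assert (exp (- (P * - S) + P * c) <= exp (P * (T + S))).
    { apply exp_le. assert (P * c <= P * T) by (apply Rmult_le_compat_l; unfold P; lra). lra. }
    assert (g (- S) * exp (- (P * - S) + P * c) <= gs / 2 * exp (- (P * (T + S))) * exp (P * (T + S))).
    { apply Rmult_le_compat; try lra. apply Rlt_le, exp_pos. }
    rewrite Rmult_assoc, <- exp_plus in H0.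
    replace (- (P * (T + S)) + P * (T + S)) with 0 in H0 by ring. rewrite exp_0 in H0. lra. }
  assert (D : forall t, 2 <= t <= T ->
    is_derive (fun t => k t / g t + b * t) t ((trunc_deriv q M (g t) - t / 2) * (k t / g t) - (k t / g t) ^ 2)).
  { intros t Ht. destruct (Hsol t ltac:(lra)) as [_ Dg]. fold (k t) in Dg.
    pose proof (is_derive_trunc_rhs M (- S) T f g t Hsol ltac:(lra)) as Dk. fold k in Dk. fold (k t) in Dk.
    specialize (Hg t ltac:(lra)).
    derive_ctx. unfold b. field. lra. }
  assert (HT2 : 2 <= T) by (unfold T; lra).
  assert (E : k T / g T + b * T <= k 2 / g 2 + b * 2).
  { apply (nonincreasing_of_derive _ _ 2 T D); [|exact HT2].
    intros x Hx. specialize (Hk x ltac:(lra)). pose proof (Hg x ltac:(lra)).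
    specialize (HY (g x) ltac:(split; [lra|apply Hle; lra])).
    assert (0 <= k x / g x) by (apply Rdiv_le_0_compat; lra).
    assert (0 <= (k x / g x) ^ 2) by apply pow2_ge_0. nra. }
  assert (0 <= k T / g T) by (apply Rdiv_le_0_compat; [apply Hk|apply Hg]; lra).
  assert (k 2 / g 2 < P).
  { apply Rlt_div_l; [apply Hg; lra|]. pose proof (HP T ltac:(lra) Hle 2 ltac:(lra)). lra. }
  assert (b * T = 2 * b + P) by (unfold T; field; lra).
  lra.
Qed.

(** * Existence and continuous dependence for the truncated equation *)

Definition rhs_lip (M n : R) : R := q * Rpower M (q - 1) + n + Rabs a + 1.

Lemma rhs_lip_pos (M n : R) : 0 <= n -> 0 < rhs_lip M n.
Proof.
  intros Hn. pose proof (Rpower_pos M (q - 1)). pose proof (Rabs_pos a). unfold rhs_lip.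
  assert (0 < q * Rpower M (q - 1)) by (apply Rmult_lt_0_compat; lra). lra.
Qed.

Lemma trunc_rhs_lipschitz (M n t x1 y1 x2 y2 : R) :
  0 < M -> Rabs t <= n ->
  Rabs (trunc_rhs M t x1 y1 - trunc_rhs M t x2 y2) <= rhs_lip M n * (Rabs (x1 - x2) + Rabs (y1 - y2)).
Proof.
  intros HM Ht. unfold trunc_rhs, rhs_lip.
  replace (trunc_pow q M y1 - t / 2 * y1 - a / 2 * x1 - (trunc_pow q M y2 - t / 2 * y2 - a / 2 * x2))
    with ((trunc_pow q M y1 - trunc_pow q M y2) + (- (t / 2) * (y1 - y2) + - (a / 2) * (x1 - x2))) by ring.
  eapply Rle_trans; [apply Rabs_triang|].
  eapply Rle_trans; [apply Rplus_le_compat_l, Rabs_triang|].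
  pose proof (trunc_pow_lipschitz q M y1 y2 Hq HM) as H1.
  rewrite !Rabs_mult, !Rabs_Ropp. unfold Rdiv. rewrite !Rabs_mult, (Rabs_right (/ 2)) by lra.
  set (u := Rabs (x1 - x2)) in *. set (v := Rabs (y1 - y2)) in *.
  assert (0 <= u) by apply Rabs_pos. assert (0 <= v) by apply Rabs_pos.
  pose proof (Rabs_pos a). pose proof (Rabs_pos t).
  assert (0 < q * Rpower M (q - 1)) by (apply Rmult_lt_0_compat; [lra|apply Rpower_pos]).
  set (L := q * Rpower M (q - 1)) in *. assert (0 <= L * u) by nra.
  assert (Rabs t * v <= n * v) by (apply Rmult_le_compat_r; lra).
  assert (0 <= Rabs t * v) by nra. assert (0 <= Rabs a * v) by nra.
  assert (0 <= Rabs a * u) by nra. assert (0 <= n * u) by nra. lra.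
Qed.

Lemma trunc_solution (M n t0 x0 y0 : R) : 0 < M -> 0 < n ->
  exists f g : R -> R, f t0 = x0 /\ g t0 = y0 /\ is_sol M (- n) n f g.
Proof.
  intros HM Hn.
  (* Clamping time to [[-n, n]] bounds the coefficient [t/2], as a global Lipschitz constant
     requires; inside the interval nothing changes. *)
  pose (cl := fun t => (Rabs (t + n) - Rabs (t - n)) / 2).
  assert (Hcl : forall t, - n <= t <= n -> cl t = t).
  { intros t Ht. unfold cl. rewrite Rabs_right, (Rabs_left1 (t - n)) by lra. lra. }
  assert (Hcl2 : forall t, Rabs (cl t) <= n).
  { intros t. apply Rabs_le. unfold cl.
    destruct (Rle_dec 0 (t + n)); destruct (Rle_dec 0 (t - n));
      [rewrite (Rabs_right (t + n)), (Rabs_right (t - n))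
      |rewrite (Rabs_right (t + n)), (Rabs_left (t - n))
      |rewrite (Rabs_left (t + n)), (Rabs_right (t - n))
      |rewrite (Rabs_left (t + n)), (Rabs_left (t - n))]; lra. }
  destruct (picard_lindelof (fun t x y => trunc_rhs M (cl t) x y) (rhs_lip M n)
              (Rabs (trunc_rhs M 0 x0 y0) + n * Rabs y0) t0 x0 y0) as [f [g [Hf [Hg H]]]].
  - apply rhs_lip_pos. lra.
  - intros t x1 y1 x2 y2. now apply trunc_rhs_lipschitz.
  - intros x y t. unfold trunc_rhs, cl. reg.
  - intros t. unfold trunc_rhs.
    replace (trunc_pow q M y0 - cl t / 2 * y0 - a / 2 * x0)
      with ((trunc_pow q M y0 - 0 / 2 * y0 - a / 2 * x0) + - (cl t / 2) * y0) by field.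
    eapply Rle_trans; [apply Rabs_triang|]. apply Rplus_le_compat_l.
    rewrite Rabs_mult, Rabs_Ropp. apply Rmult_le_compat_r; [apply Rabs_pos|].
    unfold Rdiv. rewrite Rabs_mult, (Rabs_right (/ 2)) by lra.
    specialize (Hcl2 t). pose proof (Rabs_pos (cl t)). lra.
  - exists f, g. split; [exact Hf|split; [exact Hg|]]. intros t Ht. split; [apply H|].
    pose proof (proj2 (H t)) as H'. simpl in H'. rewrite Hcl in H' by assumption. exact H'.
Qed.

Lemma trunc_dependence (M n : R) (f1 g1 f2 g2 : R -> R) (t0 : R) :
  0 < M -> 0 < n -> is_sol M (- n) n f1 g1 -> is_sol M (- n) n f2 g2 -> - n <= t0 <= n ->
  forall d, 0 <= d -> (f1 t0 - f2 t0) ^ 2 + (g1 t0 - g2 t0) ^ 2 <= d ^ 2 ->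
  forall t, - n <= t <= n ->
    Rabs (f1 t - f2 t) <= exp ((3 * rhs_lip M n + 1) * n) * d /\
    Rabs (g1 t - g2 t) <= exp ((3 * rhs_lip M n + 1) * n) * d.
Proof.
  intros HM Hn H1 H2 Ht0 d Hd Hinit t Ht.
  pose proof (rhs_lip_pos M n ltac:(lra)) as HL.
  assert (V : (f1 t - f2 t) ^ 2 + (g1 t - g2 t) ^ 2
     <= exp ((3 * rhs_lip M n + 1) * (n - - n)) * ((f1 t0 - f2 t0) ^ 2 + (g1 t0 - g2 t0) ^ 2)).
  { apply (gronwall_pair f1 g1 f2 g2 (fun t => trunc_rhs M t (f1 t) (g1 t)) (fun t => trunc_rhs M t (f2 t) (g2 t))
             (rhs_lip M n) (- n) n t0); auto; try lra.
    intros s Hs. apply trunc_rhs_lipschitz; [exact HM|]. apply Rabs_le. lra. }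
  set (E := exp ((3 * rhs_lip M n + 1) * n)).
  assert (HE : 0 < E) by apply exp_pos.
  replace (exp ((3 * rhs_lip M n + 1) * (n - - n))) with (E * E) in V
    by (unfold E; rewrite <- exp_plus; f_equal; ring).
  assert (V2 : (f1 t - f2 t) ^ 2 + (g1 t - g2 t) ^ 2 <= (E * d) ^ 2).
  { eapply Rle_trans; [exact V|]. replace ((E * d) ^ 2) with (E * E * d ^ 2) by ring.
    apply Rmult_le_compat_l; [nra|exact Hinit]. }
  pose proof (pow2_ge_0 (f1 t - f2 t)). pose proof (pow2_ge_0 (g1 t - g2 t)).
  assert (0 <= E * d) by nra.
  split; (rewrite <- (Rabs_right (E * d)) by lra); apply Rsqr_le_abs_0; unfold Rsqr; lra.
Qed.

(** Failure of the second outcome says that [Y - t] cannot increase while it exceeds [K]; starting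
    at most at [K], it stays there. *)
Lemma not_trapped_bound (M n : R) (f g : R -> R) :
  0 < M -> 2 * n + K + 2 <= q * Rpower M (q - 1) -> is_sol M (- S) n f g -> S < n ->
  0 < g (- S) -> S / 4 * g (- S) <= trunc_rhs M (- S) (f (- S)) (g (- S)) ->
  (forall t, - S <= t <= n -> 0 <= trunc_rhs M t (f t) (g t)) ->
  (forall t, - S <= t <= n -> K < trunc_deriv q M (g t) - t ->
     (q - 1) * (trunc_rhs M t (f t) (g t) / g t) * trunc_deriv q M (g t) <= 1) ->
  forall t, - S <= t <= n -> trunc_deriv q M (g t) <= t + K.
Proof.
  intros HM HYM Hsol Hn Hg0 Hk0 Hk Hnt t Ht.
  pose (k := fun t => trunc_rhs M t (f t) (g t)).
  set (Y := fun t => trunc_deriv q M (g t)).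
  assert (Hmon : forall s t, - S <= s <= t -> t <= n -> g s <= g t).
  { intros s r Hs Hr. apply (nondecreasing_of_derive g k); [| |lra].
    - intros x Hx. apply Hsol. lra.
    - intros x Hx. apply Hk. lra. }
  assert (Hg : forall t, - S <= t <= n -> 0 < g t).
  { intros s Hs. specialize (Hmon (- S) s ltac:(lra) ltac:(lra)). lra. }
  assert (HYpos : forall t, - S <= t <= n -> 0 < Y t) by (intros s Hs; apply trunc_deriv_pos; auto).
  (* At [-S] the ratio [k/g] is at least [S/4 >= 1/4], so a slope of at most 1 forces
     [Y <= 4/(q-1) <= K - S]. *)
  assert (Hstart : Y (- S) <= - S + K).
  { apply Rnot_lt_le. intros H. specialize (Hnt (- S) ltac:(lra) ltac:(unfold Y in H; lra)).
    fold (Y (- S)) in Hnt. specialize (HYpos (- S) ltac:(lra)).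
    assert (S / 4 <= k (- S) / g (- S)) by (apply (Rle_div_r (S / 4)); [lra|exact Hk0]).
    fold (k (- S)) in Hnt.
    assert ((q - 1) * (1 / 4) <= (q - 1) * (k (- S) / g (- S))) by (apply Rmult_le_compat_l; lra).
    assert ((q - 1) * (1 / 4) * Y (- S) <= 1)
      by (eapply Rle_trans; [apply Rmult_le_compat_r; [lra|eassumption]|exact Hnt]).
    assert (Y (- S) <= 4 / (q - 1)) by (apply (proj1 (Rle_div_r (Y (- S)) 4 (q - 1) ltac:(lra))); lra). lra. }
  apply Rnot_lt_le. intros Hbad. fold (Y t) in Hbad.
  assert (CY : forall x, - S <= x <= n -> continuity_pt Y x).
  { intros x Hx. apply (continuity_pt_comp g (trunc_deriv q M)).
    - destruct (Hsol x ltac:(lra)) as [_ Dg]. eapply is_derive_continuity_pt, Dg.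
    - now apply trunc_deriv_continuity. }
  (* The last time before [t] with [Y x - x <= K], found as a first time for the reversed flow. *)
  destruct (first_zero (fun x => Y (- x) + x - K) (- t) S) as [c [Hc1 [Hc2 Hc3]]].
  { lra. }
  { intros x Hx. apply continuity_pt_minus; [apply continuity_pt_plus|].
    - apply (continuity_pt_comp (fun x => - x) Y); [reg|apply CY; lra].
    - apply derivable_continuous_pt, derivable_pt_id.
    - now apply continuity_pt_const. }
  { rewrite Ropp_involutive. lra. }
  { lra. }
  set (r := - c) in *.
  assert (Hafter : forall x, r < x <= t -> K < Y x - x).
  { intros x Hx. specialize (Hc3 (- x) ltac:(unfold r in *; lra)). simpl in Hc3.
    rewrite Ropp_involutive in Hc3. lra. }
  assert (Hr : - S <= r < t) by (unfold r; lra).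
  assert (HrY : Y r = r + K) by (unfold r in *; lra).
  (* For [g r >= M] one would have [Y r >= 2n + K + 2 > r + K]. So [g < M] near [r], where [Y] is
     the untruncated, differentiable [drift]. *)
  assert (HrM : g r < M).
  { apply Rnot_le_lt. intros H. unfold Y in HrY. rewrite trunc_deriv_ge in HrY by lra. lra. }
  destruct (continuity_pt_eps g r (M - g r)) as [d [Hd Hd2]].
  { destruct (Hsol r ltac:(lra)) as [_ Dg]. eapply is_derive_continuity_pt, Dg. }
  { lra. }
  set (s := Rmin t (r + d / 2)).
  assert (Hs : r < s <= t /\ s <= r + d / 2) by
    (unfold s; split; [split; [apply Rmin_glb_lt; lra|apply Rmin_l]|apply Rmin_r]).
  assert (HsM : g s < M).
  { specialize (Hd2 s ltac:(apply Rabs_def1; lra)). apply Rabs_def2 in Hd2. lra. }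
  assert (Hle : forall x, r <= x <= s -> 0 < g x <= M).
  { intros x Hx. split; [apply Hg; lra|]. specialize (Hmon x s ltac:(lra) ltac:(lra)). lra. }
  assert (EY : forall x, r <= x <= s -> Y x = drift g x) by
    (intros x Hx; apply trunc_deriv_le; auto).
  assert (drift g s - s <= drift g r - r).
  { apply (nonincreasing_of_derive (fun t => drift g t - t) (fun t => (q - 1) * (k t / g t) * drift g t - 1)); [| |lra].
    - intros y Hy. apply (is_derive_minus (drift g) (fun t => t)); [|apply (@is_derive_id R_AbsRing)].
      apply is_derive_drift; [apply Hg|apply Hsol]; lra.
    - intros y Hy. specialize (Hnt y ltac:(lra) ltac:(apply Hafter; lra)).
      fold (Y y) in Hnt. rewrite EY in Hnt by lra. unfold k. lra. }
  specialize (Hafter s ltac:(lra)). rewrite EY in Hafter by lra. rewrite EY in HrY by lra. lra.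
Qed.

(** At a zero of [k] its derivative is [-(a+1)/2 g < 0], so [k] would be negative just afterwards.
    The second outcome asks for this strict positivity, both to be an open condition and to exclude
    the first outcome. *)
Lemma trunc_rhs_positive_before (M lo t : R) (f g : R -> R) :
  is_sol M lo t f g -> (forall s, lo <= s <= t -> 0 < g s) ->
  (forall s, lo <= s <= t -> 0 <= trunc_rhs M s (f s) (g s)) ->
  forall s, lo <= s < t -> 0 < trunc_rhs M s (f s) (g s).
Proof.
  intros Hsol Hg Hk s Hs.
  pose (k := fun t => trunc_rhs M t (f t) (g t)).
  destruct (Hk s ltac:(lra)) as [H|H]; [exact H|exfalso].
  assert (Hb : 0 < (a + 1) / 2).
  { destruct (Rlt_dec 0 (a + 1)); [lra|exfalso]. nra. }
  pose proof (is_derive_trunc_rhs M lo t f g s Hsol ltac:(lra)) as D.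
  rewrite <- H, Rmult_0_r, Rminus_0_l in D. apply is_derive_Reals in D.
  specialize (Hg s ltac:(lra)).
  assert (Hneg : 0 < (a + 1) / 2 * g s) by nra.
  destruct (D _ Hneg) as [d Hd]. pose proof (cond_pos d) as Hdp.
  set (h := Rmin (d / 2) (t - s)).
  assert (Hh : 0 < h) by (apply Rmin_glb_lt; lra).
  assert (Hh1 : h <= d / 2) by apply Rmin_l. assert (Hh2 : h <= t - s) by apply Rmin_r.
  specialize (Hd h ltac:(lra) ltac:(rewrite Rabs_right; lra)).
  rewrite <- H in Hd. apply Rabs_def2 in Hd.
  specialize (Hk (s + h) ltac:(lra)).
  assert (0 <= (trunc_rhs M (s + h) (f (s + h)) (g (s + h)) - 0) / h) by (apply Rdiv_le_0_compat; lra).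
  lra.
Qed.

(** * Selection of a solution on [[-n, n]] *)

Definition rhs (t x y : R) : R := Rpower y q - t / 2 * y - a / 2 * x.

(** Of the pointwise inequalities only [0 < g] can be lost as [n] tends to infinity; the last
    clause, a lower bound independent of [n], rules out the zero limit. *)
Definition admissible (gam0 n : R) (f g : R -> R) : Prop :=
  (forall t, - n <= t <= n ->
     is_derive f t (g t) /\ is_derive g t (rhs t (f t) (g t)) /\
     0 <= f t /\ 0 < g t /\ 0 <= rhs t (f t) (g t) /\
     (t <= - S -> - t * f t <= 4 * g t) /\ (- S <= t -> drift g t <= t + K)) /\
  gam0 <= g (- S).

Lemma shooting_level (gam0 T n : R) :
  0 < gam0 -> 0 <= T ->
  (forall M f g,
    is_sol M (- S) T f g -> 0 <= f (- S) -> S * f (- S) <= 4 * g (- S) -> 0 < g (- S) <= gam0 ->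
    exists t, - S <= t <= T /\ trunc_rhs M t (f t) (g t) < 0) ->
  S < n -> T <= n -> exists f g, admissible gam0 n f g.
Proof.
  intros Hgam0 HT Hsmall HSn HTn.
  (* [M] is the smallest level that the trap above [M] accepts on [[-S, n]]; [gam2] solves
     [q gam2^(q-1) = K + 2], so that the datum [gam2] is trapped already at [-S]. *)
  set (M := Rpower ((2 * n + K + 2) / q) (1 / (q - 1))).
  set (gam2 := Rpower ((K + 2) / q) (1 / (q - 1))).
  assert (HM : 0 < M) by apply Rpower_pos.
  assert (HMY : q * Rpower M (q - 1) = 2 * n + K + 2).
  { unfold M. rewrite Rpower_Rinv_cancel; [field; lra|apply Rdiv_lt_0_compat; lra|lra]. }
  assert (Hgam2 : 0 < gam2) by apply Rpower_pos.
  assert (HgY : q * Rpower gam2 (q - 1) = K + 2).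
  { unfold gam2. rewrite Rpower_Rinv_cancel; [field; lra|apply Rdiv_lt_0_compat; lra|lra]. }
  assert (Hgam2M : gam2 <= M).
  { apply Rle_Rpower_l.
    - apply Rlt_le, Rdiv_lt_0_compat; lra.
    - split; [apply Rdiv_lt_0_compat; lra|]. apply Rmult_le_compat_r; [|lra].
      apply Rlt_le, Rinv_0_lt_compat. lra. }
  destruct (fun_choice _ _ (fun gam (fg : (R -> R) * (R -> R)) =>
      fst fg (- n) = 0 /\ snd fg (- n) = gam /\ is_sol M (- n) n (fst fg) (snd fg))) as [FG HFG].
  { intros gam. destruct (trunc_solution M n (- n) 0 gam HM ltac:(lra)) as [f [g H]].
    exists (f, g). exact H. }
  pose (F := fun gam => fst (FG gam)). pose (G := fun gam => snd (FG gam)).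
  pose (k := fun gam t => trunc_rhs M t (F gam t) (G gam t)).
  assert (Hsol : forall gam, is_sol M (- n) n (F gam) (G gam)) by (intros gam; apply HFG).
  assert (HF0 : forall gam, F gam (- n) = 0) by (intros gam; apply HFG).
  assert (HG0 : forall gam, G gam (- n) = gam) by (intros gam; apply HFG).
  clearbody F G. clear FG HFG.
  set (C := exp ((3 * rhs_lip M n + 1) * n)).
  assert (HC : 0 < C) by apply exp_pos.
  assert (Hdep : forall x y t, - n <= t <= n ->
      Rabs (F y t - F x t) <= C * Rabs (y - x) /\ Rabs (G y t - G x t) <= C * Rabs (y - x)).
  { intros x y t Ht. apply (trunc_dependence M n (F y) (G y) (F x) (G x) (- n)); auto; try lra.
    - apply Rabs_pos.
    - rewrite !HF0, !HG0, pow2_abs. lra. }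
  pose proof (rhs_lip_pos M n ltac:(lra)) as HL.
  set (C2 := rhs_lip M n * (2 * C)).
  assert (HC2 : 0 < C2) by (apply Rmult_lt_0_compat; lra).
  assert (Hdk : forall x y t, - n <= t <= n -> Rabs (k y t - k x t) <= C2 * Rabs (y - x)).
  { intros x y t Ht. eapply Rle_trans; [apply (trunc_rhs_lipschitz M n); [exact HM|apply Rabs_le; lra]|].
    destruct (Hdep x y t Ht) as [H1 H2]. unfold C2. rewrite Rmult_assoc.
    apply Rmult_le_compat_l; lra. }
  assert (Hleft : forall gam, 0 < gam -> forall t, - n <= t <= - S ->
    0 <= F gam t /\ 0 < G gam t /\ - t * F gam t <= 4 * G gam t /\ - t / 4 * G gam t <= k gam t).
  { intros gam Hgam. apply left_barrier; auto; [lra| |now rewrite HG0].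
    intros t Ht. apply Hsol. lra. }
  (* In [B], [k > 0] on the whole past of the time [t] by definition, and after [t] by the trap;
     this makes [A] and [B] disjoint. *)
  pose (A := fun gam => exists t, - n <= t <= n /\ k gam t < 0).
  pose (B := fun gam => exists t, - S <= t <= n /\ 0 < G gam t /\ K < trunc_deriv q M (G gam t) - t /\
     1 < (q - 1) * (k gam t / G gam t) * trunc_deriv q M (G gam t) /\
     forall s, - n <= s <= t -> 0 < k gam s).
  (* [C] is the Gronwall constant. Comparison with the zero solution gives
     [g (-S) <= C gam1 <= gam0], small enough for [k] to turn negative. *)
  set (gam1 := Rmin gam2 (gam0 / C)).
  assert (Hgam1 : 0 < gam1) by (apply Rmin_glb_lt; [lra|apply Rdiv_lt_0_compat; lra]).
  assert (Hgam12 : gam1 <= gam2) by apply Rmin_l.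
  destruct (open_disjoint_gap A B gam1 gam2) as [gam [Hgam [HA HB]]].
  - exact Hgam12.
  - assert (Hz : is_sol M (- n) n (fun _ => 0) (fun _ => 0)).
    { intros t Ht. split; [apply (is_derive_const 0)|].
      apply (is_derive_eq _ _ 0); [apply (is_derive_const 0)|].
      unfold trunc_rhs. rewrite trunc_pow_0. ring. }
    destruct (Hleft gam1 Hgam1 (- S) ltac:(lra)) as [L1 [L2 [L3 _]]].
    destruct (trunc_dependence M n (F gam1) (G gam1) (fun _ => 0) (fun _ => 0) (- n) HM ltac:(lra)
        (Hsol gam1) Hz ltac:(lra) gam1 ltac:(lra) ltac:(rewrite HF0, HG0; right; ring) (- S) ltac:(lra))
      as [_ Hd].
    fold C in Hd. rewrite Rminus_0_r, Rabs_right in Hd by lra.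
    assert (C * gam1 <= gam0).
    { apply Rle_trans with (C * (gam0 / C)); [apply Rmult_le_compat_l; [lra|apply Rmin_r]|].
      right. field. lra. }
    destruct (Hsmall M (F gam1) (G gam1)) as [t [Ht1 Ht2]].
    + intros t Ht. apply Hsol. lra.
    + exact L1.
    + lra.
    + lra.
    + exists t. split; [lra|exact Ht2].
  - exists (- S).
    assert (Hge : gam2 <= G gam2 (- S)).
    { rewrite <- (HG0 gam2) at 1. apply (nondecreasing_of_derive (G gam2) (k gam2)); [| |lra].
      - intros x Hx. apply Hsol. lra.
      - intros x Hx. destruct (Hleft gam2 Hgam2 x ltac:(lra)) as [_ [H1 [_ H2]]].
        assert (0 <= - x / 4 * G gam2 x) by (apply Rmult_le_pos; lra). lra. }
    pose proof (trunc_deriv_incr q M _ _ Hq Hge) as HY.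
    rewrite (trunc_deriv_le q M gam2), HgY in HY by lra.
    destruct (Hleft gam2 Hgam2 (- S) ltac:(lra)) as [_ [L2 [_ L4]]].
    split; [lra|split; [exact L2|split; [lra|split]]].
    + assert (Hp : S / 4 <= k gam2 (- S) / G gam2 (- S)).
      { apply (proj1 (Rle_div_r (S / 4) _ _ L2)). lra. }
      assert (Hp2 : (q - 1) * (1 / 4) <= (q - 1) * (k gam2 (- S) / G gam2 (- S))) by (apply Rmult_le_compat_l; lra).
      apply Rlt_le_trans with ((q - 1) * (1 / 4) * (K + 2)).
      * assert (HK4 : 4 / (q - 1) < K + 2) by lra.
        apply Rmult_lt_compat_l with (r := (q - 1) * (1 / 4)) in HK4; [|lra].
        replace ((q - 1) * (1 / 4) * (4 / (q - 1))) with 1 in HK4 by (field; lra). exact HK4.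
      * apply Rmult_le_compat; lra.
    + intros s Hs. destruct (Hleft gam2 Hgam2 s Hs) as [_ [H1 [_ H2]]].
      assert (0 < - s / 4 * G gam2 s) by (apply Rmult_lt_0_compat; lra). lra.
  - intros x Hx [t [Ht1 Ht2]].
    exists (- k x t / C2). split; [apply Rdiv_lt_0_compat; lra|].
    intros y Hy Hxy. exists t. split; [exact Ht1|].
    specialize (Hdk x y t Ht1). apply Rmult_lt_compat_l with (r := C2) in Hxy; [|exact HC2].
    replace (C2 * (- k x t / C2)) with (- k x t) in Hxy by (field; lra).
    pose proof (Rle_abs (k y t - k x t)). lra.
  - intros x Hx [t [Ht1 [Hg [HD [HE Hk]]]]].
    assert (Htn : - n <= t <= n) by lra.
    assert (CG : continuity_pt (fun x => G x t) x).
    { apply (lipschitz_continuity_pt _ x C HC). intros y. now apply Hdep. }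
    assert (Ck : continuity_pt (fun x => k x t) x).
    { apply (lipschitz_continuity_pt _ x C2 HC2). intros y. now apply Hdk. }
    assert (CY : continuity_pt (fun x => trunc_deriv q M (G x t)) x).
    { apply (continuity_pt_comp (fun x => G x t) (trunc_deriv q M)); [exact CG|].
      now apply trunc_deriv_continuity. }
    destruct (continuity_pt_open _ x 0 CG Hg) as [d1 [Hd1 K1]].
    destruct (continuity_pt_open _ x (K + t) CY ltac:(lra)) as [d2 [Hd2 K2]].
    destruct (continuity_pt_open (fun x => (q - 1) * (k x t / G x t) * trunc_deriv q M (G x t)) x 1)
      as [d3 [Hd3 K3]]; [|exact HE|].
    { apply continuity_pt_mult; [|exact CY]. apply continuity_pt_mult.
      - now apply continuity_pt_const.
      - apply continuity_pt_div; [exact Ck|exact CG|lra]. }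
    (* Positivity of [k] on all of [[-n, t]] is stable in [gam] because its minimum there is
       positive. *)
    destruct (continuity_ab_min (k x) (- n) t) as [m [Hm1 Hm2]]; [lra| |].
    { intros c Hc. eapply is_derive_continuity_pt.
      apply (is_derive_trunc_rhs M (- n) n); [apply Hsol|lra]. }
    assert (Hkm : 0 < k x m) by (apply Hk; lra).
    exists (Rmin (Rmin d1 d2) (Rmin d3 (k x m / C2))).
    split; [repeat apply Rmin_glb_lt; auto; apply Rdiv_lt_0_compat; lra|].
    intros y Hy Hxy.
    assert (Y1 : Rabs (y - x) < Rmin d1 d2) by (eapply Rlt_le_trans; [exact Hxy|apply Rmin_l]).
    assert (Y2 : Rabs (y - x) < Rmin d3 (k x m / C2)) by (eapply Rlt_le_trans; [exact Hxy|apply Rmin_r]).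
    exists t. split; [exact Ht1|]. split; [|split; [|split]].
    + apply K1. eapply Rlt_le_trans; [exact Y1|apply Rmin_l].
    + enough (K + t < trunc_deriv q M (G y t)) by lra.
      apply K2. eapply Rlt_le_trans; [exact Y1|apply Rmin_r].
    + apply K3. eapply Rlt_le_trans; [exact Y2|apply Rmin_l].
    + intros s Hs. specialize (Hdk x y s ltac:(lra)). specialize (Hm1 s Hs).
      assert (Y3 : Rabs (y - x) < k x m / C2) by (eapply Rlt_le_trans; [exact Y2|apply Rmin_r]).
      apply Rmult_lt_compat_l with (r := C2) in Y3; [|exact HC2].
      replace (C2 * (k x m / C2)) with (k x m) in Y3 by (field; lra).
      assert (Rabs (k y s - k x s) < k x m) as Y4 by lra.
      apply Rabs_def2 in Y4. lra.
  - intros x Hx [t [Ht1 Ht2]] [r [Hr1 [Hg [HD [HE Hk]]]]].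
    destruct (Rle_dec t r) as [Htr|Htr]; [specialize (Hk t ltac:(lra)); lra|].
    assert (0 < k x t); [|lra].
    apply (trunc_trap M r n (F x) (G x)); auto; try lra.
    intros s Hs. apply Hsol. lra.
  - assert (Hk : forall t, - n <= t <= n -> 0 <= k gam t).
    { intros t Ht. apply Rnot_lt_le. intros H. apply HA. exists t. auto. }
    assert (Hpos : 0 < gam) by lra.
    assert (Hmon : forall s t, - n <= s <= t -> t <= n -> G gam s <= G gam t).
    { intros s t Hs Ht. apply (nondecreasing_of_derive (G gam) (k gam)); [| |lra].
      - intros x Hx. apply Hsol. lra.
      - intros x Hx. apply Hk. lra. }
    assert (Hg : forall t, - n <= t <= n -> 0 < G gam t).
    { intros t Ht. specialize (Hmon (- n) t ltac:(lra) ltac:(lra)). rewrite HG0 in Hmon. lra. }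
    assert (HY : forall t, - S <= t <= n -> trunc_deriv q M (G gam t) <= t + K).
    { apply (not_trapped_bound M n (F gam) (G gam)); auto; try lra.
      - intros t Ht. apply Hsol. lra.
      - apply Hg. lra.
      - destruct (Hleft gam Hpos (- S) ltac:(lra)) as [_ [_ [_ H]]].
        rewrite Ropp_involutive in H. exact H.
      - intros t Ht. apply Hk. lra.
      - intros t Ht HD. apply Rnot_lt_le. intros HE. apply HB. exists t.
        assert (Hgt : 0 < G gam t) by (apply Hg; lra).
        assert (HYt : 0 < trunc_deriv q M (G gam t)) by (apply trunc_deriv_pos; auto).
        assert (Hkt : 0 < k gam t) by exact (slope_pos _ _ _ Hgt HYt HE).
        split; [exact Ht|split; [exact Hgt|split; [exact HD|split; [exact HE|]]]].
        intros s Hs. destruct (Req_dec s t) as [->|Hne]; [exact Hkt|].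
        apply (trunc_rhs_positive_before M (- n) t); try lra.
        + intros x Hx. apply Hsol. lra.
        + intros x Hx. apply Hg. lra.
        + intros x Hx. apply Hk. lra. }
    (* If [g n > M], then [Y n] would equal [2n + K + 2], above the bound [n + K]. Hence the
       truncation never acts on the selected solution. *)
    assert (HgM : forall t, - n <= t <= n -> G gam t <= M).
    { intros t Ht. apply Rle_trans with (G gam n); [apply Hmon; lra|].
      apply Rnot_lt_le. intros H. specialize (HY n ltac:(lra)).
      rewrite trunc_deriv_ge in HY by lra. lra. }
    assert (Hrhs : forall t, - n <= t <= n -> k gam t = rhs t (F gam t) (G gam t)).
    { intros t Ht. unfold k, trunc_rhs, rhs. rewrite trunc_pow_eq; auto. }
    exists (F gam), (G gam). split.
    + intros t Ht. rewrite <- Hrhs by exact Ht.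
      split; [now apply Hsol|split; [now apply Hsol|]].
      assert (Hf : 0 <= F gam t).
      { rewrite <- (HF0 gam). apply (nondecreasing_of_derive (F gam) (G gam)); [| |lra].
        - intros x Hx. apply Hsol. lra.
        - intros x Hx. apply Rlt_le, Hg. lra. }
      split; [exact Hf|split; [now apply Hg|split; [now apply Hk|split]]].
      * intros HtS. apply (Hleft gam Hpos t). lra.
      * intros HtS. unfold drift. rewrite <- (trunc_deriv_le q M); [apply HY; lra|split; auto].
    + apply Rnot_lt_le. intros H.
      destruct (Hleft gam Hpos (- S) ltac:(lra)) as [L1 [L2 [L3 _]]].
      destruct (Hsmall M (F gam) (G gam)) as [t [Ht1 Ht2]]; try lra.
      * intros t Ht. apply Hsol. lra.
      * specialize (Hk t ltac:(lra)). unfold k in Hk. lra.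
Qed.

(** * Bounds uniform in [n] and the entire profile *)

Lemma le_of_drift_le (y c : R) : 0 < y -> 0 < c ->
  q * Rpower y (q - 1) <= c -> y <= Rpower (c / q) (1 / (q - 1)).
Proof.
  intros Hy Hc H. apply Rnot_lt_le. intros Hlt.
  assert (Rpower (Rpower (c / q) (1 / (q - 1))) (q - 1) < Rpower y (q - 1)).
  { apply Rlt_Rpower_l; [lra|]. split; [apply Rpower_pos|exact Hlt]. }
  rewrite Rpower_Rinv_cancel in H0; [|apply Rdiv_lt_0_compat; lra|lra].
  apply Rmult_lt_compat_l with (r := q) in H0; [|lra].
  replace (q * (c / q)) with c in H0 by (field; lra). lra.
Qed.

Lemma drift_le_of_le (y c : R) : 0 < y -> 0 < c ->
  y <= Rpower (c / q) (1 / (q - 1)) -> q * Rpower y (q - 1) <= c.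
Proof.
  intros Hy Hc H.
  assert (Rpower y (q - 1) <= Rpower (Rpower (c / q) (1 / (q - 1))) (q - 1)).
  { apply Rle_Rpower_l; lra. }
  rewrite Rpower_Rinv_cancel in H0; [|apply Rdiv_lt_0_compat; lra|lra].
  apply Rmult_le_compat_l with (r := q) in H0; [|lra].
  replace (q * (c / q)) with c in H0 by (field; lra). exact H0.
Qed.

Lemma admissible_mono (gam0 n s r : R) (f g : R -> R) :
  admissible gam0 n f g -> - n <= s <= r -> r <= n -> g s <= g r.
Proof.
  intros [H _] Hs Hr. apply (nondecreasing_of_derive g (fun t => rhs t (f t) (g t))); [| |lra];
    intros x Hx; apply H; lra.
Qed.

(** Gronwall backwards from [-S], where [g >= gam0]: on [[t, -S]] one has [k <= C g] with [C]
    independent of [n]. This is what makes the limit of [g] positive at every time to the left. *)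
Lemma admissible_lower (gam0 n t : R) (f g : R -> R) :
  admissible gam0 n f g -> S <= n -> - n <= t <= - S ->
  gam0 * exp (- ((K - t + 2 * Rabs a) * (- S - t))) <= g t.
Proof.
  intros [H Hg0] HSn Ht. set (C := K - t + 2 * Rabs a).
  pose proof (fun s r => admissible_mono gam0 n s r f g (conj H Hg0)) as Hmon.
  assert (E : g (- S) * exp (- (C * - S)) <= g t * exp (- (C * t))).
  { apply (nonincreasing_of_derive (fun t => g t * exp (- (C * t)))
             (fun t => (rhs t (f t) (g t) - C * g t) * exp (- (C * t)))); [| |lra].
    - intros x Hx. destruct (H x ltac:(lra)) as [_ [Dg _]].
      derive_ctx. ring.
    - intros x Hx. destruct (H x ltac:(lra)) as [_ [_ [Hf [Hg [_ [Hfg _]]]]]].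
      specialize (Hfg ltac:(lra)). pose proof (exp_pos (- (C * x))).
      enough (rhs x (f x) (g x) <= C * g x) by nra.
      unfold rhs. rewrite (Rpower_pred (g x) q) by exact Hg.
      destruct (H (- S) ltac:(lra)) as [_ [_ [_ [Hg' [_ [_ HY]]]]]].
      specialize (HY ltac:(lra)). unfold drift in HY.
      assert (Rpower (g x) (q - 1) <= Rpower (g (- S)) (q - 1)).
      { apply Rle_Rpower_l; [lra|]. split; [exact Hg|]. apply Hmon; lra. }
      pose proof (Rpower_pos (g (- S)) (q - 1)).
      assert (1 * Rpower (g (- S)) (q - 1) <= q * Rpower (g (- S)) (q - 1)) by (apply Rmult_le_compat_r; lra).
      assert (- a * f x <= Rabs a * f x).
      { apply Rmult_le_compat_r; [exact Hf|]. rewrite <- Rabs_Ropp. apply Rle_abs. }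
      assert (f x <= 4 * g x) by (assert (1 * f x <= - x * f x) by (apply Rmult_le_compat_r; lra); lra).
      pose proof (Rabs_pos a).
      assert (Rabs a * f x <= Rabs a * (4 * g x)) by (apply Rmult_le_compat_l; lra).
      assert (g x * Rpower (g x) (q - 1) <= g x * (K - S)) by (apply Rmult_le_compat_l; lra).
      assert (- x * g x <= - t * g x) by (apply Rmult_le_compat_r; lra).
      assert (0 <= - x * g x) by (apply Rmult_le_pos; lra).
      unfold C. nra. }
  apply Rmult_le_compat_r with (r := exp (C * t)) in E; [|apply Rlt_le, exp_pos].
  rewrite !Rmult_assoc, <- !exp_plus in E.
  replace (- (C * t) + C * t) with 0 in E by ring. rewrite exp_0, Rmult_1_r in E.
  replace (- (C * (- S - t))) with (- (C * - S) + C * t) by ring.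
  eapply Rle_trans; [|exact E]. apply Rmult_le_compat_r; [apply Rlt_le, exp_pos|exact Hg0].
Qed.

(** The bound on the drift at time [L] and the monotonicity of [g] give a truncation level depending
    on [L] alone. So the solutions for all [n >= L] obey one and the same Lipschitz equation on
    [[-L, L]]. *)
Lemma admissible_is_sol (gam0 n L : R) (f g : R -> R) :
  admissible gam0 n f g -> 0 < L <= n ->
  is_sol (Rpower ((L + K) / q) (1 / (q - 1))) (- L) L f g /\
  forall t, - L <= t <= L -> g t <= Rpower ((L + K) / q) (1 / (q - 1)).
Proof.
  intros [H Hg0] HL.
  pose proof (fun s r => admissible_mono gam0 n s r f g (conj H Hg0)) as Hmon.
  assert (HM : forall t, - L <= t <= L -> g t <= Rpower ((L + K) / q) (1 / (q - 1))).
  { intros t Ht. apply Rle_trans with (g L); [apply Hmon; lra|].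
    destruct (H L ltac:(lra)) as [_ [_ [_ [Hg [_ [_ HY]]]]]].
    apply le_of_drift_le; [exact Hg|lra|]. apply HY. lra. }
  split; [|exact HM].
  intros t Ht. destruct (H t ltac:(lra)) as [Df [Dg [_ [Hg _]]]]. split; [exact Df|].
  unfold trunc_rhs. rewrite trunc_pow_eq; [exact Dg|exact Hq|]. split; [exact Hg|now apply HM].
Qed.

Lemma global_profile :
  exists f g : R -> R, forall t,
     is_derive f t (g t) /\ is_derive g t (rhs t (f t) (g t)) /\
     0 <= f t /\ 0 < g t /\ 0 <= rhs t (f t) (g t) /\
     (t <= - S -> - t * f t <= 4 * g t) /\ (- S <= t -> drift g t <= t + K).
Proof.
  destruct small_data_turns as [gam0 [T [Hgam0 [HT Hsmall]]]].
  pose (n := fun i : nat => S + T + 1 + INR i).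
  assert (Hn : forall i, S < n i /\ T <= n i) by (intros i; pose proof (pos_INR i); unfold n; lra).
  destruct (fun_choice _ _ (fun i (fg : (R -> R) * (R -> R)) => admissible gam0 (n i) (fst fg) (snd fg))) as [fg Hfg].
  { intros i. destruct (shooting_level gam0 T (n i)) as [f [g H]]; try apply Hn; auto.
    exists (f, g). exact H. }
  pose (f := fun i => fst (fg i)). pose (g := fun i => snd (fg i)).
  assert (Hadm : forall i, admissible gam0 (n i) (f i) (g i)) by exact Hfg.
  clearbody f g. clear fg Hfg.
  set (Gam := Rpower ((- S + K) / q) (1 / (q - 1))).
  assert (HgS : forall i, gam0 <= g i (- S) <= Gam).
  { intros i. destruct (Hadm i) as [H H0]. split; [exact H0|]. destruct (Hn i).
    destruct (H (- S) ltac:(lra)) as [_ [_ [_ [Hg [_ [_ HY]]]]]].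
    apply le_of_drift_le; [exact Hg|lra|apply HY; lra]. }
  assert (HfS : forall i, 0 <= f i (- S) <= 4 * Gam).
  { intros i. destruct (Hadm i) as [H H0]. destruct (Hn i).
    destruct (H (- S) ltac:(lra)) as [_ [_ [Hf [_ [_ [Hfg _]]]]]]. specialize (Hfg ltac:(lra)).
    specialize (HgS i). split; [exact Hf|]. rewrite Ropp_involutive in Hfg.
    assert (1 * f i (- S) <= S * f i (- S)) by (apply Rmult_le_compat_r; lra). lra. }
  (* Compactness is used only for the two numbers [g (-S)] and [f (-S)]; continuous dependence
     carries the convergence to all other times. *)
  destruct (bounded_subsequence (fun i => g i (- S)) gam0 Gam HgS) as [phi1 [y0 [Hphi1 Hy0]]].
  destruct (bounded_subsequence (fun i => f (phi1 i) (- S)) 0 (4 * Gam) (fun i => HfS (phi1 i)))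
    as [phi2 [x0 [Hphi2 Hx0]]].
  pose (psi := fun i => phi1 (phi2 i)).
  assert (Hpsi : forall i, (i <= psi i)%nat).
  { intros i. unfold psi. specialize (Hphi1 (phi2 i)). specialize (Hphi2 i). lia. }
  pose (d := fun i => Rabs (f (psi i) (- S) - x0) + Rabs (g (psi i) (- S) - y0)).
  assert (Hd : Un_cv d 0).
  { intros eps He. destruct (Hx0 (eps / 2) ltac:(lra)) as [N1 HN1].
    destruct (Hy0 (eps / 2) ltac:(lra)) as [N2 HN2]. exists (max N1 N2). intros i Hi.
    specialize (HN1 i ltac:(lia)). specialize (HN2 (phi2 i) ltac:(specialize (Hphi2 i); lia)).
    unfold Rdist in *. unfold d. rewrite Rminus_0_r, Rabs_right; [unfold psi; lra|].
    pose proof (Rabs_pos (f (psi i) (- S) - x0)). pose proof (Rabs_pos (g (psi i) (- S) - y0)). lra. }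
  assert (Hlarge : forall L, exists N, forall i, (N <= i)%nat -> L <= n (psi i)).
  { intros L. destruct (INR_unbounded L) as [N HN]. exists N. intros i Hi.
    specialize (Hpsi i). assert (INR N <= INR (psi i)) by (apply le_INR; lia). unfold n. lra. }
  assert (Hloc : forall L, S < L -> exists X Y, is_sol (Rpower ((L + K) / q) (1 / (q - 1))) (- L) L X Y /\
     forall t, - L <= t <= L -> Un_cv (fun i => f (psi i) t) (X t) /\ Un_cv (fun i => g (psi i) t) (Y t)).
  { intros L HL. set (M := Rpower ((L + K) / q) (1 / (q - 1))).
    assert (HM : 0 < M) by apply Rpower_pos.
    destruct (trunc_solution M L (- S) x0 y0 HM ltac:(lra)) as [X [Y [HX [HY Hsol]]]].
    exists X, Y. split; [exact Hsol|]. intros t Ht.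
    destruct (Hlarge L) as [N HN].
    assert (HD : forall i, (N <= i)%nat ->
       Rabs (f (psi i) t - X t) <= exp ((3 * rhs_lip M L + 1) * L) * d i /\
       Rabs (g (psi i) t - Y t) <= exp ((3 * rhs_lip M L + 1) * L) * d i).
    { intros i Hi. specialize (HN i Hi).
      destruct (admissible_is_sol gam0 (n (psi i)) L _ _ (Hadm (psi i)) ltac:(lra)) as [Hs _]. fold M in Hs.
      apply (trunc_dependence M L _ _ X Y (- S)); auto; try lra.
      - apply Rplus_le_le_0_compat; apply Rabs_pos.
      - rewrite HX, HY. unfold d.
        rewrite <- (pow2_abs (f (psi i) (- S) - x0)), <- (pow2_abs (g (psi i) (- S) - y0)).
        pose proof (Rabs_pos (f (psi i) (- S) - x0)). pose proof (Rabs_pos (g (psi i) (- S) - y0)). nra. }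
    split; apply (Un_cv_squeeze _ d _ (exp ((3 * rhs_lip M L + 1) * L)) N (exp_pos _) Hd);
      intros i Hi; now apply HD. }
  assert (Hlim : forall t, exists xy : R * R,
     Un_cv (fun i => f (psi i) t) (fst xy) /\ Un_cv (fun i => g (psi i) t) (snd xy)).
  { intros t. pose proof (Rle_abs t) as A1. pose proof (Rle_abs (- t)) as A2. rewrite Rabs_Ropp in A2.
    destruct (Hloc (S + 1 + Rabs t)) as [X [Y [_ H]]]; [pose proof (Rabs_pos t); lra|].
    exists (X t, Y t). apply H. lra. }
  destruct (fun_choice _ _ _ Hlim) as [xy Hxy].
  pose (F := fun t => fst (xy t)). pose (G := fun t => snd (xy t)).
  assert (HF : forall t, Un_cv (fun i => f (psi i) t) (F t)) by (intros t; apply Hxy).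
  assert (HG : forall t, Un_cv (fun i => g (psi i) t) (G t)) by (intros t; apply Hxy).
  clearbody F G. clear xy Hxy Hlim.
  exists F, G. intros t.
  set (L := S + 2 + Rabs t).
  pose proof (Rabs_pos t). pose proof (Rle_abs t) as A1. pose proof (Rle_abs (- t)) as A2.
  rewrite Rabs_Ropp in A2.
  assert (HL : S < L) by (unfold L; lra).
  assert (HtL : - L < t < L) by (unfold L; lra).
  destruct (Hloc L HL) as [X [Y [Hsol HXY]]]. set (M := Rpower ((L + K) / q) (1 / (q - 1))) in *.
  (* Limits are unique, so [F] and [G] agree near [t] with the local solution [X], [Y] and inherit
     its derivatives. *)
  assert (EX : forall s, - L <= s <= L -> F s = X s /\ G s = Y s).
  { intros s Hs. destruct (HXY s Hs) as [H1 H2]. split; eapply UL_sequence; eauto. }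
  assert (Nb : locally t (fun s => - L <= s <= L)).
  { apply (filter_imp (fun s => - L < s /\ s < L)); [intros s Hs; lra|].
    apply filter_and; [apply locally_gt|apply locally_lt]; lra. }
  assert (Df : is_derive F t (G t)).
  { rewrite (proj2 (EX t ltac:(lra))). apply is_derive_ext_loc with X; [|apply Hsol; lra].
    apply filter_imp with (2 := Nb). intros s Hs. symmetry. now apply EX. }
  assert (Dg : is_derive G t (trunc_rhs M t (F t) (G t))).
  { rewrite (proj1 (EX t ltac:(lra))), (proj2 (EX t ltac:(lra))).
    apply is_derive_ext_loc with Y; [|apply Hsol; lra].
    apply filter_imp with (2 := Nb). intros s Hs. symmetry. now apply EX. }
  destruct (Hlarge L) as [N HN].
  assert (Hi : forall i, (N <= i)%nat -> - n (psi i) <= t <= n (psi i)) by (intros i Hi; specialize (HN i Hi); lra).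
  assert (Fpos : 0 <= F t).
  { apply (Un_cv_ge _ _ _ N (HF t)). intros i Hii. destruct (Hadm (psi i)) as [H1 _].
    apply (H1 t). auto. }
  (* A strict inequality does not pass to the limit; it comes from the lower bounds independent of
     [n]. *)
  assert (Gpos : 0 < G t).
  { destruct (Rle_dec t (- S)) as [HtS|HtS].
    - apply Rlt_le_trans with (gam0 * exp (- ((K - t + 2 * Rabs a) * (- S - t)))).
      + apply Rmult_lt_0_compat; [exact Hgam0|apply exp_pos].
      + apply (Un_cv_ge _ _ _ N (HG t)). intros i Hii.
        apply (admissible_lower gam0 (n (psi i)) t (f (psi i))); auto.
        * destruct (Hn (psi i)). lra.
        * specialize (Hi i Hii). lra.
    - apply Rlt_le_trans with gam0; [exact Hgam0|].
      apply (Un_cv_ge _ _ _ N (HG t)). intros i Hii. destruct (Hadm (psi i)) as [H1 H2].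
      eapply Rle_trans; [exact H2|]. specialize (Hi i Hii). destruct (Hn (psi i)).
      apply (admissible_mono gam0 (n (psi i)) _ _ (f (psi i))); auto; lra. }
  assert (GM : G t <= M).
  { enough (- M <= - G t) by lra. apply (Un_cv_ge _ _ _ N (CV_opp _ _ (HG t))).
    intros i Hii. apply Ropp_le_contravar. specialize (HN i Hii).
    apply (admissible_is_sol gam0 (n (psi i)) L (f (psi i)) (g (psi i))); auto; lra. }
  assert (Erhs : trunc_rhs M t (F t) (G t) = rhs t (F t) (G t)).
  { unfold trunc_rhs, rhs. rewrite trunc_pow_eq; auto. }
  split; [exact Df|]. split; [rewrite <- Erhs; exact Dg|].
  split; [exact Fpos|]. split; [exact Gpos|]. split; [|split].
  - rewrite <- Erhs.
    apply (Un_cv_ge (fun i => trunc_rhs M t (f (psi i) t) (g (psi i) t)) _ _ N).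
    + unfold trunc_rhs. apply CV_minus; [apply CV_minus|].
      * apply (continuity_seq (trunc_pow q M)); [|apply HG].
        eapply is_derive_continuity_pt. now apply is_derive_trunc_pow.
      * apply CV_mult; [apply Un_cv_const|apply HG].
      * apply CV_mult; [apply Un_cv_const|apply HF].
    + intros i Hii. destruct (Hadm (psi i)) as [H1 _]. specialize (HN i Hii).
      destruct (H1 t ltac:(lra)) as [_ [_ [_ [Hg [Hk _]]]]].
      unfold trunc_rhs. rewrite trunc_pow_eq; auto. split; [exact Hg|].
      apply (admissible_is_sol gam0 (n (psi i)) L (f (psi i)) (g (psi i))); auto; lra.
  - intros HtS. enough (0 <= 4 * G t - - t * F t) by lra.
    apply (Un_cv_ge (fun i => 4 * g (psi i) t - - t * f (psi i) t) _ _ N).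
    + apply CV_minus; apply CV_mult; auto using Un_cv_const.
    + intros i Hii. destruct (Hadm (psi i)) as [H1 _].
      destruct (H1 t (Hi i Hii)) as [_ [_ [_ [_ [_ [Hfg _]]]]]]. specialize (Hfg HtS). lra.
  (* Solved for [g], the bound on the drift becomes a closed inequality that passes to the limit
     directly. *)
  - intros HtS. apply drift_le_of_le; [exact Gpos|lra|].
    enough (- Rpower ((t + K) / q) (1 / (q - 1)) <= - G t) by lra.
    apply (Un_cv_ge _ _ _ N (CV_opp _ _ (HG t))).
    intros i Hii. apply Ropp_le_contravar. destruct (Hadm (psi i)) as [H1 _].
    destruct (H1 t (Hi i Hii)) as [_ [_ [_ [Hg [_ [_ HY]]]]]].
    apply le_of_drift_le; [exact Hg|lra|now apply HY].
Qed.

End Shooting.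

(** * Asymptotics of the profile *)

Section Profile.

Context (q a S K : R).
Context (Hq : 1 < q) (Ha : (a + 1) * (q - 1) = 1).
Context (HS1 : 1 <= S) (HS2 : 8 * Rabs a <= S) (HK1 : S + 1 <= K).
Context (f g : R -> R).
Context (Hfg : forall t,
     is_derive f t (g t) /\ is_derive g t (rhs q a t (f t) (g t)) /\
     0 <= f t /\ 0 < g t /\ 0 <= rhs q a t (f t) (g t) /\
     (t <= - S -> - t * f t <= 4 * g t) /\ (- S <= t -> drift q g t <= t + K)).

Definition curv (t : R) : R := rhs q a t (f t) (g t).

Lemma a_gt_m1 : 0 < a + 1.
Proof. destruct (Rlt_dec 0 (a + 1)); [assumption|exfalso]. nra. Qed.

Lemma is_derive_f (t : R) : is_derive f t (g t). Proof. apply Hfg. Qed.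
Lemma is_derive_g (t : R) : is_derive g t (curv t). Proof. apply Hfg. Qed.
Lemma g_pos (t : R) : 0 < g t. Proof. apply Hfg. Qed.
Lemma curv_nonneg (t : R) : 0 <= curv t. Proof. apply Hfg. Qed.

Lemma f_incr (s t : R) : s < t -> f s < f t.
Proof.
  intros H. apply (increasing_of_derive f g); [| |exact H]; intros x _; [apply is_derive_f|apply g_pos].
Qed.

Lemma f_pos (t : R) : 0 < f t.
Proof.
  apply Rle_lt_trans with (f (t - 1)); [apply Hfg|apply f_incr; lra].
Qed.

Lemma g_incr (s t : R) : s <= t -> g s <= g t.
Proof.
  intros H. apply (nondecreasing_of_derive g curv); [| |exact H]; intros x _;
    [apply is_derive_g|apply curv_nonneg].
Qed.

Lemma is_derive_curv (t : R) :
  is_derive curv t ((drift q g t - t / 2) * curv t - (a + 1) / 2 * g t).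
Proof.
  assert (DN : is_derive (fun t => Rpower (g t) q) t (curv t * (q * Rpower (g t) (q - 1)))).
  { apply (is_derive_comp (fun u => Rpower u q) g); [apply is_derive_Rpower, g_pos|apply is_derive_g]. }
  pose proof (is_derive_f t) as Df. pose proof (is_derive_g t) as Dg.
  apply (is_derive_eq _ _ (curv t * (q * Rpower (g t) (q - 1))
            - (1 / 2 * g t + t / 2 * curv t) - a / 2 * g t)); [|unfold drift; lra].
  apply (is_derive_minus (fun t => Rpower (g t) q - t / 2 * g t) (fun t => a / 2 * f t)).
  - apply (is_derive_minus (fun t => Rpower (g t) q) (fun t => t / 2 * g t)); [exact DN|].
    derive_ctx. lra.
  - derive_ctx. lra.
Qed.

(** * Behaviour at plus infinity *)

(** [k >= 0] means [g^q >= t/2 g + a/2 f]. For negative [a], the bound [f t <= f 0 + t g t] from the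
    monotonicity of [g] leaves [(1 + a) t] in front of [g], still positive; hence [m]. *)
Lemma drift_unbounded (r : R) : exists H, 1 <= H /\ forall t, H <= t -> r <= drift q g t.
Proof.
  pose proof a_gt_m1 as Ha1. pose proof (g_pos 0) as Hg0.
  set (m := Rmin 1 (1 + a)).
  assert (Hm : 0 < m) by (apply Rmin_glb_lt; lra).
  set (c := Rabs a * (f 0 / g 0)).
  assert (Hc : 0 <= c).
  { apply Rmult_le_pos; [apply Rabs_pos|]. apply Rdiv_le_0_compat; [apply Hfg|exact Hg0]. }
  exists (1 + (2 * Rabs r + c) / m).
  assert (Hr0 : 0 <= (2 * Rabs r + c) / m) by (apply Rdiv_le_0_compat; [pose proof (Rabs_pos r); lra|exact Hm]).
  split; [lra|]. intros t Ht.
  pose proof (g_pos t) as Hg. pose proof (curv_nonneg t) as Hk. unfold curv, rhs in Hk.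
  rewrite (Rpower_pred (g t) q) in Hk by exact Hg.
  set (G := Rpower (g t) (q - 1)) in *.
  assert (Hf1 : f t <= f 0 + t * g t).
  { enough (f t - t * g t <= f 0 - 0 * g t) by lra.
    apply (nonincreasing_of_derive (fun s => f s - s * g t) (fun s => g s - g t)); [| |lra].
    - intros x Hx. pose proof (is_derive_f x) as Df. derive_ctx. ring.
    - intros x Hx. pose proof (g_incr x t ltac:(lra)). lra. }
  assert (Hf2 : f 0 <= f 0 / g 0 * g t).
  { replace (f 0) with (f 0 / g 0 * g 0) at 1 by (field; lra).
    apply Rmult_le_compat_l; [apply Rdiv_le_0_compat; [apply Hfg|exact Hg0]|]. apply g_incr. lra. }
  assert (Hlow : (m * t - c) * g t <= t * g t + a * f t).
  { destruct (Rle_dec 0 a) as [Hpos|Hneg].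
    - assert (0 <= a * f t) by (apply Rmult_le_pos; [lra|apply Hfg]).
      assert (m * t <= 1 * t) by (apply Rmult_le_compat_r; [lra|apply Rmin_l]). nra.
    - assert (Em : m = 1 + a) by (apply Rmin_right; lra).
      assert (Rabs a = - a) by (apply Rabs_left; lra).
      assert (- a * f t <= - a * (f 0 / g 0 * g t + t * g t)) by (apply Rmult_le_compat_l; lra).
      unfold c. rewrite Em, H. nra. }
  assert (HG : m * t - c <= 2 * G).
  { apply Rmult_le_reg_r with (g t); [exact Hg|]. lra. }
  assert (Ht2 : 2 * Rabs r + c <= m * t).
  { apply Rle_trans with (m * ((2 * Rabs r + c) / m)); [right; field; lra|].
    apply Rmult_le_compat_l; lra. }
  unfold drift. fold G. pose proof (Rle_abs r). pose proof (Rabs_pos r). nra.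
Qed.

(* With [w] the slope of [drift], its derivative is
   [w (drift - t/2) - drift/2 + (q-2)/(q-1) w^2/drift], negative when [w <= 1] and [drift < t - 2]. *)
Lemma drift_lower : exists c H, 1 <= H /\ forall t, H <= t -> t - c <= drift q g t.
Proof.
  set (m := Rabs (q - 2) / (q - 1)).
  assert (Hm : 0 <= m) by (apply Rdiv_le_0_compat; [apply Rabs_pos|lra]).
  (* The threshold [2 + 2m] makes the quadratic term [m w^2 / Y] at most 1/2 when [w <= 1]. *)
  destruct (drift_unbounded (2 + 2 * m)) as [H [HH HY]].
  pose (w := fun t => (q - 1) * (curv t / g t) * drift q g t).
  pose (dw := fun t => (q - 1) * drift q g t *
     ((drift q g t - t / 2) * (curv t / g t) - (a + 1) / 2 + (q - 2) * (curv t / g t) ^ 2)).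
  assert (Dw : forall t, is_derive w t (dw t)).
  { intros t. apply is_derive_slope; [apply g_pos|apply is_derive_g|apply is_derive_curv]. }
  assert (DD : forall t, is_derive (fun t => drift q g t - t) t (w t - 1)).
  { intros t. apply (is_derive_minus (drift q g) (fun t => t)); [|apply (@is_derive_id R_AbsRing)].
    apply is_derive_drift; [apply g_pos|apply is_derive_g]. }
  assert (Hw : forall t, 0 <= w t).
  { intros t. unfold w. pose proof (drift_pos q Hq g t).
    apply Rmult_le_pos; [apply Rmult_le_pos|lra]; [lra|].
    apply Rdiv_le_0_compat; [apply curv_nonneg|apply g_pos]. }
  assert (Hdw : forall t, H <= t -> drift q g t - t < - 2 -> w t <= 1 -> dw t <= - (1 / 2)).
  { intros t Ht HD Hw1. specialize (HY t Ht). specialize (Hw t).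
    assert (E : dw t = w t * (drift q g t - t / 2) - drift q g t / 2
               + (q - 2) / (q - 1) * (w t * w t / drift q g t)).
    { unfold dw, w. pose proof (g_pos t). replace (a + 1) with (1 / (q - 1))
        by (apply Rmult_eq_reg_r with (q - 1); [rewrite Ha; field; lra|lra]).
      field. repeat split; lra. }
    rewrite E. set (Y := drift q g t) in *.
    assert (W : 0 <= w t * w t / Y <= 1 / (2 + 2 * m)).
    { split; [apply Rdiv_le_0_compat; [apply Rmult_le_pos|]; lra|].
      apply Rmult_le_compat; [apply Rmult_le_pos; lra| |nra|apply Rinv_le_contravar; lra].
      apply Rlt_le, Rinv_0_lt_compat. lra. }
    pose proof (Rmult_Rabs_bounds ((q - 2) / (q - 1)) _ _ W) as [_ HB].
    assert (Em : Rabs ((q - 2) / (q - 1)) = m).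
    { unfold m, Rdiv. rewrite Rabs_mult, (Rabs_right (/ (q - 1))); [reflexivity|].
      apply Rle_ge, Rlt_le, Rinv_0_lt_compat. lra. }
    rewrite Em in HB.
    assert (m * (1 / (2 + 2 * m)) <= 1 / 2).
    { apply Rmult_le_reg_r with (2 + 2 * m); [lra|].
      replace (m * (1 / (2 + 2 * m)) * (2 + 2 * m)) with m by (field; lra). lra. }
    destruct (Rle_dec (t / 2) Y) as [Hc|Hc].
    - assert (w t * (Y - t / 2) <= 1 * (Y - t / 2)) by (apply Rmult_le_compat_r; lra). lra.
    - assert (0 <= w t * (t / 2 - Y)) by (apply Rmult_le_pos; lra). lra. }
  assert (Hnot : forall t, H <= t -> drift q g t - t < - 2 -> 0 <= w t - 1).
  { intros t1 Ht1 HD. apply Rnot_lt_le. intros Hlt.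
    (* If [w < 1] at [t1], it stays below 1 and loses at least 1/2 per unit of time; after three
       units it would be negative, against [w >= 0]. *)
    assert (Hb : forall t, t1 <= t <= t1 + 3 -> 0 < 1 - w t).
    { apply (positive_barrier (fun t => 1 - w t) (fun t => 0 - dw t)).
      - intros x _. apply (is_derive_minus (fun _ => 1) w); [apply (is_derive_const 1)|apply Dw].
      - lra.
      - intros x Hx Hz Hbf.
        assert (drift q g x - x <= drift q g t1 - t1).
        { apply (nonincreasing_of_derive _ _ t1 x (fun s _ => DD s)); [|lra].
          intros s Hs. specialize (Hbf s ltac:(lra)). lra. }
        specialize (Hdw x ltac:(lra) ltac:(lra) ltac:(lra)). lra. }
    assert (HDx : forall x, t1 <= x <= t1 + 3 -> drift q g x - x <= drift q g t1 - t1).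
    { intros x Hx. apply (nonincreasing_of_derive _ _ t1 x (fun s _ => DD s)); [|lra].
      intros s Hs. specialize (Hb s ltac:(lra)). lra. }
    assert (w (t1 + 3) + 1 / 2 * (t1 + 3) <= w t1 + 1 / 2 * t1).
    { apply (nonincreasing_of_derive (fun t => w t + 1 / 2 * t) (fun t => dw t + 1 / 2)); [| |lra].
      - intros x _. apply (is_derive_plus w (fun t => 1 / 2 * t)); [apply Dw|].
        auto_derive; [exact I|ring].
      - intros x Hx. specialize (HDx x ltac:(lra)). specialize (Hb x ltac:(lra)).
        specialize (Hdw x ltac:(lra) ltac:(lra) ltac:(lra)). lra. }
    specialize (Hw (t1 + 3)). lra. }
  exists (- Rmin (- 2) (drift q g H - H)), H. split; [exact HH|]. intros t Ht.
  enough (Rmin (- 2) (drift q g H - H) <= drift q g t - t) by lra.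
  apply (lower_bound_of_derive (fun t => drift q g t - t) (fun t => w t - 1) H t); [exact Ht| | |].
  - intros x _. apply DD.
  - apply Rmin_r.
  - intros x Hx HD. apply Hnot; [lra|]. eapply Rlt_le_trans; [exact HD|apply Rmin_l].
Qed.

Lemma g_of_drift (t : R) : g t = Rpower (drift q g t / q) (1 / (q - 1)).
Proof.
  pose proof (g_pos t). unfold drift.
  replace (q * Rpower (g t) (q - 1) / q) with (Rpower (g t) (q - 1)) by (field; lra).
  rewrite Rpower_mult. replace ((q - 1) * (1 / (q - 1))) with 1 by (field; lra).
  symmetry. now apply Rpower_1.
Qed.

(** The bounded difference [Y - t] is absorbed by [e t] for large [t], and [Y] is inverted for
    [g]. *)
Lemma g_growth (e : R) : 0 < e < 1 -> exists H, 1 <= H /\ forall t, H <= t ->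
  Rpower ((1 - e) / q) (1 / (q - 1)) * Rpower t (1 / (q - 1)) <= g t
    <= Rpower ((1 + e) / q) (1 / (q - 1)) * Rpower t (1 / (q - 1)).
Proof.
  intros He. destruct drift_lower as [c [H0 [HH0 Hlow]]].
  assert (Hb : 0 <= 1 / (q - 1)) by (apply Rlt_le, Rdiv_lt_0_compat; lra).
  exists (H0 + (Rabs c + K) / e).
  assert (HcK : 0 <= (Rabs c + K) / e) by (apply Rdiv_le_0_compat; [pose proof (Rabs_pos c)|]; lra).
  split; [lra|]. intros t Ht.
  specialize (Hlow t ltac:(lra)).
  assert (Hup : drift q g t <= t + K) by (apply Hfg; lra).
  assert (Hte : Rabs c + K <= e * t).
  { apply Rle_trans with (e * ((Rabs c + K) / e)); [right; field; lra|].
    apply Rmult_le_compat_l; lra. }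
  pose proof (Rle_abs c). pose proof (Rabs_pos c).
  assert (Hq0 : 0 < / q) by (apply Rinv_0_lt_compat; lra).
  rewrite g_of_drift, !Rpower_mult_distr; try (apply Rdiv_lt_0_compat; lra); try lra.
  split; apply Rle_Rpower_l; try exact Hb; split.
  - apply Rmult_lt_0_compat; [apply Rdiv_lt_0_compat; lra|lra].
  - replace ((1 - e) / q * t) with ((1 - e) * t * / q) by (field; lra).
    apply Rmult_le_compat_r; lra.
  - apply Rdiv_lt_0_compat; [apply drift_pos; exact Hq|lra].
  - replace ((1 + e) / q * t) with ((1 + e) * t * / q) by (field; lra).
    apply Rmult_le_compat_r; lra.
Qed.

(** The form [(1 + 0) / q] matches the perturbed constants [(1 + e) / q] used next, of which this is
    the case [e = 0]; the division by [q'] comes from integrating [t^(1/(q-1))]. *)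
Lemma cq_eq :
  Rpower (q / (q - 1)) (- (q / (q - 1))) * Rpower (1 / (q - 1)) (1 / (q - 1))
  = Rpower ((1 + 0) / q) (1 / (q - 1)) / (q / (q - 1)).
Proof.
  assert (Hqq : 0 < q / (q - 1)) by (apply Rdiv_lt_0_compat; lra).
  replace (Rpower ((1 + 0) / q) (1 / (q - 1)) / (q / (q - 1)))
    with (Rpower ((1 + 0) / q) (1 / (q - 1)) * Rpower (q / (q - 1)) (- (1))).
  - unfold Rpower. rewrite <- !exp_plus. f_equal.
    rewrite Rplus_0_r. unfold Rdiv. rewrite !Rmult_1_l.
    rewrite ln_mult, !ln_Rinv by (try apply Rinv_0_lt_compat; lra). field. lra.
  - rewrite Rpower_Ropp, Rpower_1 by exact Hqq. reflexivity.
Qed.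

Lemma is_derive_power_primitive (C t : R) : 0 < t ->
  is_derive (fun t => C / (q / (q - 1)) * Rpower t (q / (q - 1))) t (C * Rpower t (1 / (q - 1))).
Proof.
  intros Ht.
  apply (is_derive_eq _ _ (C / (q / (q - 1)) * (q / (q - 1) * Rpower t (q / (q - 1) - 1)))).
  - apply (is_derive_scal (fun t => Rpower t (q / (q - 1)))). now apply is_derive_Rpower.
  - replace (q / (q - 1) - 1) with (1 / (q - 1)) by (field; lra). field. lra.
Qed.

Lemma Rpower_tail (A eps : R) : 0 < eps -> exists M, 1 <= M /\ forall t, M < t ->
  Rabs (Rpower t (- (q / (q - 1))) * A) < eps.
Proof.
  intros He. exists (1 + Rabs A / eps).
  assert (0 <= Rabs A / eps) by (apply Rdiv_le_0_compat; [apply Rabs_pos|exact He]).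
  split; [lra|]. intros t Ht.
  rewrite Rabs_mult, (Rabs_right (Rpower _ _)) by (apply Rle_ge, Rlt_le, Rpower_pos).
  assert (Hle : Rpower t (- (q / (q - 1))) <= / t).
  { rewrite <- (Rpower_1 t) at 2 by lra. rewrite <- Rpower_Ropp.
    apply Rle_Rpower; [lra|]. apply Ropp_le_contravar. apply Rle_div_r; lra. }
  apply Rle_lt_trans with (/ t * Rabs A); [apply Rmult_le_compat_r; [apply Rabs_pos|exact Hle]|].
  apply Rmult_lt_reg_l with t; [lra|].
  replace (t * (/ t * Rabs A)) with (Rabs A) by (field; lra).
  apply Rmult_lt_reg_r with (/ eps); [now apply Rinv_0_lt_compat|].
  replace (t * eps * / eps) with t by (field; lra). unfold Rdiv in Ht. lra.
Qed.

Lemma profile_plus_infty (eps : R) : 0 < eps -> exists M, forall eta, M < eta ->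
  Rabs (Rpower eta (- (q / (q - 1))) * f eta
        - Rpower (q / (q - 1)) (- (q / (q - 1))) * Rpower (1 / (q - 1)) (1 / (q - 1))) < eps.
Proof.
  intros He. rewrite cq_eq. set (q' := q / (q - 1)).
  assert (Hq' : 0 < q') by (apply Rdiv_lt_0_compat; lra).
  pose (c := fun e => Rpower ((1 + e) / q) (1 / (q - 1)) / q'). fold (c 0).
  assert (Cc : continuity_pt c 0).
  { eapply is_derive_continuity_pt. unfold c.
    apply (is_derive_ext (fun e => / q' * Rpower ((1 + e) / q) (1 / (q - 1)))); [intros; apply Rmult_comm|].
    apply (is_derive_scal (fun e => Rpower ((1 + e) / q) (1 / (q - 1)))).
    apply (is_derive_comp (fun u => Rpower u (1 / (q - 1))) (fun e => (1 + e) / q)).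
    - apply is_derive_Rpower. apply Rdiv_lt_0_compat; lra.
    - auto_derive; [exact I|reflexivity]. }
  destruct (continuity_pt_eps c 0 (eps / 2) Cc ltac:(lra)) as [d [Hd Hcd]].
  set (e := Rmin (d / 2) (1 / 2)).
  assert (He0 : 0 < e) by (apply Rmin_glb_lt; lra).
  assert (He1 : e <= d / 2) by apply Rmin_l. assert (He2 : e <= 1 / 2) by apply Rmin_r.
  destruct (g_growth e ltac:(lra)) as [H [HH Hg]].
  pose proof (Hcd e ltac:(apply Rabs_def1; lra)) as C1. apply Rabs_def2 in C1.
  pose proof (Hcd (- e) ltac:(apply Rabs_def1; lra)) as C2. apply Rabs_def2 in C2.
  destruct (Rpower_tail (f H - c e * Rpower H q') (eps / 2) ltac:(lra)) as [M1 [_ T1]].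
  destruct (Rpower_tail (f H - c (- e) * Rpower H q') (eps / 2) ltac:(lra)) as [M2 [_ T2]].
  exists (Rmax H (Rmax M1 M2)). intros t Ht.
  assert (HtH : H < t) by (eapply Rle_lt_trans; [apply Rmax_l|exact Ht]).
  assert (HtM : Rmax M1 M2 < t) by (eapply Rle_lt_trans; [apply Rmax_r|exact Ht]).
  specialize (T1 t ltac:(eapply Rle_lt_trans; [apply Rmax_l|exact HtM])).
  specialize (T2 t ltac:(eapply Rle_lt_trans; [apply Rmax_r|exact HtM])).
  fold q' in T1, T2. apply Rabs_def2 in T1. apply Rabs_def2 in T2.
  (* The bounds on [g] are integrated from [H] on; the factor [t^(-q')] then makes the constants of
     integration negligible. *)
  assert (Up : f t - c e * Rpower t q' <= f H - c e * Rpower H q').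
  { apply (nonincreasing_of_derive (fun t => f t - c e * Rpower t q')
       (fun t => g t - Rpower ((1 + e) / q) (1 / (q - 1)) * Rpower t (1 / (q - 1)))); [| |lra].
    - intros x Hx. apply (is_derive_minus f (fun t => c e * Rpower t q')); [apply is_derive_f|].
      apply is_derive_power_primitive. lra.
    - intros x Hx. specialize (Hg x ltac:(lra)). lra. }
  assert (Lo : f H - c (- e) * Rpower H q' <= f t - c (- e) * Rpower t q').
  { apply (nondecreasing_of_derive (fun t => f t - c (- e) * Rpower t q')
       (fun t => g t - Rpower ((1 + - e) / q) (1 / (q - 1)) * Rpower t (1 / (q - 1)))); [| |lra].
    - intros x Hx. apply (is_derive_minus f (fun t => c (- e) * Rpower t q')); [apply is_derive_f|].
      apply is_derive_power_primitive. lra.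
    - intros x Hx. specialize (Hg x ltac:(lra)). change (1 + - e) with (1 - e). lra. }
  set (P := Rpower t (- q')) in *.
  assert (HP : 0 < P) by apply Rpower_pos.
  assert (PP : P * Rpower t q' = 1).
  { unfold P. rewrite <- Rpower_plus, Rplus_opp_l. apply Rpower_O. lra. }
  assert (Up2 : P * (f t - c e * Rpower t q') <= P * (f H - c e * Rpower H q')) by (apply Rmult_le_compat_l; lra).
  assert (Lo2 : P * (f H - c (- e) * Rpower H q') <= P * (f t - c (- e) * Rpower t q')) by (apply Rmult_le_compat_l; lra).
  replace (P * (f t - c e * Rpower t q')) with (P * f t - c e * (P * Rpower t q')) in Up2 by ring.
  replace (P * (f t - c (- e) * Rpower t q')) with (P * f t - c (- e) * (P * Rpower t q')) in Lo2 by ring.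
  rewrite PP in Up2, Lo2. apply Rabs_def1; lra.
Qed.

(** * Behaviour at minus infinity *)

Lemma ratio_bounds (t : R) : t <= - S -> 0 <= f t / g t /\ - t * (f t / g t) <= 4.
Proof.
  intros Ht. pose proof (g_pos t) as Hg. destruct (Hfg t) as [_ [_ [Hf [_ [_ [H _]]]]]].
  specialize (H Ht). split; [now apply Rdiv_le_0_compat|].
  replace (- t * (f t / g t)) with (- t * f t / g t) by (field; lra).
  apply (proj2 (Rle_div_l (- t * f t) 4 (g t) Hg)). exact H.
Qed.

Lemma curv_ratio (t : R) : curv t / g t = drift q g t / q - t / 2 - a / 2 * (f t / g t).
Proof.
  pose proof (g_pos t) as Hg. unfold curv, rhs, drift. rewrite (Rpower_pred (g t) q) by exact Hg.
  field. lra.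
Qed.

Lemma curv_ratio_lower (t : R) : t <= - S -> - t / 4 <= curv t / g t.
Proof.
  intros Ht. rewrite curv_ratio. destruct (ratio_bounds t Ht) as [R1 R2].
  pose proof (drift_pos q Hq g t).
  assert (0 <= drift q g t / q) by (apply Rdiv_le_0_compat; lra).
  assert (a * (f t / g t) <= Rabs a * (f t / g t)) by (apply Rmult_le_compat_r; [exact R1|apply Rle_abs]).
  assert (8 * Rabs a * (f t / g t) <= - t * (f t / g t)) by (apply Rmult_le_compat_r; lra).
  lra.
Qed.

(** [Y t^2] is nondecreasing: [Y'/Y = (q-1) k/g >= (q-1)(-t)/4] beats [2/(-t)] once
    [t^2 >= 8/(q-1)]. The true decay is Gaussian, but an integrable power is enough for what
    follows. *)
Lemma drift_decay : exists c S1, 0 <= c /\ S <= S1 /\ forall t, t <= - S1 -> drift q g t / q <= c / t ^ 2.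
Proof.
  set (S1 := S + 8 / (q - 1)).
  assert (H8 : 0 < 8 / (q - 1)) by (apply Rdiv_lt_0_compat; lra).
  exists (drift q g (- S1) / q * (- S1) ^ 2), S1.
  assert (HS : S <= S1) by (unfold S1; lra).
  split; [|split; [exact HS|]].
  - pose proof (drift_pos q Hq g (- S1)). apply Rmult_le_pos; [apply Rdiv_le_0_compat; lra|apply pow2_ge_0].
  - intros t Ht.
    assert (E : drift q g t / q * t ^ 2 <= drift q g (- S1) / q * (- S1) ^ 2).
    { apply (nondecreasing_of_derive (fun t => drift q g t / q * t ^ 2)
         (fun t => drift q g t / q * (- t) * ((q - 1) * (curv t / g t) * - t - 2))); [| |exact Ht].
      - intros x Hx. pose proof (is_derive_drift q g curv x (g_pos x) (is_derive_g x)) as DY.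
        derive_ctx. field. pose proof (g_pos x). split; lra.
      - intros x Hx. pose proof (drift_pos q Hq g x).
        pose proof (curv_ratio_lower x ltac:(lra)) as Hp.
        apply Rmult_le_pos; [apply Rmult_le_pos; [apply Rdiv_le_0_compat|]; lra|].
        assert (8 <= (q - 1) * (- x * - x)).
        { assert (8 / (q - 1) <= - x * - x)
            by (assert (8 / (q - 1) <= S1) by (unfold S1; lra); assert (- x <= - x * - x) by nra; lra).
          apply Rmult_le_compat_l with (r := q - 1) in H0; [|lra].
          replace ((q - 1) * (8 / (q - 1))) with 8 in H0 by (field; lra). exact H0. }
        assert ((q - 1) * (- x / 4) * - x <= (q - 1) * (curv x / g x) * - x).
        { apply Rmult_le_compat_r; [lra|]. apply Rmult_le_compat_l; lra. }
        lra. }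
    assert (0 < t ^ 2) by nra.
    apply (proj1 (Rle_div_r (drift q g t / q) _ (t ^ 2) H)). exact E.
Qed.

Lemma is_derive_ratio (t : R) :
  is_derive (fun t => f t / g t) t (1 - f t / g t * (curv t / g t)).
Proof.
  pose proof (is_derive_f t) as Df. pose proof (is_derive_g t) as Dg. pose proof (g_pos t).
  derive_ctx. field. lra.
Qed.

(* The ratio minus [2/(-t)], multiplied by the integrating factor [exp (-t^2/4)], vanishes at [-oo]
   and has derivative dominated by that of a multiple of [(-t)^(-3) exp (-t^2/4)]. *)
Lemma ratio_asymptotics : exists c S1, 0 <= c /\ S <= S1 /\ forall t, t <= - S1 ->
  drift q g t / q <= c / t ^ 2 /\ Rabs (f t / g t - 2 / - t) <= c / (- t) ^ 3.
Proof.
  destruct drift_decay as [c0 [S1 [Hc0 [HS HY]]]].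
  (* With [r = f/g] and [G = Y/q], the error [e = r - 2/(-t)] satisfies
     [e' - t/2 e = - r G + a/2 r^2 - 2/t^2]. By [0 <= r <= 4/(-t)] the three terms are at most
     [4 c0], [8|a|] and [2] times [1/t^2]. *)
  set (c := 2 * (4 * c0 + 8 * Rabs a + 2)).
  assert (Hc : 0 <= c) by (pose proof (Rabs_pos a); unfold c; lra).
  exists (c0 + c), S1. split; [lra|split; [exact HS|]]. intros t0 Ht0.
  assert (Hs : 1 <= - t0) by lra.
  split.
  { eapply Rle_trans; [now apply HY|]. apply Rmult_le_compat_r; [|lra].
    apply Rlt_le, Rinv_0_lt_compat. nra. }
  set (e := fun t => f t / g t - 2 / - t).
  assert (De : forall t, t <= - S1 -> is_derive e t (1 - f t / g t * (curv t / g t) - 2 / t ^ 2)).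
  { intros t Ht. apply (is_derive_minus (fun t => f t / g t) (fun t => 2 / - t)); [apply is_derive_ratio|].
    auto_derive; [lra|]. field. lra. }
  assert (Be : forall t, t <= - S1 ->
    Rabs (1 - f t / g t * (curv t / g t) - 2 / t ^ 2 - t / 2 * e t) <= c / 2 * (1 / t ^ 2)).
  { intros t Ht. destruct (ratio_bounds t ltac:(lra)) as [R1 R2]. specialize (HY t Ht).
    assert (Hst : 1 <= - t) by lra.
    assert (Ht2 : 0 < 1 / t ^ 2) by (apply Rdiv_lt_0_compat; [lra|nra]).
    pose proof (drift_pos q Hq g t) as HYp.
    assert (HG : 0 <= drift q g t / q) by (apply Rdiv_le_0_compat; lra).
    rewrite curv_ratio. unfold e. set (r := f t / g t) in *. set (G := drift q g t / q) in *.
    replace (1 - r * (G - t / 2 - a / 2 * r) - 2 / t ^ 2 - t / 2 * (r - 2 / - t))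
      with (- (r * G) + (a / 2 * (r * r) + - (2 * (1 / t ^ 2)))) by (field; lra).
    assert (Hr4 : r <= 4) by nra.
    assert (Hr2 : r * r <= 16 * (1 / t ^ 2)).
    { apply Rmult_le_reg_r with (t ^ 2); [nra|].
      replace (16 * (1 / t ^ 2) * t ^ 2) with 16 by (field; lra).
      replace (r * r * t ^ 2) with ((- t * r) * (- t * r)) by ring.
      assert (0 <= - t * r) by (apply Rmult_le_pos; lra). nra. }
    eapply Rle_trans; [apply Rabs_triang|].
    eapply Rle_trans; [apply Rplus_le_compat_l, Rabs_triang|].
    rewrite !Rabs_Ropp, !(Rabs_mult (a / 2)), (Rabs_right (r * G)), (Rabs_right (2 * _)), (Rabs_right (r * r)).
    - unfold Rdiv at 1. rewrite (Rabs_mult a), (Rabs_right (/ 2)) by lra.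
      assert (r * G <= 4 * (c0 * (1 / t ^ 2))).
      { apply Rmult_le_compat; try assumption. unfold Rdiv in *. lra. }
      assert (Rabs a * (r * r) <= Rabs a * (16 * (1 / t ^ 2))) by (apply Rmult_le_compat_l; [apply Rabs_pos|exact Hr2]).
      unfold c. lra.
    - apply Rle_ge, Rmult_le_pos; lra.
    - lra.
    - apply Rle_ge, Rmult_le_pos; lra. }
  pose (Psi := fun t => c * / (- t) ^ 3 * exp (- t ^ 2 / 4)).
  pose (Phi := fun t => e t * exp (- t ^ 2 / 4)).
  assert (DPsi : forall t, t <= - S1 -> is_derive Psi t (c * (3 * / t ^ 4 + 1 / 2 * (1 / t ^ 2)) * exp (- t ^ 2 / 4))).
  { intros t Ht. unfold Psi. auto_derive.
    - assert (0 < (- t) ^ 3) by (apply pow_lt; lra). simpl in *. lra.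
    - simpl. unfold Rdiv. field. lra. }
  assert (DPhi : forall t, t <= - S1 ->
     is_derive Phi t ((1 - f t / g t * (curv t / g t) - 2 / t ^ 2 - t / 2 * e t) * exp (- t ^ 2 / 4))).
  { intros t Ht. specialize (De t Ht). unfold Phi. derive_ctx.
    simpl. unfold Rdiv. field. pose proof (g_pos t). split; lra. }
  assert (Btail : forall t, t <= - S1 -> Rabs (Phi t) <= 6 / - t /\ 0 <= Psi t).
  { intros t Ht. destruct (ratio_bounds t ltac:(lra)) as [R1 R2].
    assert (Hst : 1 <= - t) by lra.
    assert (Hexp : exp (- t ^ 2 / 4) <= 1) by (rewrite <- exp_0; apply exp_le; nra).
    pose proof (exp_pos (- t ^ 2 / 4)).
    split.
    - unfold Phi. rewrite Rabs_mult, (Rabs_right (exp _)) by lra.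
      assert (Hre : Rabs (e t) <= 6 / - t).
      { unfold e. apply Rabs_le.
        assert (f t / g t <= 4 / - t) by (apply (proj1 (Rle_div_r (f t / g t) 4 (- t) ltac:(lra))); lra).
        assert (0 < / - t) by (apply Rinv_0_lt_compat; lra).
        unfold Rdiv in *. lra. }
      pose proof (Rabs_pos (e t)). nra.
    - unfold Psi. apply Rmult_le_pos; [|lra]. apply Rmult_le_pos; [exact Hc|].
      apply Rlt_le, Rinv_0_lt_compat, pow_lt. lra. }
  assert (Dbound : forall t, t <= - S1 ->
     Rabs ((1 - f t / g t * (curv t / g t) - 2 / t ^ 2 - t / 2 * e t) * exp (- t ^ 2 / 4))
       <= c * (3 * / t ^ 4 + 1 / 2 * (1 / t ^ 2)) * exp (- t ^ 2 / 4)).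
  { intros t Ht. pose proof (exp_pos (- t ^ 2 / 4)). rewrite Rabs_mult, (Rabs_right (exp _)) by lra.
    apply Rmult_le_compat_r; [lra|]. eapply Rle_trans; [now apply Be|].
    assert (0 < / t ^ 4) by (apply Rinv_0_lt_compat; replace (t ^ 4) with ((t * t) * (t * t)) by ring; assert (0 < t * t) by nra; nra).
    assert (0 <= c * / t ^ 4) by nra. lra. }
  (* If [h t0 < 0], then at any [t < 6 / h t0] the lower bound [-6/(-t)] exceeds [h t0]. Applied to
     [Psi + Phi] and [Psi - Phi], this expresses that [Phi] vanishes at [-oo], which excludes a
     component of [e] growing like [exp (t^2/4)]. *)
  assert (Lim : forall h : R -> R, (forall t, t <= t0 -> h t <= h t0) ->
     (forall t, t <= t0 -> - (6 / - t) <= h t) -> 0 <= h t0).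
  { intros h H1 H2. apply Rnot_lt_le. intros Hneg.
    set (t := Rmin t0 (6 / h t0 - 1)).
    assert (Ht : t <= t0) by apply Rmin_l. assert (Ht' : t <= 6 / h t0 - 1) by apply Rmin_r.
    specialize (H1 t Ht). specialize (H2 t Ht).
    assert (6 / - t < - h t0); [|lra].
    apply Rlt_div_l; [lra|].
    assert (6 / h t0 - 1 < 6 / h t0) by lra.
    assert (- h t0 * (- (6 / h t0)) = 6) by (field; lra). nra. }
  assert (P : forall sg, sg = 1 \/ sg = - 1 -> 0 <= Psi t0 + sg * Phi t0).
  { intros sg Hsg. apply (Lim (fun t => Psi t + sg * Phi t)).
    - intros t Ht. apply (nondecreasing_of_derive (fun t => Psi t + sg * Phi t) (fun t =>
         c * (3 * / t ^ 4 + 1 / 2 * (1 / t ^ 2)) * exp (- t ^ 2 / 4)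
         + sg * ((1 - f t / g t * (curv t / g t) - 2 / t ^ 2 - t / 2 * e t) * exp (- t ^ 2 / 4)))); [| |exact Ht].
      + intros x Hx. apply (is_derive_plus Psi (fun t => sg * Phi t)); [apply DPsi; lra|].
        apply (is_derive_scal Phi). apply DPhi. lra.
      + intros x Hx. specialize (Dbound x ltac:(lra)). apply Rabs_le_between in Dbound.
        destruct Hsg as [-> | ->]; lra.
    - intros t Ht. destruct (Btail t ltac:(lra)) as [B1 B2]. apply Rabs_le_between in B1.
      destruct Hsg as [-> | ->]; lra. }
  pose proof (P 1 (or_introl eq_refl)) as P1. pose proof (P (- 1) (or_intror eq_refl)) as P2.
  unfold Psi, Phi in P1, P2. pose proof (exp_pos (- t0 ^ 2 / 4)) as Hex.
  assert (0 < / (- t0) ^ 3) by (apply Rinv_0_lt_compat, pow_lt; lra).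
  assert (0 <= c0 * / (- t0) ^ 3) by nra.
  fold (e t0). apply Rabs_le. unfold Rdiv. split.
  - apply Rmult_le_reg_r with (exp (- t0 ^ 2 / 4)); [exact Hex|]. nra.
  - apply Rmult_le_reg_r with (exp (- t0 ^ 2 / 4)); [exact Hex|]. nra.
Qed.

(** [h + c/(-t)] is nondecreasing and [h - c/(-t)] nonincreasing, so the two envelopes enclose a
    number; the supremum of the lower one is taken, and the rate comes for free. *)
Lemma limit_minus_infty (h dh : R -> R) (c S1 : R) :
  0 < S1 -> 0 <= c -> (forall t, t <= - S1 -> is_derive h t (dh t)) ->
  (forall t, t <= - S1 -> Rabs (dh t) <= c / t ^ 2) ->
  exists l, forall t, t <= - S1 -> Rabs (h t - l) <= c / - t.
Proof.
  intros HS Hc Hd Hb.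
  assert (Dc : forall t, t <= - S1 -> is_derive (fun t => c / - t) t (c / t ^ 2)).
  { intros t Ht. auto_derive; [lra|]. field. lra. }
  assert (M1 : forall s t, s <= t -> t <= - S1 -> h s + c / - s <= h t + c / - t).
  { intros s t Hst Ht. apply (nondecreasing_of_derive (fun t => h t + c / - t) (fun t => dh t + c / t ^ 2)); [| |exact Hst].
    - intros x Hx. apply (is_derive_plus h (fun t => c / - t)); [apply Hd|apply Dc]; lra.
    - intros x Hx. specialize (Hb x ltac:(lra)). apply Rabs_le_between in Hb. lra. }
  assert (M2 : forall s t, s <= t -> t <= - S1 -> h t - c / - t <= h s - c / - s).
  { intros s t Hst Ht. apply (nonincreasing_of_derive (fun t => h t - c / - t) (fun t => dh t - c / t ^ 2)); [| |exact Hst].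
    - intros x Hx. apply (is_derive_minus h (fun t => c / - t)); [apply Hd|apply Dc]; lra.
    - intros x Hx. specialize (Hb x ltac:(lra)). apply Rabs_le_between in Hb. lra. }
  assert (Hp : forall t, t <= - S1 -> 0 <= c / - t) by (intros t Ht; apply Rdiv_le_0_compat; lra).
  assert (X : forall s t, s <= - S1 -> t <= - S1 -> h t - c / - t <= h s + c / - s).
  { intros s t Hs Ht. destruct (Rle_dec s t) as [H|H].
    - specialize (M2 s t H Ht). specialize (Hp s Hs). lra.
    - specialize (M1 t s ltac:(lra) Hs). specialize (Hp t Ht). lra. }
  destruct (completeness (fun x => exists t, t <= - S1 /\ x = h t - c / - t)) as [l [Hub Hlub]].
  { exists (h (- S1) + c / - - S1). intros x [t [Ht ->]]. apply X; lra. }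
  { exists (h (- S1) - c / - - S1), (- S1). split; [lra|reflexivity]. }
  exists l. intros t Ht. apply Rabs_le.
  assert (h t - c / - t <= l) by (apply Hub; exists t; auto).
  assert (l <= h t + c / - t) by (apply Hlub; intros x [s [Hs ->]]; apply X; auto).
  lra.
Qed.

(** Because [(3-2q)/(q-1) = a - 1], the quantity is [(-t f/g) exp (L t)]. The first factor tends to
    2 and [L] to [l], whence [C = 2 exp l]. *)
Lemma profile_minus_infty : exists C, 0 < C /\
  forall eps, 0 < eps -> exists M, forall eta, eta < - M ->
    Rabs (exp (eta ^ 2 / 4) * Rpower (- eta) (- ((3 - 2 * q) / (q - 1))) * f eta - C) < eps.
Proof.
  destruct ratio_asymptotics as [c [S1 [Hc [HS Hr]]]].
  (* The terms [t^2/4] and [-a ln (-t)] cancel the leading part of [(ln g)' = k/g]; a derivative of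
     order [t^(-2)] remains. *)
  set (L := fun t => ln (g t) + t ^ 2 / 4 - a * ln (- t)).
  destruct (limit_minus_infty L (fun t => drift q g t / q - a / 2 * (f t / g t - 2 / - t))
              (c * (1 + Rabs a)) S1) as [l Hl].
  - lra.
  - apply Rmult_le_pos; [exact Hc|]. pose proof (Rabs_pos a). lra.
  - intros t Ht.
    apply (is_derive_eq _ _ (curv t / g t + t / 2 - a / t)).
    + pose proof (is_derive_g t) as Dg. pose proof (g_pos t).
      unfold L. derive_ctx. field. lra.
    + rewrite curv_ratio. field. pose proof (g_pos t). repeat split; lra.
  - intros t Ht. destruct (Hr t Ht) as [H1 H2]. assert (Hst : 1 <= - t) by lra.
    pose proof (drift_pos q Hq g t). assert (0 <= drift q g t / q) by (apply Rdiv_le_0_compat; lra).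
    unfold Rminus at 1. eapply Rle_trans; [apply Rabs_triang|].
    rewrite Rabs_Ropp, Rabs_mult, (Rabs_right (drift q g t / q)) by lra.
    assert (H3 : c / (- t) ^ 3 <= c / t ^ 2).
    { apply Rmult_le_compat_l; [exact Hc|]. apply Rinv_le_contravar; [nra|]. simpl. nra. }
    assert (H4 : Rabs (a / 2) <= Rabs a).
    { unfold Rdiv. rewrite Rabs_mult, (Rabs_right (/ 2)) by lra. pose proof (Rabs_pos a). lra. }
    assert (Rabs (a / 2) * Rabs (f t / g t - 2 / - t) <= Rabs a * (c / t ^ 2)).
    { apply Rmult_le_compat; try apply Rabs_pos; [exact H4|]. lra. }
    replace (c * (1 + Rabs a) / t ^ 2) with (c / t ^ 2 + Rabs a * (c / t ^ 2)) by (field; lra). lra.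
  - exists (2 * exp l). split; [pose proof (exp_pos l); lra|]. intros eps He.
    destruct (continuity_pt_eps exp l (Rmin 1 (eps / 4))) as [d [Hd Hexp]].
    { apply derivable_continuous_pt, derivable_pt_exp. }
    { apply Rmin_glb_lt; lra. }
    set (E := exp l + 1). assert (HE : 0 < E) by (pose proof (exp_pos l); unfold E; lra).
    set (c1 := c * (1 + Rabs a)). assert (Hc1 : 0 <= c1) by (apply Rmult_le_pos; [exact Hc|pose proof (Rabs_pos a); lra]).
    exists (S1 + c1 / d + 2 * c * E / eps).
    assert (Q1 : 0 <= c1 / d) by (apply Rdiv_le_0_compat; lra).
    assert (Q2 : 0 <= 2 * c * E / eps) by (apply Rdiv_le_0_compat; [apply Rmult_le_pos; lra|lra]).
    intros t Ht. specialize (Hl t ltac:(lra)). fold c1 in Hl. destruct (Hr t ltac:(lra)) as [_ He2].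
    assert (Hst : 1 <= - t) by lra.
    assert (HLd : Rabs (L t - l) < d).
    { eapply Rle_lt_trans; [exact Hl|]. apply Rlt_div_l; [lra|].
      assert (d * (c1 / d) = c1) by (field; lra). nra. }
    specialize (Hexp (L t) HLd).
    assert (X1 : Rabs (exp (L t) - exp l) < 1) by (eapply Rlt_le_trans; [exact Hexp|apply Rmin_l]).
    assert (X2 : Rabs (exp (L t) - exp l) < eps / 4) by (eapply Rlt_le_trans; [exact Hexp|apply Rmin_r]).
    pose proof (g_pos t) as Hg.
    assert (Eq : exp (t ^ 2 / 4) * Rpower (- t) (- ((3 - 2 * q) / (q - 1))) * f t
                 = - t * (f t / g t) * exp (L t)).
    { replace (f t) with (f t / g t * g t) at 1 by (field; lra).
      replace (- ((3 - 2 * q) / (q - 1))) with (1 + - a).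
      - rewrite Rpower_plus, Rpower_1 by lra. unfold L.
        replace (ln (g t) + t ^ 2 / 4 - a * ln (- t)) with (ln (g t) + (t ^ 2 / 4 + - a * ln (- t))) by ring.
        rewrite !exp_plus, exp_ln by exact Hg. unfold Rpower. ring.
      - replace a with (1 / (q - 1) - 1); [field; lra|].
        apply Rmult_eq_reg_r with (q - 1); [|lra].
        replace (a * (q - 1)) with ((a + 1) * (q - 1) - (q - 1)) by ring. rewrite Ha. field. lra. }
    rewrite Eq.
    set (r := f t / g t) in *.
    replace (- t * r * exp (L t) - 2 * exp l)
      with (- t * (r - 2 / - t) * exp (L t) + 2 * (exp (L t) - exp l)) by (field; lra).
    eapply Rle_lt_trans; [apply Rabs_triang|].
    rewrite !Rabs_mult, (Rabs_right 2), (Rabs_right (exp (L t))), (Rabs_right (- t))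
      by (try (apply Rle_ge, Rlt_le, exp_pos); lra).
    assert (Y1 : - t * Rabs (r - 2 / - t) <= c / - t).
    { apply Rle_trans with (- t * (c / (- t) ^ 3)); [apply Rmult_le_compat_l; lra|].
      replace (- t * (c / (- t) ^ 3)) with (c / - t * (1 / - t)) by (field; lra).
      rewrite <- (Rmult_1_r (c / - t)) at 2. apply Rmult_le_compat_l; [apply Rdiv_le_0_compat; lra|].
      apply Rle_div_l; lra. }
    assert (Y2 : exp (L t) <= E) by (apply Rabs_def2 in X1; unfold E; lra).
    assert (Y3 : c / - t * E < eps / 2 \/ c / - t * E = 0).
    { destruct (Req_dec c 0) as [->|Hc0]; [right; field; lra|left].
      apply Rmult_lt_reg_r with (- t); [lra|].
      replace (c / - t * E * - t) with (c * E) by (field; lra).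
      assert (eps / 2 * (2 * c * E / eps) = c * E) by (field; lra). nra. }
    assert (Y4 : - t * Rabs (r - 2 / - t) * exp (L t) <= c / - t * E).
    { apply Rmult_le_compat; [|apply Rlt_le, exp_pos|exact Y1|exact Y2].
      apply Rmult_le_pos; [lra|apply Rabs_pos]. }
    destruct Y3; lra.
Qed.

End Profile.

(** * Midpoint sums *)

Definition mesh (R0 : R) (n : nat) : R := 2 * R0 / INR (S n).
Definition node (R0 : R) (n k : nat) : R := - R0 + (2 * INR k + 1) * R0 / INR (S n).

Lemma INR_S_pos (n : nat) : 0 < INR (S n).
Proof. apply lt_0_INR. lia. Qed.

Lemma mesh_nonneg (R0 : R) (n : nat) : 0 <= R0 -> 0 <= mesh R0 n.
Proof.
  intros H. pose proof (INR_S_pos n). unfold mesh, Rdiv. apply Rmult_le_pos; [lra|].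
  apply Rlt_le, Rinv_0_lt_compat. lra.
Qed.

Lemma node_bound (R0 : R) (n k : nat) : 0 <= R0 -> (k <= n)%nat -> Rabs (node R0 n k) <= R0.
Proof.
  intros H Hk. pose proof (INR_S_pos n) as Hn. pose proof (pos_INR k).
  assert (INR k <= INR n) by now apply le_INR.
  assert (E : (2 * INR k + 1) * R0 / INR (S n) = R0 * ((2 * INR k + 1) / INR (S n))) by (field; lra).
  assert (0 <= (2 * INR k + 1) / INR (S n) <= 2).
  { split.
    - apply Rmult_le_pos; [lra|]. apply Rlt_le, Rinv_0_lt_compat, Hn.
    - apply Rmult_le_reg_r with (INR (S n)); [exact Hn|].
      replace ((2 * INR k + 1) / INR (S n) * INR (S n)) with (2 * INR k + 1) by (field; lra).
      rewrite S_INR. lra. }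
  unfold node. rewrite E. apply Rabs_le. nra.
Qed.

(** Grid [n] has [S n] cells per direction, so the common refinement of grids [n] and [m] has
    [S n * S m] of them, and its index is one less. *)
Definition refine (n m : nat) : nat := (n * S m + m)%nat.

Lemma INR_refine (n m : nat) : INR (S (refine n m)) = INR (S n) * INR (S m).
Proof. rewrite <- mult_INR. f_equal. unfold refine. lia. Qed.

Lemma refine_comm (n m : nat) : refine n m = refine m n.
Proof. unfold refine. lia. Qed.

Lemma mesh_refine (R0 : R) (n m : nat) : mesh R0 n = INR (S m) * mesh R0 (refine n m).
Proof.
  unfold mesh. rewrite INR_refine. pose proof (INR_S_pos n). pose proof (INR_S_pos m). field. lra.
Qed.

Lemma node_refine (R0 : R) (n m k j : nat) : 0 <= R0 -> (j <= m)%nat ->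
  Rabs (node R0 n k - node R0 (refine n m) (k * S m + j)) <= mesh R0 n.
Proof.
  intros H Hj. pose proof (INR_S_pos n) as Hn. pose proof (INR_S_pos m) as Hm.
  unfold node, mesh. rewrite INR_refine, plus_INR, mult_INR.
  replace (- R0 + (2 * INR k + 1) * R0 / INR (S n)
     - (- R0 + (2 * (INR k * INR (S m) + INR j) + 1) * R0 / (INR (S n) * INR (S m))))
    with (2 * R0 / INR (S n) * ((INR (S m) - 2 * INR j - 1) / (2 * INR (S m)))) by (field; lra).
  assert (0 <= 2 * R0 / INR (S n)) by (apply (mesh_nonneg R0 n H)).
  rewrite Rabs_mult, (Rabs_right (2 * R0 / INR (S n))) by lra.
  rewrite <- (Rmult_1_r (2 * R0 / INR (S n))) at 2. apply Rmult_le_compat_l; [exact H0|].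
  assert (INR j <= INR m) by now apply le_INR. pose proof (pos_INR j). rewrite S_INR in *.
  apply Rabs_le. split.
  - apply Rmult_le_reg_r with (2 * (INR m + 1)); [lra|].
    replace ((INR m + 1 - 2 * INR j - 1) / (2 * (INR m + 1)) * (2 * (INR m + 1)))
      with (INR m + 1 - 2 * INR j - 1) by (field; lra). lra.
  - apply Rmult_le_reg_r with (2 * (INR m + 1)); [lra|].
    replace ((INR m + 1 - 2 * INR j - 1) / (2 * (INR m + 1)) * (2 * (INR m + 1)))
      with (INR m + 1 - 2 * INR j - 1) by (field; lra). lra.
Qed.

Lemma sum_refine (a : nat -> R) (n m : nat) :
  sum_f_R0 a (refine n m) = sum_f_R0 (fun k => sum_f_R0 (fun j => a (k * S m + j)%nat) m) n.
Proof.
  unfold refine. induction n as [|n IH]; [reflexivity|].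
  rewrite (tech2 a (n * S m + m)) by lia. rewrite IH.
  simpl (sum_f_R0 _ (S n)). f_equal.
  replace (S n * S m + m - S (n * S m + m))%nat with m by lia.
  apply sum_eq. intros i Hi. f_equal. lia.
Qed.

(** Fine cells are grouped by the coarse cell that contains them. The error [e] may vary from cell
    to cell, to separate later the cells near the sphere from the others. *)
Lemma block_compare (a b e : nat -> R) (n m : nat) (h h' : R) :
  h = INR (S m) * h' -> 0 <= h' ->
  (forall k j, (k <= n)%nat -> (j <= m)%nat -> Rabs (a k - b (k * S m + j)%nat) <= e k) ->
  Rabs (sum_f_R0 (fun k => a k * h) n - sum_f_R0 (fun i => b i * h') (refine n m))
    <= sum_f_R0 (fun k => e k * h) n.
Proof.
  intros Hh Hh' H. rewrite sum_refine, <- minus_sum.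
  eapply Rle_trans; [apply Rsum_abs|]. apply sum_Rle. intros k Hk.
  replace (a k * h) with (sum_f_R0 (fun _ => a k * h') m) by (rewrite sum_cte, Hh; ring).
  replace (e k * h) with (sum_f_R0 (fun _ => e k * h') m) by (rewrite sum_cte, Hh; ring).
  rewrite <- minus_sum. eapply Rle_trans; [apply Rsum_abs|]. apply sum_Rle. intros j Hj.
  replace (a k * h' - b (k * S m + j)%nat * h') with ((a k - b (k * S m + j)%nat) * h') by ring.
  rewrite Rabs_mult, (Rabs_right h') by lra. apply Rmult_le_compat_r; auto.
Qed.

Lemma sum_telescope (G : nat -> R) (n : nat) :
  sum_f_R0 (fun k => G (S k) - G k) n = G (S n) - G O.
Proof. induction n as [|n IH]; simpl; [reflexivity|]. rewrite IH. ring. Qed.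

(** * Counting nodes in intervals and annuli *)

Definition clamp (lo hi z : R) : R := Rmax lo (Rmin z hi).

Lemma clamp_cases (lo hi z : R) : lo <= hi ->
  (z <= lo /\ clamp lo hi z = lo) \/ (lo <= z <= hi /\ clamp lo hi z = z) \/ (hi <= z /\ clamp lo hi z = hi).
Proof.
  intros H. unfold clamp, Rmin, Rmax.
  destruct (Rle_dec z hi); destruct (Rle_dec lo _); lra.
Qed.

Definition in_itv (lo hi z : R) : R := if Rle_dec lo z then (if Rle_dec z hi then 1 else 0) else 0.

Lemma in_itv_nonneg (lo hi z : R) : 0 <= in_itv lo hi z.
Proof. unfold in_itv. destruct (Rle_dec lo z); [destruct (Rle_dec z hi)|]; lra. Qed.

Definition edge (R0 : R) (n k : nat) : R := - R0 + INR k * mesh R0 n.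

Lemma node_edge (R0 : R) (n k : nat) : node R0 n k = edge R0 n k + mesh R0 n / 2.
Proof. unfold node, edge, mesh. pose proof (INR_S_pos n). field. lra. Qed.

Lemma edge_S (R0 : R) (n k : nat) : edge R0 n (S k) = edge R0 n k + mesh R0 n.
Proof. unfold edge. rewrite S_INR. ring. Qed.

Lemma edge_0 (R0 : R) (n : nat) : edge R0 n 0 = - R0.
Proof. unfold edge. simpl. ring. Qed.

Lemma edge_last (R0 : R) (n : nat) : edge R0 n (S n) = R0.
Proof. unfold edge, mesh. pose proof (INR_S_pos n). field. lra. Qed.

(** A counted node is the midpoint of a cell contained in [[lo - h/2, hi + h/2]], so it accounts for
    a full increment of the clamp to that interval; the increments telescope. *)
Lemma count_upper (R0 lo hi : R) (n : nat) : 0 <= R0 -> lo <= hi ->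
  sum_f_R0 (fun k => in_itv lo hi (node R0 n k) * mesh R0 n) n <= hi - lo + mesh R0 n.
Proof.
  intros HR H. pose proof (mesh_nonneg R0 n HR) as Hh. set (h := mesh R0 n) in *.
  set (P := clamp (lo - h / 2) (hi + h / 2)).
  apply Rle_trans with (sum_f_R0 (fun k => P (edge R0 n (S k)) - P (edge R0 n k)) n).
  - apply sum_Rle. intros k _. rewrite node_edge, edge_S. fold h. set (z := edge R0 n k).
    unfold in_itv, P.
    destruct (clamp_cases (lo - h / 2) (hi + h / 2) (z + h)) as [[? ->]|[[? ->]|[? ->]]]; try lra;
    destruct (clamp_cases (lo - h / 2) (hi + h / 2) z) as [[? ->]|[[? ->]|[? ->]]]; try lra;
    destruct (Rle_dec lo (z + h / 2)); try lra; destruct (Rle_dec (z + h / 2) hi); lra.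
  - rewrite (sum_telescope (fun k => P (edge R0 n k))).
    destruct (clamp_cases (lo - h / 2) (hi + h / 2) (edge R0 n (S n))) as [[? E1]|[[? E1]|[? E1]]]; try lra;
    destruct (clamp_cases (lo - h / 2) (hi + h / 2) (edge R0 n 0)) as [[? E2]|[[? E2]|[? E2]]]; try lra;
    unfold P; rewrite E1, E2; lra.
Qed.

(** Dually, a cell on which the clamp to [[lo + h/2, hi - h/2]] grows has its midpoint in
    [[lo, hi]]. *)
Lemma count_lower (R0 lo hi : R) (n : nat) : 0 <= R0 -> - R0 <= lo -> hi <= R0 -> mesh R0 n <= hi - lo ->
  hi - lo - mesh R0 n <= sum_f_R0 (fun k => in_itv lo hi (node R0 n k) * mesh R0 n) n.
Proof.
  intros HR H1 H2 Hm. pose proof (mesh_nonneg R0 n HR) as Hh. set (h := mesh R0 n) in *.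
  set (P := clamp (lo + h / 2) (hi - h / 2)).
  apply Rle_trans with (sum_f_R0 (fun k => P (edge R0 n (S k)) - P (edge R0 n k)) n).
  - rewrite (sum_telescope (fun k => P (edge R0 n k))). rewrite edge_0, edge_last.
    destruct (clamp_cases (lo + h / 2) (hi - h / 2) R0) as [[? E1]|[[? E1]|[? E1]]]; try lra;
    destruct (clamp_cases (lo + h / 2) (hi - h / 2) (- R0)) as [[? E2]|[[? E2]|[? E2]]]; try lra;
    unfold P; rewrite E1, E2; lra.
  - apply sum_Rle. intros k _. rewrite node_edge, edge_S. fold h. set (z := edge R0 n k).
    unfold in_itv.
    destruct (clamp_cases (lo + h / 2) (hi - h / 2) (z + h)) as [[? E1]|[[? E1]|[? E1]]]; try lra;
    destruct (clamp_cases (lo + h / 2) (hi - h / 2) z) as [[? E2]|[[? E2]|[? E2]]]; try lra;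
    unfold P; rewrite E1, E2;
    destruct (Rle_dec lo (z + h / 2)); try lra; destruct (Rle_dec (z + h / 2) hi); lra.
Qed.

(** The two intervals have length at most [sqrt (2 eta)] by [sqrt B <= sqrt A + sqrt (2 eta)]. The
    bound is uniform in [s], so lines tangent to the sphere are covered too. *)
Lemma annulus_cover (c s eta : R) : 0 <= eta ->
  exists lo hi, 0 <= lo <= hi /\ hi - lo <= sqrt (2 * eta) /\
    forall z, Rabs ((z - c) ^ 2 - s) <= eta -> c + lo <= z <= c + hi \/ c - hi <= z <= c - lo.
Proof.
  intros He.
  set (A := Rmax 0 (s - eta)). set (B := Rmax 0 (s + eta)).
  assert (HA : 0 <= A) by apply Rmax_l. assert (HA' : s - eta <= A) by apply Rmax_r.
  assert (HB : 0 <= B) by apply Rmax_l. assert (HB' : s + eta <= B) by apply Rmax_r.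
  assert (HAB : A <= B) by (unfold A; apply Rmax_lub; lra).
  assert (HAB2 : B <= A + 2 * eta) by (unfold B; apply Rmax_lub; lra).
  assert (LA : sqrt A <= sqrt B) by now apply sqrt_le_1_alt.
  pose proof (sqrt_pos A). pose proof (sqrt_pos (2 * eta)).
  exists (sqrt A), (sqrt B). split; [lra|split].
  - assert (sqrt B <= sqrt A + sqrt (2 * eta)); [|lra].
    apply Rsqr_incr_0; [|apply sqrt_pos|lra].
    unfold Rsqr. rewrite sqrt_sqrt by exact HB.
    assert (sqrt A * sqrt A = A) by now apply sqrt_sqrt.
    assert (sqrt (2 * eta) * sqrt (2 * eta) = 2 * eta) by (apply sqrt_sqrt; lra). nra.
  - intros z Hz. apply Rabs_le_between in Hz.
    assert (Hz2 : 0 <= (z - c) ^ 2) by apply pow2_ge_0.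
    assert (L1 : sqrt A <= Rabs (z - c)).
    { rewrite <- sqrt_Rsqr_abs. apply sqrt_le_1_alt. unfold Rsqr, A. apply Rmax_lub; lra. }
    assert (L2 : Rabs (z - c) <= sqrt B).
    { rewrite <- sqrt_Rsqr_abs. apply sqrt_le_1_alt. unfold Rsqr. lra. }
    destruct (Rle_dec 0 (z - c)).
    + rewrite Rabs_right in L1, L2 by lra. left. lra.
    + rewrite Rabs_left in L1, L2 by lra. right. lra.
Qed.

Definition in_annulus (c s eta z : R) : R := if Rle_dec (Rabs ((z - c) ^ 2 - s)) eta then 1 else 0.

Lemma count_annulus (R0 c s eta : R) (n : nat) : 0 <= R0 -> 0 <= eta ->
  sum_f_R0 (fun k => in_annulus c s eta (node R0 n k) * mesh R0 n) n
    <= 2 * (sqrt (2 * eta) + mesh R0 n).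
Proof.
  intros HR He. destruct (annulus_cover c s eta He) as [lo [hi [Hlh [Hd Hz]]]].
  pose proof (count_upper R0 (c + lo) (c + hi) n HR ltac:(lra)) as C1.
  pose proof (count_upper R0 (c - hi) (c - lo) n HR ltac:(lra)) as C2.
  apply Rle_trans with (sum_f_R0 (fun k => in_itv (c + lo) (c + hi) (node R0 n k) * mesh R0 n) n +
                        sum_f_R0 (fun k => in_itv (c - hi) (c - lo) (node R0 n k) * mesh R0 n) n); [|lra].
  rewrite <- sum_plus. apply sum_Rle. intros k _. rewrite <- Rmult_plus_distr_r.
  apply Rmult_le_compat_r; [now apply mesh_nonneg|].
  set (z := node R0 n k).
  pose proof (in_itv_nonneg (c + lo) (c + hi) z). pose proof (in_itv_nonneg (c - hi) (c - lo) z).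
  unfold in_annulus. destruct (Rle_dec _ eta) as [Hle|]; [|lra].
  unfold in_itv in *. destruct (Hz z Hle).
  - destruct (Rle_dec (c + lo) z); [|lra]. destruct (Rle_dec z (c + hi)); lra.
  - destruct (Rle_dec (c - hi) z); [|lra]. destruct (Rle_dec z (c - lo)); lra.
Qed.

(** * Iterated midpoint sums and their limits *)

Lemma gsum_S (d n : nat) (R0 : R) (g : pt -> R) (x : pt) :
  gsum (S d) n R0 g x = sum_f_R0 (fun k => gsum d n R0 g (upd x d (node R0 n k)) * mesh R0 n) n.
Proof. reflexivity. Qed.

Lemma sum_mesh (R0 B : R) (n : nat) : sum_f_R0 (fun _ => B * mesh R0 n) n = B * (2 * R0).
Proof. rewrite sum_cte. unfold mesh. pose proof (INR_S_pos n). field. lra. Qed.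

Lemma gsum_bound (d n : nat) (R0 B : R) (g : pt -> R) (x : pt) :
  0 <= R0 -> (forall y, Rabs (g y) <= B) -> Rabs (gsum d n R0 g x) <= B * (2 * R0) ^ d.
Proof.
  intros HR Hg. revert x. induction d as [|d IH]; intros x.
  - simpl. rewrite Rmult_1_r. apply Hg.
  - rewrite gsum_S. eapply Rle_trans; [apply Rsum_abs|].
    apply Rle_trans with (sum_f_R0 (fun _ => B * (2 * R0) ^ d * mesh R0 n) n).
    + apply sum_Rle. intros k _. pose proof (mesh_nonneg R0 n HR).
      rewrite Rabs_mult, (Rabs_right (mesh R0 n)) by lra. apply Rmult_le_compat_r; auto.
    + rewrite sum_mesh. right. simpl. ring.
Qed.

Lemma gsum_nonneg (d n : nat) (R0 : R) (g : pt -> R) (x : pt) :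
  0 <= R0 -> (forall y, 0 <= g y) -> 0 <= gsum d n R0 g x.
Proof.
  intros HR Hg. revert x. induction d as [|d IH]; intros x; [apply Hg|].
  rewrite gsum_S. apply cond_pos_sum. intros k. apply Rmult_le_pos; [apply IH|now apply mesh_nonneg].
Qed.

Lemma lim_seq_eq (s : nat -> R) (l : R) : Un_cv s l -> lim_seq s = l.
Proof.
  intros H. unfold lim_seq. destruct (excluded_middle_informative _) as [E|E].
  - destruct (constructive_indefinite_description _ E) as [l' Hl']. simpl. now apply (UL_sequence s).
  - exfalso. apply E. now exists l.
Qed.

(** The default value 0 of a divergent sequence also meets the bound, so upper estimates hold in
    either case. *)
Lemma lim_seq_bound (s : nat -> R) (B : R) : (forall n, Rabs (s n) <= B) -> Rabs (lim_seq s) <= B.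
Proof.
  intros H. unfold lim_seq. destruct (excluded_middle_informative _) as [E|E].
  - destruct (constructive_indefinite_description _ E) as [l Hl]. simpl.
    apply Rnot_lt_le. intros Hlt. destruct (Hl (Rabs l - B)) as [N HN]; [lra|].
    specialize (HN N (le_n N)). specialize (H N). unfold Rdist in HN.
    pose proof (Rabs_triang_inv l (s N)). rewrite Rabs_minus_sym in HN. lra.
  - rewrite Rabs_R0. pose proof (Rabs_pos (s O)). specialize (H O). lra.
Qed.

Lemma intBox_bound (N : nat) (R0 B : R) (g : pt -> R) :
  0 <= R0 -> (forall y, Rabs (g y) <= B) -> Rabs (intBox N R0 g) <= B * (2 * R0) ^ N.
Proof. intros HR Hg. apply lim_seq_bound. intros n. now apply gsum_bound. Qed.

Lemma upd_eq (x : pt) (i : nat) (s : R) : upd x i s i = s.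
Proof. unfold upd. now rewrite Nat.eqb_refl. Qed.

Lemma upd_neq (x : pt) (i j : nat) (s : R) : j <> i -> upd x i s j = x j.
Proof. intros H. unfold upd. destruct (Nat.eqb_spec j i); [contradiction|reflexivity]. Qed.

(** Coordinates below [d] are left free: the remaining sums overwrite them. *)
Definition near_from (d N : nat) (R0 delta : R) (x y : pt) : Prop :=
  forall i, (d <= i < N)%nat -> Rabs (x i) <= R0 /\ Rabs (y i) <= R0 /\ Rabs (x i - y i) <= delta.

(** The first coordinate is the innermost sum, so the comparison reduces to lines in that direction.
    Each outer coordinate displaces the two base points by at most one mesh and multiplies the error
    by [2 R0]. *)
Lemma gsum_refine (N d n m : nat) (R0 eps : R) (g : pt -> R) :
  0 <= R0 -> (1 + d <= N)%nat ->
  (forall x y, near_from 1 N R0 (mesh R0 n) x y ->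
     Rabs (gsum 1 n R0 g x - gsum 1 (refine n m) R0 g y) <= eps) ->
  forall x y, near_from (S d) N R0 (mesh R0 n) x y ->
     Rabs (gsum (S d) n R0 g x - gsum (S d) (refine n m) R0 g y) <= eps * (2 * R0) ^ d.
Proof.
  intros HR HdN H1. induction d as [|d IH]; intros x y Hxy.
  - rewrite Rmult_1_r. now apply H1.
  - rewrite (gsum_S (S d) n), (gsum_S (S d) (refine n m)).
    apply Rle_trans with (sum_f_R0 (fun _ => eps * (2 * R0) ^ d * mesh R0 n) n).
    + apply (block_compare (fun k => gsum (S d) n R0 g (upd x (S d) (node R0 n k)))
               (fun i => gsum (S d) (refine n m) R0 g (upd y (S d) (node R0 (refine n m) i)))
               (fun _ => eps * (2 * R0) ^ d)).
      * apply mesh_refine.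
      * now apply mesh_nonneg.
      * intros k j Hk Hj. apply IH; [lia|]. intros i Hi.
        destruct (Nat.eq_dec i (S d)) as [->|Hne].
        -- rewrite !upd_eq. split; [now apply node_bound|split; [|now apply node_refine]].
           apply node_bound; [exact HR|]. unfold refine. nia.
        -- rewrite !upd_neq by exact Hne. apply Hxy. lia.
    + rewrite sum_mesh. right. simpl. ring.
Qed.

Lemma sumN_S (n : nat) (a : nat -> R) : sumN (S n) a = sumN n a + a n.
Proof. destruct n as [|n]; simpl; [ring|reflexivity]. Qed.

Lemma sumN_split0 (N : nat) (a : nat -> R) : (1 <= N)%nat ->
  sumN N a = a O + sumN N (fun i => match i with O => 0 | _ => a i end).
Proof.
  intros HN. destruct N as [|n]; [lia|]. clear HN. induction n as [|n IH].
  - simpl. ring.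
  - rewrite sumN_S, IH, (sumN_S (S n)). ring.
Qed.

Lemma sumN_le (N : nat) (a b : nat -> R) :
  (forall i, (i < N)%nat -> a i <= b i) -> sumN N a <= sumN N b.
Proof.
  induction N as [|N IH]; intros H; [simpl; lra|]. rewrite !sumN_S.
  apply Rplus_le_compat; [apply IH; intros i Hi|]; apply H; lia.
Qed.

Lemma sumN_const (N : nat) (e : R) : sumN N (fun _ => e) = INR N * e.
Proof. induction N as [|N IH]; [simpl; ring|]. rewrite sumN_S, IH, S_INR. ring. Qed.

Lemma sumN_ext (N : nat) (a b : nat -> R) :
  (forall i, (i < N)%nat -> a i = b i) -> sumN N a = sumN N b.
Proof.
  intros H. apply Rle_antisym; apply sumN_le; intros i Hi; rewrite H by exact Hi; lra.
Qed.

Lemma sumN_diff (N : nat) (a b : nat -> R) (e : R) :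
  (forall i, (i < N)%nat -> Rabs (a i - b i) <= e) -> Rabs (sumN N a - sumN N b) <= INR N * e.
Proof.
  induction N as [|N IH]; intros H.
  - simpl. rewrite Rminus_diag, Rabs_R0. lra.
  - rewrite !sumN_S, S_INR.
    replace (sumN N a + a N - (sumN N b + b N)) with ((sumN N a - sumN N b) + (a N - b N)) by ring.
    eapply Rle_trans; [apply Rabs_triang|]. specialize (IH (fun i Hi => H i ltac:(lia))).
    specialize (H N ltac:(lia)). lra.
Qed.

Lemma sumN_term_le (N : nat) (a : nat -> R) (i : nat) :
  (forall j, 0 <= a j) -> (i < N)%nat -> a i <= sumN N a.
Proof.
  intros Ha. induction N as [|N IH]; intros Hi; [lia|]. rewrite sumN_S.
  destruct (Nat.eq_dec i N) as [->|Hne].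
  - assert (0 <= sumN N a); [|lra].
    rewrite <- (Rmult_0_r (INR N)), <- sumN_const. apply sumN_le. auto.
  - specialize (IH ltac:(lia)). specialize (Ha N). lra.
Qed.

Definition ball_fun (N : nat) (c : pt) (r : R) (u : R -> R) (x : pt) : R :=
  if Rlt_dec (sumN N (fun i => (x i - c i) ^ 2)) (r ^ 2) then u (x O) else 0.

(** The first term is the variation of [u] over a cell. The second counts cells crossed by the
    sphere: between matching nodes the squared distance to the centre changes by at most
    [N * 4 R0 h]. *)
Definition slice_error (N : nat) (R0 Lu Um h : R) : R :=
  Lu * h * (2 * R0) + Um * (2 * (sqrt (2 * (INR N * (4 * R0 * h))) + h)).

Lemma ball_slice_refine (N n m : nat) (c : pt) (r R0 Lu Um : R) (u : R -> R) :
  (1 <= N)%nat -> 0 <= R0 -> (forall i, (i < N)%nat -> Rabs (c i) <= R0) ->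
  (forall z, Rabs z <= R0 -> 0 <= u z <= Um) -> 0 <= Lu ->
  (forall z z', Rabs z <= R0 -> Rabs z' <= R0 -> Rabs (u z - u z') <= Lu * Rabs (z - z')) ->
  forall x y, near_from 1 N R0 (mesh R0 n) x y ->
  Rabs (gsum 1 n R0 (ball_fun N c r u) x - gsum 1 (refine n m) R0 (ball_fun N c r u) y)
    <= slice_error N R0 Lu Um (mesh R0 n).
Proof.
  intros HN HR Hc Hu HLu HL x y Hxy.
  pose proof (mesh_nonneg R0 n HR) as Hh. set (h := mesh R0 n) in *.
  set (eta := INR N * (4 * R0 * h)).
  assert (Heta : 0 <= eta).
  { apply Rmult_le_pos; [apply pos_INR|]. apply Rmult_le_pos; lra. }
  assert (HUm : 0 <= Um) by (specialize (Hu 0 ltac:(rewrite Rabs_R0; lra)); lra).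
  set (T := sumN N (fun i => match i with O => 0 | _ => (x i - c i) ^ 2 end)).
  assert (HT : forall z, sumN N (fun i => (upd x 0 z i - c i) ^ 2) = (z - c O) ^ 2 + T).
  { intros z. rewrite sumN_split0 by exact HN. f_equal. apply sumN_ext. intros [|i] _; reflexivity. }
  rewrite (gsum_S 0 n), (gsum_S 0 (refine n m)).
  apply Rle_trans with (sum_f_R0 (fun k => (Lu * h + Um * in_annulus (c O) (r ^ 2 - T) eta (node R0 n k)) * mesh R0 n) n).
  - apply (block_compare (fun k => gsum 0 n R0 (ball_fun N c r u) (upd x 0 (node R0 n k)))
               (fun i => gsum 0 (refine n m) R0 (ball_fun N c r u) (upd y 0 (node R0 (refine n m) i)))
               (fun k => Lu * h + Um * in_annulus (c O) (r ^ 2 - T) eta (node R0 n k))).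
    + apply mesh_refine.
    + now apply mesh_nonneg.
    + intros k j Hk Hj. simpl. set (z := node R0 n k). set (z' := node R0 (refine n m) (k * S m + j)).
      assert (Hz : Rabs z <= R0) by now apply node_bound.
      assert (Hz' : Rabs z' <= R0) by (apply node_bound; [exact HR|unfold refine; nia]).
      assert (Hzz : Rabs (z - z') <= h) by now apply node_refine.
      assert (HD : Rabs (sumN N (fun i => (upd x 0 z i - c i) ^ 2) - sumN N (fun i => (upd y 0 z' i - c i) ^ 2)) <= eta).
      { apply sumN_diff. intros i Hi.
        assert (Hn : Rabs (upd x 0 z i) <= R0 /\ Rabs (upd y 0 z' i) <= R0 /\ Rabs (upd x 0 z i - upd y 0 z' i) <= h).
        { destruct i as [|i]; [auto|]. apply Hxy. lia. }
        destruct Hn as [H1 [H2 H3]]. set (p := upd x 0 z i) in *. set (p' := upd y 0 z' i) in *.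
        replace ((p - c i) ^ 2 - (p' - c i) ^ 2) with ((p + p' - 2 * c i) * (p - p')) by ring.
        rewrite Rabs_mult. apply Rmult_le_compat; try apply Rabs_pos; [|exact H3].
        specialize (Hc i Hi). apply Rabs_le_between in H1, H2, Hc. apply Rabs_le. lra. }
      unfold ball_fun. rewrite HT in HD |- *. change (upd x 0 z O) with z. change (upd y 0 z' O) with z'.
      pose proof (Hu z Hz) as U1. pose proof (Hu z' Hz') as U2.
      assert (Lh : Rabs (u z - u z') <= Lu * h).
      { eapply Rle_trans; [now apply HL|]. now apply Rmult_le_compat_l. }
      assert (HLh : 0 <= Lu * h) by now apply Rmult_le_pos.
      unfold in_annulus. apply Rabs_le_between in HD.
      (* If just one of the two points lies in the ball, the coarse one has squared distance within
         [eta] of [r^2], so its node is in the annulus and the error [Um] is accounted for. *)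
      destruct (Rlt_dec _ (r ^ 2)) as [I1|I1]; destruct (Rlt_dec _ (r ^ 2)) as [I2|I2];
        destruct (Rle_dec _ eta) as [J|J]; try (rewrite Rminus_diag, Rabs_R0; lra);
        try (eapply Rle_trans; [exact Lh|lra]);
        try (apply Rabs_le; lra);
        exfalso; apply J, Rabs_le; lra.
  - apply Rle_trans with (sum_f_R0 (fun k => Lu * h * mesh R0 n) n
       + Um * sum_f_R0 (fun k => in_annulus (c O) (r ^ 2 - T) eta (node R0 n k) * mesh R0 n) n).
    + rewrite scal_sum, <- sum_plus. right. apply sum_eq. intros k _. ring.
    + rewrite sum_mesh. unfold slice_error. apply Rplus_le_compat_l.
      apply Rmult_le_compat_l; [exact HUm|]. now apply count_annulus.
Qed.

Lemma mesh_small (R0 d : R) : 0 <= R0 -> 0 < d -> exists n0, forall n, (n0 <= n)%nat -> mesh R0 n < d.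
Proof.
  intros HR Hd. destruct (INR_unbounded (2 * R0 / d)) as [n0 Hn0]. exists n0. intros n Hn.
  pose proof (INR_S_pos n). unfold mesh.
  assert (INR n0 <= INR (S n)) by (apply le_INR; lia).
  apply Rlt_div_l; [lra|]. apply Rlt_div_l in Hn0; [|lra]. nra.
Qed.

Lemma slice_error_small (N : nat) (R0 Lu Um eps : R) : 0 <= R0 -> 0 < eps ->
  exists d, 0 < d /\ forall h, 0 <= h < d -> slice_error N R0 Lu Um h < eps.
Proof.
  intros HR He.
  assert (C : continuity_pt (slice_error N R0 Lu Um) 0).
  { unfold slice_error. apply continuity_pt_plus; [reg|]. apply continuity_pt_mult; [reg|].
    apply continuity_pt_mult; [reg|]. apply continuity_pt_plus; [|reg].
    apply (continuity_pt_comp (fun h => 2 * (INR N * (4 * R0 * h))) sqrt); [reg|].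
    apply continuity_pt_sqrt. lra. }
  destruct (continuity_pt_eps _ _ eps C He) as [d [Hd K]].
  exists d. split; [exact Hd|]. intros h Hh.
  specialize (K h ltac:(apply Rabs_def1; lra)).
  assert (E0 : slice_error N R0 Lu Um 0 = 0).
  { unfold slice_error. rewrite !Rmult_0_r, sqrt_0. ring. }
  rewrite E0, Rminus_0_r in K. apply Rabs_def2 in K. lra.
Qed.

(** Grids [n] and [m] are both compared with their common refinement, so the sums are Cauchy.
    Convergence matters here: [lim_seq] of a divergent sequence is 0, which would ruin a lower
    bound. *)
Lemma ball_gsum_converges (N : nat) (c : pt) (r R0 Lu Um : R) (u : R -> R) :
  (1 <= N)%nat -> 0 <= R0 -> (forall i, (i < N)%nat -> Rabs (c i) <= R0) ->
  (forall z, Rabs z <= R0 -> 0 <= u z <= Um) -> 0 <= Lu ->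
  (forall z z', Rabs z <= R0 -> Rabs z' <= R0 -> Rabs (u z - u z') <= Lu * Rabs (z - z')) ->
  exists l, Un_cv (fun n => gsum N n R0 (ball_fun N c r u) (fun _ => 0)) l.
Proof.
  intros HN HR Hc Hu HLu HL. destruct N as [|d]; [lia|].
  set (V := (2 * R0) ^ d). assert (HV : 0 <= V) by (apply pow_le; lra).
  assert (Href : forall n m, Rabs (gsum (S d) n R0 (ball_fun (S d) c r u) (fun _ => 0)
     - gsum (S d) (refine n m) R0 (ball_fun (S d) c r u) (fun _ => 0)) <= slice_error (S d) R0 Lu Um (mesh R0 n) * V).
  { intros n m. apply (gsum_refine (S d) d n m); [exact HR|lia| |].
    - apply ball_slice_refine; auto.
    - intros i Hi. lia. }
  destruct (R_complete (fun n => gsum (S d) n R0 (ball_fun (S d) c r u) (fun _ => 0))) as [l Hl]; [|now exists l].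
  intros eps He.
  destruct (slice_error_small (S d) R0 Lu Um (eps / (2 * (V + 1))) HR) as [dl [Hdl Hs]].
  { apply Rdiv_lt_0_compat; lra. }
  destruct (mesh_small R0 dl HR Hdl) as [n0 Hn0].
  assert (Hsm : forall n m, (n0 <= n)%nat -> Rabs (gsum (S d) n R0 (ball_fun (S d) c r u) (fun _ => 0)
     - gsum (S d) (refine n m) R0 (ball_fun (S d) c r u) (fun _ => 0)) < eps / 2).
  { intros n m Hn. eapply Rle_lt_trans; [apply Href|].
    assert (Hx : slice_error (S d) R0 Lu Um (mesh R0 n) < eps / (2 * (V + 1))).
    { apply Hs. split; [now apply mesh_nonneg|now apply Hn0]. }
    assert (H2 : 0 < eps / (2 * (V + 1))) by (apply Rdiv_lt_0_compat; lra).
    replace (eps / 2) with (eps / (2 * (V + 1)) * (V + 1)) by (field; lra).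
    nra. }
  exists n0. intros n m Hn Hm. unfold Rdist.
  pose proof (Hsm n m Hn) as A1. pose proof (Hsm m n Hm) as A2. rewrite refine_comm in A2.
  apply Rabs_def2 in A1. apply Rabs_def2 in A2. apply Rabs_def1; lra.
Qed.

(** Only nodes in the cube are kept; in each direction they carry weight at least
    [rho/2 - mesh >= rho/4]. *)
Lemma gsum_cube_lower (N d n : nat) (c : pt) (R0 rho m0 : R) (F : pt -> R) (x : pt) :
  0 <= R0 -> 0 <= m0 -> 0 < rho -> mesh R0 n <= rho / 4 ->
  (forall i, (i < N)%nat -> - R0 <= c i + rho / 2 /\ c i + rho <= R0) ->
  (forall y, 0 <= F y) ->
  (forall y, (forall i, (i < N)%nat -> c i + rho / 2 <= y i <= c i + rho) -> m0 <= F y) ->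
  (d <= N)%nat -> (forall i, (d <= i < N)%nat -> c i + rho / 2 <= x i <= c i + rho) ->
  m0 * (rho / 4) ^ d <= gsum d n R0 F x.
Proof.
  intros HR Hm0 Hrho Hmesh Hc HF HFm. revert x. induction d as [|d IH]; intros x Hd Hx.
  - simpl. rewrite Rmult_1_r. apply HFm. intros i Hi. apply Hx. lia.
  - rewrite gsum_S.
    assert (HL : 0 <= m0 * (rho / 4) ^ d) by (apply Rmult_le_pos; [exact Hm0|apply pow_le; lra]).
    destruct (Hc d ltac:(lia)) as [Hc1 Hc2].
    pose proof (count_lower R0 (c d + rho / 2) (c d + rho) n HR Hc1 Hc2 ltac:(lra)) as Hcount.
    apply Rle_trans with (m0 * (rho / 4) ^ d
       * sum_f_R0 (fun k => in_itv (c d + rho / 2) (c d + rho) (node R0 n k) * mesh R0 n) n).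
    + simpl. replace (m0 * (rho / 4 * (rho / 4) ^ d)) with (m0 * (rho / 4) ^ d * (rho / 4)) by ring.
      apply Rmult_le_compat_l; [exact HL|lra].
    + rewrite scal_sum. apply sum_Rle. intros k _.
      pose proof (mesh_nonneg R0 n HR).
      replace (in_itv (c d + rho / 2) (c d + rho) (node R0 n k) * mesh R0 n * (m0 * (rho / 4) ^ d))
        with (m0 * (rho / 4) ^ d * in_itv (c d + rho / 2) (c d + rho) (node R0 n k) * mesh R0 n) by ring.
      apply Rmult_le_compat_r; [assumption|].
      pose proof (gsum_nonneg d n R0 F (upd x d (node R0 n k)) HR HF).
      unfold in_itv. destruct (Rle_dec _ (node R0 n k)) as [H1|H1]; [|lra].
      destruct (Rle_dec (node R0 n k) _) as [H2|H2]; [|lra].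
      rewrite Rmult_1_r. apply IH; [lia|]. intros i Hi.
      destruct (Nat.eq_dec i d) as [->|Hne]; [rewrite upd_eq; lra|].
      rewrite upd_neq by exact Hne. apply Hx. lia.
Qed.

(** With [rho = r/(2N)] the cube [c + [rho/2, rho]^N] lies in the ball, as [N rho^2 < r^2]. It is
    shifted forward in the first coordinate, so that it stays off the hyperplane even when the
    centre lies on it. *)
Lemma intBall_lower (N : nat) (c : pt) (r Lu : R) (u : R -> R) :
  (1 <= N)%nat -> 0 < r -> (forall z, 0 <= u z) -> (forall z z', z <= z' -> u z <= u z') -> 0 <= Lu ->
  (forall z z', Rabs z <= r + sumN N (fun i => Rabs (c i)) -> Rabs z' <= r + sumN N (fun i => Rabs (c i)) ->
     Rabs (u z - u z') <= Lu * Rabs (z - z')) ->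
  u (c O + r / (4 * INR N)) * (r / (8 * INR N)) ^ N <= intBall N c r (fun x => u (x O)).
Proof.
  intros HN Hr Hu0 Hmon HLu HL.
  set (R0 := r + sumN N (fun i => Rabs (c i))) in *.
  assert (Hci : forall i, (i < N)%nat -> Rabs (c i) + r <= R0).
  { intros i Hi. pose proof (sumN_term_le N (fun i => Rabs (c i)) i (fun j => Rabs_pos (c j)) Hi) as H.
    simpl in H. unfold R0. lra. }
  assert (HR : 0 <= R0) by (specialize (Hci O ltac:(lia)); pose proof (Rabs_pos (c O)); lra).
  assert (HNR : 1 <= INR N) by (apply (le_INR 1); exact HN).
  set (rho := r / (2 * INR N)).
  assert (Hrho : 0 < rho) by (apply Rdiv_lt_0_compat; lra).
  assert (Hrr : rho * (2 * INR N) = r) by (unfold rho; field; lra).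
  assert (Hrho2 : rho <= r / 2) by nra.
  replace (r / (4 * INR N)) with (rho / 2) by (unfold rho; field; lra).
  replace (r / (8 * INR N)) with (rho / 4) by (unfold rho; field; lra).
  destruct (ball_gsum_converges N c r R0 Lu (u R0) u) as [l Hl]; auto.
  { intros i Hi. specialize (Hci i Hi). lra. }
  { intros z Hz. split; [apply Hu0|]. apply Hmon. apply Rabs_le_between in Hz. lra. }
  change (intBall N c r (fun x => u (x O))) with (lim_seq (fun n => gsum N n R0 (ball_fun N c r u) (fun _ => 0))).
  rewrite (lim_seq_eq _ l Hl).
  destruct (mesh_small R0 (rho / 4) HR ltac:(lra)) as [n0 Hn0].
  apply Rnot_lt_le. intros Hlt.
  destruct (Hl (u (c O + rho / 2) * (rho / 4) ^ N - l) ltac:(lra)) as [n1 Hn1].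
  specialize (Hn1 (max n0 n1) ltac:(lia)). specialize (Hn0 (max n0 n1) ltac:(lia)).
  assert (u (c O + rho / 2) * (rho / 4) ^ N <= gsum N (max n0 n1) R0 (ball_fun N c r u) (fun _ => 0)).
  { apply (gsum_cube_lower N N (max n0 n1) c); auto; try lra.
    - intros i Hi. specialize (Hci i Hi). pose proof (Rle_abs (c i)). pose proof (Rle_abs (- c i)).
      rewrite Rabs_Ropp in *. lra.
    - intros y. unfold ball_fun. destruct (Rlt_dec _ _); [apply Hu0|lra].
    - intros y Hy. unfold ball_fun. destruct (Rlt_dec _ _) as [Hin|Hout].
      + apply Hmon. apply Hy. lia.
      + exfalso. apply Hout. apply Rle_lt_trans with (INR N * rho ^ 2).
        * rewrite <- sumN_const. apply sumN_le. intros i Hi. specialize (Hy i Hi). nra.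
        * rewrite <- Hrr. assert (0 < rho ^ 2) by nra. nra.
    - intros i Hi. lia. }
  unfold Rdist in Hn1. apply Rabs_def2 in Hn1. lra.
Qed.

(** Tube lemma: coordinates are freed one at a time, the first [j] ranging over [[-R0, R0]] while
    the others stay near [x]. *)
Lemma Cc_neg_bounded (N : nat) (psi : pt -> R) (R0 : R) :
  Cc_neg N psi R0 -> exists B, 0 <= B /\ forall x, Rabs (psi x) <= B.
Proof.
  intros [Hcont [HR [d [Hd Hsupp]]]].
  assert (P : forall j, (j <= N)%nat -> forall x, exists dl B, 0 < dl /\ 0 < B /\ forall y,
     (forall i, (i < j)%nat -> Rabs (y i) <= R0) ->
     (forall i, (j <= i < N)%nat -> Rabs (y i - x i) < dl) -> Rabs (psi y) <= B).
  { induction j as [|j IH]; intros Hj x.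
    - destruct (Hcont x 1 Rlt_0_1) as [dl [Hdl H]]. exists dl, (Rabs (psi x) + 1).
      pose proof (Rabs_pos (psi x)). split; [exact Hdl|split; [lra|]]. intros y _ Hy.
      specialize (H y ltac:(intros i Hi; apply Hy; lia)).
      pose proof (Rabs_triang_inv (psi y) (psi x)). lra.
    - assert (IHc : forall c, exists e : posreal, forall y,
        (forall i, (i < j)%nat -> Rabs (y i) <= R0) ->
        (forall i, (j <= i < N)%nat -> Rabs (y i - upd x j c i) < e) -> Rabs (psi y) <= / e).
      { intros c. destruct (IH ltac:(lia) (upd x j c)) as [dl [B [Hdl [HB H]]]].
        (* One number serves as a radius and, inverted, as a bound, so that the one-dimensional
           compactness lemma delivers both at once. *)
        assert (He : 0 < Rmin dl (/ B)) by (apply Rmin_glb_lt; [exact Hdl|now apply Rinv_0_lt_compat]).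
        exists (mkposreal _ He). simpl. intros y Hy1 Hy2.
        apply Rle_trans with B.
        - apply H; [exact Hy1|]. intros i Hi. eapply Rlt_le_trans; [now apply Hy2|apply Rmin_l].
        - rewrite <- (Rinv_inv B) at 1. apply Rinv_le_contravar; [exact He|apply Rmin_r]. }
      pose (e := fun c => proj1_sig (constructive_indefinite_description _ (IHc c))).
      assert (He : forall c y, (forall i, (i < j)%nat -> Rabs (y i) <= R0) ->
        (forall i, (j <= i < N)%nat -> Rabs (y i - upd x j c i) < e c) -> Rabs (psi y) <= / e c)
        by (intros c; exact (proj2_sig (constructive_indefinite_description _ (IHc c)))).
      destruct (compactness_value_1d (- R0) R0 e) as [dl Hdl].
      exists dl, (/ dl). pose proof (cond_pos dl) as Hp. split; [exact Hp|split; [now apply Rinv_0_lt_compat|]].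
      intros y Hy1 Hy2. apply Rnot_lt_le. intros Hlt.
      apply (Hdl (y j)); [apply Rabs_le_between, Hy1; lia|]. intros [c [Hc1 [Hc2 Hc3]]].
      assert (Rabs (psi y) <= / e c).
      { apply He; [intros i Hi; apply Hy1; lia|]. intros i Hi.
        destruct (Nat.eq_dec i j) as [->|Hne]; [rewrite upd_eq; exact Hc2|].
        rewrite upd_neq by exact Hne. eapply Rlt_le_trans; [apply Hy2; lia|exact Hc3]. }
      assert (/ e c <= / dl) by (apply Rinv_le_contravar; [exact Hp|exact Hc3]). lra. }
  destruct (P N (le_n N) (fun _ => 0)) as [dl [B [_ [HB H]]]].
  exists B. split; [lra|]. intros x.
  destruct (excluded_middle_informative (exists i, (i < N)%nat /\ R0 <= Rabs (x i))) as [E|E].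
  - rewrite Hsupp by now left. rewrite Rabs_R0. lra.
  - apply H; [|intros i Hi; lia]. intros i Hi. apply Rnot_lt_le. intros Hlt. apply E. exists i. split; [exact Hi|lra].
Qed.

(** * The self-similar solution *)

Lemma selfsimilar_profile (q : R) : 1 < q ->
  let a := (2 - q) / (q - 1) in
  exists f g : R -> R,
    (forall t, is_derive f t (g t) /\ is_derive g t (rhs q a t (f t) (g t)) /\ 0 < f t /\ 0 < g t) /\
    (forall s t, s <= t -> g s <= g t) /\
    (forall eps, 0 < eps -> exists M, forall eta, M < eta ->
        Rabs (Rpower eta (- (q / (q - 1))) * f eta
              - Rpower (q / (q - 1)) (- (q / (q - 1))) * Rpower (1 / (q - 1)) (1 / (q - 1))) < eps) /\
    (exists C, 0 < C /\
       forall eps, 0 < eps -> exists M, forall eta, eta < - M ->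
         Rabs (exp (eta ^ 2 / 4) * Rpower (- eta) (- ((3 - 2 * q) / (q - 1))) * f eta - C) < eps).
Proof.
  intros Hq a.
  assert (Ha : (a + 1) * (q - 1) = 1) by (unfold a; field; lra).
  set (S := 1 + 8 * Rabs a).
  set (K := S + 1 + 4 / (q - 1) + 2 * (Rabs (q - 2) / (q - 1))).
  pose proof (Rabs_pos a).
  assert (0 < 4 / (q - 1)) by (apply Rdiv_lt_0_compat; lra).
  assert (0 <= Rabs (q - 2) / (q - 1)) by (apply Rdiv_le_0_compat; [apply Rabs_pos|lra]).
  assert (HS1 : 1 <= S) by (unfold S; lra).
  assert (HS2 : 8 * Rabs a <= S) by (unfold S; lra).
  assert (HK1 : S + 1 <= K) by (unfold K; lra).
  destruct (global_profile q a S K Hq Ha HS1 HS2 HK1) as [f [g Hfg]]; [unfold K; lra|unfold K; lra|].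
  exists f, g. split; [|split; [|split]].
  - intros t. split; [apply Hfg|split; [apply Hfg|split; [|apply Hfg]]].
    now apply (f_pos q a S K f g).
  - now apply (g_incr q a S K f g).
  - now apply (profile_plus_infty q a S K Hq Ha HS1 HK1 f g).
  - now apply (profile_minus_infty q a S K Hq Ha HS1 HS2 f g).
Qed.

Lemma cont_Q_selfsimilar (N : nat) (al : R) (F : R -> R) :
  (1 <= N)%nat -> (forall z, continuity_pt F z) ->
  cont_Q N (fun x t => Rpower t al * F (x O / sqrt t)).
Proof.
  intros HN HF x t Ht eps He.
  assert (C : continuity_2d_pt (fun u v => Rpower v al * F (u * / sqrt v)) (x O) t).
  { apply continuity_2d_pt_mult.
    - apply (continuity_1d_2d_pt_comp (fun v => Rpower v al) (fun _ v => v)); [|apply continuity_2d_pt_id2].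
      eapply is_derive_continuity_pt, is_derive_Rpower, Ht.
    - apply (continuity_1d_2d_pt_comp F (fun u v => u * / sqrt v)); [apply HF|].
      apply continuity_2d_pt_mult; [apply continuity_2d_pt_id1|].
      apply (continuity_1d_2d_pt_comp (fun v => / sqrt v) (fun _ v => v)); [|apply continuity_2d_pt_id2].
      apply continuity_pt_inv; [apply continuity_pt_sqrt; lra|].
      pose proof (sqrt_lt_R0 t Ht). lra. }
  destruct (C (mkposreal eps He)) as [d Hd]. exists d. split; [apply cond_pos|].
  intros y s Hs Hst Hxy. apply Hd; [apply Hxy; lia|exact Hst].
Qed.

Lemma cont_Q_zero (N : nat) : cont_Q N (fun _ _ => 0).
Proof.
  intros x t Ht eps He. exists 1. split; [lra|]. intros. rewrite Rminus_diag, Rabs_R0. exact He.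
Qed.

Lemma sumN_single (N : nat) (h : nat -> R) : (1 <= N)%nat ->
  (forall i, h (S i) = 0) -> sumN N h = h O.
Proof.
  intros HN Hh. rewrite sumN_split0 by exact HN.
  rewrite (sumN_ext N _ (fun _ => 0)); [rewrite sumN_const; ring|].
  intros [|i] _; [reflexivity|apply Hh].
Qed.

Section SelfSimilar.

Context (N : nat) (q a : R) (f g : R -> R).
Context (HN : (1 <= N)%nat) (Hq : 1 < q) (Ha : a = (2 - q) / (q - 1)).
Context (Hfg : forall t, is_derive f t (g t) /\ is_derive g t (rhs q a t (f t) (g t)) /\ 0 < f t /\ 0 < g t).

Definition selfsim (x : pt) (t : R) : R := Rpower t (- a / 2) * f (x O / sqrt t).

Lemma is_derive_selfsim_space (al : R) (F dF : R -> R) (t z : R) :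
  0 < t -> (forall y, is_derive F y (dF y)) ->
  is_derive (fun s => Rpower t al * F (s / sqrt t)) z (Rpower t (al - 1 / 2) * dF (z / sqrt t)).
Proof.
  intros Ht HF. pose proof (sqrt_lt_R0 t Ht) as Hs.
  apply (is_derive_eq _ _ (Rpower t al * (/ sqrt t * dF (z / sqrt t)))).
  - apply (is_derive_scal (fun s => F (s / sqrt t))).
    apply (is_derive_comp F (fun s => s / sqrt t)); [apply HF|].
    auto_derive; [exact I|]. unfold Rdiv. ring.
  - unfold Rminus. rewrite Rpower_plus. replace (- (1 / 2)) with (- / 2) by field.
    rewrite Rpower_Ropp, Rpower_sqrt by exact Ht. ring.
Qed.

Lemma is_derive_selfsim_time (z t : R) : 0 < t ->
  is_derive (fun s => Rpower s (- a / 2) * f (z / sqrt s)) t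
    (Rpower t (- a / 2 - 1) * (- a / 2 * f (z / sqrt t) - z / sqrt t / 2 * g (z / sqrt t))).
Proof.
  intros Ht. pose proof (sqrt_lt_R0 t Ht) as Hs.
  assert (D1 : is_derive (fun s => f (z / sqrt s)) t (- (z / sqrt t / (2 * t)) * g (z / sqrt t))).
  { apply (is_derive_comp f (fun s => z / sqrt s)); [apply Hfg|].
    auto_derive; [split; [exact Ht|split; [lra|exact I]]|].
    rewrite <- (sqrt_sqrt t) at 5 by lra. field. lra. }
  pose proof (is_derive_Rpower t (- a / 2) Ht) as D2.
  apply (is_derive_eq _ _ ((- a / 2 * Rpower t (- a / 2 - 1)) * f (z / sqrt t)
           + Rpower t (- a / 2) * (- (z / sqrt t / (2 * t)) * g (z / sqrt t)))).
  - apply (is_derive_mult (fun s => Rpower s (- a / 2)) (fun s => f (z / sqrt s))); [exact D2|exact D1|].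
    intros n m. apply Rmult_comm.
  - rewrite (Rpower_pred t (- a / 2)) by exact Ht. field. lra.
Qed.

Lemma continuity_f (z : R) : continuity_pt f z.
Proof. exact (is_derive_continuity_pt f z _ (proj1 (Hfg z))). Qed.

Lemma continuity_g (z : R) : continuity_pt g z.
Proof. exact (is_derive_continuity_pt g z _ (proj1 (proj2 (Hfg z)))). Qed.

Lemma continuity_rhs (z : R) : continuity_pt (fun t => rhs q a t (f t) (g t)) z.
Proof.
  unfold rhs. apply continuity_pt_minus; [apply continuity_pt_minus|].
  - apply (continuity_pt_comp g (fun u => Rpower u q)); [apply continuity_g|].
    eapply is_derive_continuity_pt, is_derive_Rpower, Hfg.
  - apply continuity_pt_mult; [reg|apply continuity_g].
  - apply continuity_pt_mult; [reg|apply continuity_f].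
Qed.

Lemma selfsim_classical : classical_solution N q selfsim.
Proof.
  pose (k := fun t => rhs q a t (f t) (g t)).
  exists (fun x t => Rpower t (- a / 2 - 1) * (- a / 2 * f (x O / sqrt t) - x O / sqrt t / 2 * g (x O / sqrt t))).
  exists (fun i x t => match i with O => Rpower t (- a / 2 - 1 / 2) * g (x O / sqrt t) | _ => 0 end).
  exists (fun i j x t => match i, j with O, O => Rpower t (- a / 2 - 1 / 2 - 1 / 2) * k (x O / sqrt t) | _, _ => 0 end).
  split; [|split; [|split; [|split; [|split; [|split; [|split]]]]]].
  - apply cont_Q_selfsimilar; [exact HN|apply continuity_f].
  - apply (cont_Q_selfsimilar N _ (fun z => - a / 2 * f z - z / 2 * g z)); [exact HN|]. intros z.
    apply continuity_pt_minus; apply continuity_pt_mult; try apply continuity_f; try apply continuity_g; reg.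
  - intros [|i] _; [|apply cont_Q_zero]. apply cont_Q_selfsimilar; [exact HN|apply continuity_g].
  - intros [|i] [|j] _ _; try apply cont_Q_zero. apply cont_Q_selfsimilar; [exact HN|apply continuity_rhs].
  - intros x t Ht. apply is_derive_Reals. now apply is_derive_selfsim_time.
  - intros [|i] x t _ Ht.
    + apply is_derive_Reals. apply (is_derive_selfsim_space _ f g); [exact Ht|apply Hfg].
    + apply (derivable_pt_lim_const (selfsim x t)).
  - intros [|i] [|j] x t _ _ Ht; try apply (derivable_pt_lim_const 0).
    + apply is_derive_Reals. apply (is_derive_selfsim_space _ g k); [exact Ht|apply Hfg].
    + apply (derivable_pt_lim_const (Rpower t (- a / 2 - 1 / 2) * g (x O / sqrt t))).
  - intros x t Ht. rewrite !sumN_single by (try exact HN; intros; ring).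
    set (z := x O / sqrt t). destruct (Hfg z) as [_ [_ [_ Hg]]].
    assert (Hpos : 0 < Rpower t (- a / 2 - 1 / 2) * g z) by (apply Rmult_lt_0_compat; [apply Rpower_pos|exact Hg]).
    rewrite <- Rsqr_pow2, sqrt_Rsqr by lra. rewrite rpow_pos_eq by exact Hpos.
    rewrite <- Rpower_mult_distr by (try apply Rpower_pos; exact Hg).
    rewrite Rpower_mult.
    (* The value of [a] enters here: all three terms of the equation scale like [t^(-a/2-1)]. *)
    replace ((- a / 2 - 1 / 2) * q) with (- a / 2 - 1) by (rewrite Ha; field; lra).
    replace (- a / 2 - 1 / 2 - 1 / 2) with (- a / 2 - 1) by field.
    unfold k, rhs. field.
Qed.

(** * The initial trace *)

Lemma f_nondecr (s t : R) : s <= t -> f s <= f t.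
Proof.
  intros H. apply (nondecreasing_of_derive f g); [| |exact H]; intros x _; [apply Hfg|apply Rlt_le, Hfg].
Qed.

(** With [s = d / sqrt t] the factor [t^(-a/2)] is [d^(-a) s^a], while [f (-s)] is bounded by a
    multiple of [s^p exp (-s^2/4)]; the Gaussian wins against every power. *)
Lemma selfsim_vanishes (C : R) (d eps : R) :
  (forall e, 0 < e -> exists M, forall eta, eta < - M ->
     Rabs (exp (eta ^ 2 / 4) * Rpower (- eta) (- ((3 - 2 * q) / (q - 1))) * f eta - C) < e) ->
  0 < d -> 0 < eps ->
  exists t0, 0 < t0 /\ forall t, 0 < t < t0 -> Rpower t (- a / 2) * f (- d / sqrt t) < eps.
Proof.
  intros HC Hd He. destruct (HC 1 Rlt_0_1) as [M HM].
  (* The extra 1 in [m] buys a spare factor [1/s], which makes the final bound [A/s] small;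
     [4|m| <= s] gives [m ln s <= |m| s <= s^2/4]. *)
  set (p := (3 - 2 * q) / (q - 1)) in *. set (m := a + p + 1).
  set (A := (Rabs C + 1) * Rpower d (- a)).
  assert (HA : 0 < A) by (apply Rmult_lt_0_compat; [pose proof (Rabs_pos C); lra|apply Rpower_pos]).
  set (s0 := Rmax 1 (Rmax M (Rmax (4 * Rabs m) (A / eps)))).
  assert (B1 : 1 <= s0) by apply Rmax_l.
  assert (B2 : M <= s0) by (eapply Rle_trans; [|apply Rmax_r]; apply Rmax_l).
  assert (B3 : 4 * Rabs m <= s0)
    by (eapply Rle_trans; [|apply Rmax_r]; eapply Rle_trans; [|apply Rmax_r]; apply Rmax_l).
  assert (B4 : A / eps <= s0)
    by (eapply Rle_trans; [|apply Rmax_r]; eapply Rle_trans; [|apply Rmax_r]; apply Rmax_r).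
  exists ((d / s0) ^ 2). split; [apply pow_lt, Rdiv_lt_0_compat; lra|]. intros t [Ht Ht0].
  pose proof (sqrt_lt_R0 t Ht) as Hst.
  set (s := d / sqrt t).
  assert (Hss : s0 < s).
  { assert (sqrt t < d / s0).
    { rewrite <- (sqrt_pow2 (d / s0)) by (apply Rlt_le, Rdiv_lt_0_compat; lra). apply sqrt_lt_1_alt. lra. }
    unfold s. apply Rlt_div_r; [exact Hst|]. apply Rlt_div_r in H; [|lra]. lra. }
  replace (- d / sqrt t) with (- s) by (unfold s; field; lra).
  specialize (HM (- s) ltac:(lra)). rewrite Ropp_involutive in HM.
  replace ((- s) ^ 2) with (s ^ 2) in HM by ring.
  set (X := exp (s ^ 2 / 4) * Rpower s (- p)) in *.
  assert (HX : 0 < X) by (apply Rmult_lt_0_compat; [apply exp_pos|apply Rpower_pos]).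
  assert (Hf : X * f (- s) < Rabs C + 1).
  { apply Rabs_def2 in HM. pose proof (Rle_abs C). lra. }
  assert (Et : Rpower t (- a / 2) = Rpower d (- a) * Rpower s a).
  { assert (ln t = 2 * (ln d - ln s)).
    { unfold s, Rdiv. rewrite ln_mult, ln_Rinv by (try apply Rinv_0_lt_compat; lra).
      rewrite <- (sqrt_sqrt t) at 1 by lra. rewrite ln_mult by exact Hst. ring. }
    unfold Rpower. rewrite <- exp_plus. f_equal. rewrite H. field. }
  assert (Hexp : s * Rpower s a <= X).
  { assert (Hs1 : s * Rpower s a = Rpower s (a + 1)).
    { rewrite Rpower_plus, Rpower_1 by lra. ring. }
    rewrite Hs1. unfold X, Rpower. rewrite <- exp_plus. apply exp_le.
    enough (m * ln s <= s ^ 2 / 4) by (unfold m in *; lra).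
    assert (Hln : 0 <= ln s <= s).
    { split; [rewrite <- ln_1; apply Rlt_le, ln_increasing; lra|].
      pose proof (exp_ineq1_le (ln s)). rewrite exp_ln in H by lra. lra. }
    assert (m * ln s <= Rabs m * ln s) by (apply Rmult_le_compat_r; [lra|apply Rle_abs]).
    pose proof (Rabs_pos m). nra. }
  rewrite Et.
  destruct (Hfg (- s)) as [_ [_ [Hfp _]]].
  assert (H1 : s * (Rpower s a * f (- s)) < Rabs C + 1) by nra.
  pose proof (Rpower_pos d (- a)) as Hda.
  assert (H2 : s * (Rpower d (- a) * Rpower s a * f (- s)) < A).
  { unfold A. replace (s * (Rpower d (- a) * Rpower s a * f (- s)))
      with (s * (Rpower s a * f (- s)) * Rpower d (- a)) by ring.
    apply Rmult_lt_compat_r; assumption. }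
  apply Rmult_lt_reg_l with s; [lra|]. eapply Rlt_trans; [exact H2|].
  assert (Hfin : A / eps < s) by lra. apply (proj1 (Rlt_div_l A s eps He)) in Hfin. lra.
Qed.

(** Where [psi] is nonzero, [x_1 <= -d], and the monotonicity of [f] bounds the solution there by
    its single value at [-d]. *)
Lemma selfsim_trace_regular (C : R) (psi : pt -> R) (R0 : R) :
  (forall e, 0 < e -> exists M, forall eta, eta < - M ->
     Rabs (exp (eta ^ 2 / 4) * Rpower (- eta) (- ((3 - 2 * q) / (q - 1))) * f eta - C) < e) ->
  Cc_neg N psi R0 ->
  forall eps, 0 < eps -> exists d, 0 < d /\ forall t, 0 < t < d ->
    Rabs (intBox N R0 (fun x => selfsim x t * psi x)) < eps.
Proof.
  intros HC Hpsi eps He. destruct (Cc_neg_bounded N psi R0 Hpsi) as [B [HB Hb]].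
  destruct Hpsi as [_ [HR [d [Hd Hsupp]]]].
  assert (HV : 0 < (2 * R0) ^ N) by (apply pow_lt; lra).
  assert (HD : 0 < (B + 1) * (2 * R0) ^ N) by (apply Rmult_lt_0_compat; lra).
  destruct (selfsim_vanishes C d (eps / ((B + 1) * (2 * R0) ^ N)) HC Hd) as [t0 [Ht0 Hsmall]].
  { apply Rdiv_lt_0_compat; assumption. }
  exists t0. split; [exact Ht0|]. intros t Ht. specialize (Hsmall t Ht).
  set (e := Rpower t (- a / 2) * f (- d / sqrt t)) in *.
  assert (He0 : 0 < e) by (apply Rmult_lt_0_compat; [apply Rpower_pos|apply Hfg]).
  apply Rle_lt_trans with (e * B * (2 * R0) ^ N).
  - apply intBox_bound; [lra|]. intros y.
    destruct (Rlt_dec (- d) (y O)) as [Hy|Hy].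
    + rewrite (Hsupp y) by now right. rewrite Rmult_0_r, Rabs_R0. apply Rmult_le_pos; lra.
    + rewrite Rabs_mult. apply Rmult_le_compat; try apply Rabs_pos; [|apply Hb].
      unfold selfsim. pose proof (Rpower_pos t (- a / 2)) as Hp.
      destruct (Hfg (y O / sqrt t)) as [_ [_ [Hfp _]]].
      rewrite Rabs_right by (apply Rle_ge, Rmult_le_pos; lra).
      apply Rmult_le_compat_l; [lra|]. apply f_nondecr.
      apply Rmult_le_compat_r; [|lra]. apply Rlt_le, Rinv_0_lt_compat, sqrt_lt_R0. lra.
  - apply (proj2 (Rlt_div_r e eps _ HD)) in Hsmall. nra.
Qed.

(** Since [-a/2 - q'/2 = -1/(q-1)], the value is at least [(cq/2) b^q' t^(-1/(q-1))] for small
    [t]. *)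
Lemma selfsim_blows_up (b M cq : R) :
  0 < cq -> (forall e, 0 < e -> exists m, forall eta, m < eta ->
     Rabs (Rpower eta (- (q / (q - 1))) * f eta - cq) < e) ->
  0 < b -> exists t0, 0 < t0 /\ forall t, 0 < t < t0 -> M < Rpower t (- a / 2) * f (b / sqrt t).
Proof.
  intros Hcq Hlim Hb. destruct (Hlim (cq / 2) ltac:(lra)) as [m Hm].
  set (q' := q / (q - 1)) in *. set (A := cq / 2 * Rpower b q').
  assert (HA : 0 < A) by (apply Rmult_lt_0_compat; [lra|apply Rpower_pos]).
  set (M1 := Rabs M / A + 1).
  assert (HM1 : 0 < M1).
  { assert (0 <= Rabs M / A) by (apply Rdiv_le_0_compat; [apply Rabs_pos|exact HA]). unfold M1. lra. }
  set (m1 := Rabs m + 1). assert (Hm1 : 0 < m1) by (pose proof (Rabs_pos m); unfold m1; lra).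
  (* The first bound puts [b / sqrt t] where [f] exceeds half of its leading term; the second makes
     [t^(-1/(q-1)) > M1]. *)
  exists (Rmin ((b / m1) ^ 2) (Rpower M1 (- (q - 1)))).
  split; [apply Rmin_glb_lt; [apply pow_lt, Rdiv_lt_0_compat; lra|apply Rpower_pos]|].
  intros t [Ht Ht0].
  assert (T1 : t < (b / m1) ^ 2) by (eapply Rlt_le_trans; [exact Ht0|apply Rmin_l]).
  assert (T2 : t < Rpower M1 (- (q - 1))) by (eapply Rlt_le_trans; [exact Ht0|apply Rmin_r]).
  pose proof (sqrt_lt_R0 t Ht) as Hst. set (s := b / sqrt t).
  assert (Hs : m1 < s).
  { assert (sqrt t < b / m1).
    { rewrite <- (sqrt_pow2 (b / m1)) by (apply Rlt_le, Rdiv_lt_0_compat; lra). apply sqrt_lt_1_alt. lra. }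
    unfold s. apply Rlt_div_r; [exact Hst|]. apply Rlt_div_r in H; [|lra]. lra. }
  assert (Hms : m < s) by (pose proof (Rle_abs m); unfold m1 in Hs; lra).
  specialize (Hm s Hms). apply Rabs_def2 in Hm.
  assert (Hs0 : 0 < s) by lra.
  assert (Hf : cq / 2 * Rpower s q' < f s).
  { pose proof (Rpower_pos s q') as Hp.
    assert (E : Rpower s (- q') * Rpower s q' = 1).
    { rewrite <- Rpower_plus, Rplus_opp_l. now apply Rpower_O. }
    assert (cq / 2 * Rpower s q' < Rpower s (- q') * f s * Rpower s q') by (apply Rmult_lt_compat_r; lra).
    replace (Rpower s (- q') * f s * Rpower s q') with (f s * (Rpower s (- q') * Rpower s q')) in H by ring.
    rewrite E in H. lra. }
  pose proof (Rpower_pos t (- a / 2)) as Hta.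
  assert (E : Rpower t (- a / 2) * (cq / 2 * Rpower s q') = A * Rpower t (- (1 / (q - 1)))).
  { assert (Hln : ln s = ln b - ln t / 2).
    { unfold s, Rdiv. rewrite ln_mult, ln_Rinv by (try apply Rinv_0_lt_compat; lra).
      rewrite <- (sqrt_sqrt t) at 2 by lra. rewrite ln_mult by exact Hst. field. }
    unfold A.
    replace (Rpower t (- a / 2) * (cq / 2 * Rpower s q')) with (cq / 2 * (Rpower t (- a / 2) * Rpower s q')) by ring.
    rewrite Rmult_assoc. f_equal. unfold Rpower. rewrite <- !exp_plus. f_equal. rewrite Hln, Ha.
    unfold q'. field. lra. }
  assert (HP : M1 < Rpower t (- (1 / (q - 1)))).
  { assert (Hinv : Rpower (Rpower M1 (- (q - 1))) (- (1 / (q - 1))) = M1).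
    { rewrite Rpower_mult. replace (- (q - 1) * - (1 / (q - 1))) with 1 by (field; lra). now apply Rpower_1. }
    rewrite <- Hinv at 1. rewrite !(Rpower_Ropp _ (1 / (q - 1))).
    apply Rinv_lt_contravar; [apply Rmult_lt_0_compat; apply Rpower_pos|].
    apply Rlt_Rpower_l; [apply Rdiv_lt_0_compat; lra|lra]. }
  apply Rlt_trans with (A * Rpower t (- (1 / (q - 1)))).
  - apply Rlt_trans with (A * M1); [|now apply Rmult_lt_compat_l].
    unfold M1. replace (A * (Rabs M / A + 1)) with (Rabs M + A) by (field; lra).
    pose proof (Rle_abs M). lra.
  - rewrite <- E. now apply Rmult_lt_compat_l.
Qed.

Lemma selfsim_trace_singular (cq : R) (x0 : pt) (r M : R) :
  (forall s t, s <= t -> g s <= g t) ->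
  0 < cq -> (forall e, 0 < e -> exists m, forall eta, m < eta ->
     Rabs (Rpower eta (- (q / (q - 1))) * f eta - cq) < e) ->
  0 <= x0 O -> 0 < r ->
  exists d, 0 < d /\ forall t, 0 < t < d -> M < intBall N x0 r (fun x => selfsim x t).
Proof.
  intros Hmon Hcq Hlim Hx0 Hr.
  assert (HNR : 1 <= INR N) by (apply (le_INR 1); exact HN).
  (* [b] is the least first coordinate in the inscribed cube; it is positive even when
     [x0 O = 0]. *)
  set (b := x0 O + r / (4 * INR N)).
  assert (Hb : 0 < b) by (assert (0 < r / (4 * INR N)) by (apply Rdiv_lt_0_compat; lra); unfold b; lra).
  set (V := (r / (8 * INR N)) ^ N).
  assert (HV : 0 < V) by (apply pow_lt, Rdiv_lt_0_compat; lra).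
  destruct (selfsim_blows_up b (M / V) cq Hcq Hlim Hb) as [t0 [Ht0 Hbig]].
  exists t0. split; [exact Ht0|]. intros t Ht. specialize (Hbig t Ht).
  apply (proj1 (Rlt_div_l M _ V HV)) in Hbig. eapply Rlt_le_trans; [exact Hbig|].
  pose proof (sqrt_lt_R0 t ltac:(lra)) as Hst.
  set (R1 := r + sumN N (fun i => Rabs (x0 i))).
  pose (u := fun z => Rpower t (- a / 2) * f (z / sqrt t)).
  pose proof (Rpower_pos t (- a / 2)) as Hp.
  assert (Hdiv : forall z z', z <= z' -> z / sqrt t <= z' / sqrt t).
  { intros z z' H. apply Rmult_le_compat_r; [|exact H]. apply Rlt_le, Rinv_0_lt_compat, Hst. }
  (* As [g] is nondecreasing, its value at the right end of the box provides the Lipschitz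
     constant. *)
  apply (intBall_lower N x0 r (Rpower t (- a / 2 - 1 / 2) * g (R1 / sqrt t)) u HN Hr).
  - intros z. apply Rmult_le_pos; [lra|]. apply Rlt_le, Hfg.
  - intros z z' H. apply Rmult_le_compat_l; [lra|]. apply f_nondecr. now apply Hdiv.
  - apply Rmult_le_pos; [apply Rlt_le, Rpower_pos|apply Rlt_le, Hfg].
  - fold R1. intros z z' Hz Hz'.
    destruct (MVT_gen u z' z (fun y => Rpower t (- a / 2 - 1 / 2) * g (y / sqrt t))) as [c [Hc Eq]].
    + intros y _. apply (is_derive_selfsim_space _ f g); [lra|apply Hfg].
    + intros y _. eapply is_derive_continuity_pt, (is_derive_selfsim_space _ f g); [lra|apply Hfg].
    + rewrite Eq, Rabs_mult. apply Rmult_le_compat_r; [apply Rabs_pos|].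
      pose proof (Rpower_pos t (- a / 2 - 1 / 2)) as Hp2.
      destruct (Hfg (c / sqrt t)) as [_ [_ [_ Hg]]].
      rewrite Rabs_right by (apply Rle_ge, Rmult_le_pos; lra).
      apply Rmult_le_compat_l; [lra|]. apply Hmon, Hdiv.
      eapply Rle_trans; [apply Hc|]. apply Rabs_le_between in Hz, Hz'. apply Rmax_lub; lra.
Qed.

End SelfSimilar.

Theorem theorem1p3 (N : nat) (q : R) :
  (1 <= N)%nat -> 1 < q ->
  let q' := q / (q - 1) in
  let a := (2 - q) / (q - 1) in
  let cq := Rpower q' (- q') * Rpower (1 / (q - 1)) (1 / (q - 1)) in
  exists f : R -> R,
    C2 f /\ (forall eta, 0 < f eta) /\
    let U := fun (x : pt) (t : R) => Rpower t (- a / 2) * f (x O / sqrt t) in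
    classical_solution N q U /\
    (forall x t, 0 < t -> 0 < U x t) /\
    trace_halfspace N U /\
    (forall eps, 0 < eps -> exists M, forall eta, M < eta ->
        Rabs (Rpower eta (- q') * f eta - cq) < eps) /\
    (exists C, 0 < C /\
       forall eps, 0 < eps -> exists M, forall eta, eta < - M ->
         Rabs (exp (eta ^ 2 / 4) * Rpower (- eta) (- ((3 - 2 * q) / (q - 1))) * f eta - C) < eps).
Proof.
  intros HN Hq q' a cq.
  destruct (selfsimilar_profile q Hq) as [f [g [Hfg [Hmon [Hplus Hminus]]]]]. fold a in Hfg.
  destruct Hminus as [C [HC Hminus]].
  assert (Hcq : 0 < cq) by (apply Rmult_lt_0_compat; apply Rpower_pos).
  exists f. split; [|split; [|split; [|split; [|split; [|split]]]]].
  - exists g, (fun t => rhs q a t (f t) (g t)). split; [|split].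
    + intros x. apply is_derive_Reals, Hfg.
    + intros x. apply is_derive_Reals, Hfg.
    + intros x. now apply continuity_rhs.
  - intros eta. apply Hfg.
  - exact (selfsim_classical N q a f g HN Hq eq_refl Hfg).
  - intros x t _. apply Rmult_lt_0_compat; [apply Rpower_pos|apply Hfg].
  - split.
    + intros psi R0 Hpsi. exact (selfsim_trace_regular N q a f g Hfg C psi R0 Hminus Hpsi).
    + intros x0 r Hx0 Hr M.
      exact (selfsim_trace_singular N q a f g HN Hq eq_refl Hfg cq x0 r M Hmon Hcq Hplus Hx0 Hr).
  - exact Hplus.
  - exists C. split; [exact HC|exact Hminus].
Qed.
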